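(* Let $(Y,\mathfrak A,m)$ be a measurable space with a nonzero $\sigma$-finite measure $m$, and let $\beta:Y\to Y$ be a measurable mapping for which there is a constant $C$ with $m(\beta^{-1}(G))\le C\,m(G)$ for all $G\in\mathfrak A$. Let $1\le p<\infty$, let $T:L^p(Y,m)\to L^p(Y,m)$ be the shift operator $[Tf](x)=f(\beta(x))$, let $\psi\in L^\infty(Y,m)$, and let $\psi T:f\mapsto\psi\cdot Tf$ be the weighted shift operator on $L^p(Y,m)$. Then the spectral radius $r(\psi T)$ of $\psi T:L^p(Y,m)\to L^p(Y,m)$ satisfies $$\ln r(\psi T)=\max_{\mu\in M_\beta(Y,m)}\left(\int_Y\ln|\psi|\,d\mu+\frac{\tau(\mu)}{p}\right),$$ where $\tau(\mu)$ is the $t$-entropy assigned to the operator $A:L^\infty(Y,m)\to L^\infty(Y,m)$ defined by the identity $$\int_Y f\cdot (g\circ\beta)\,dm=\int_Y(Af)\,g\,dm,\qquad g\in L^1(Y,m),\ f\in L^\infty(Y,m).$$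
   Context: The spaces $L^p(Y,m)$, $L^\infty(Y,m)$ consist of real-valued functions; $r(\psi T)=\lim_n\|(\psi T)^n\|^{1/n}$ and $\ln0=-\infty$. $M_\beta(Y,m)$ is the set of all finitely additive probability measures $\mu$ on $\mathfrak A$ that vanish on sets of zero measure $m$ and satisfy $\mu(\beta^{-1}(G))=\mu(G)$ for all $G\in\mathfrak A$. Writing $\mu(f)=\int_Yf\,d\mu$ for $f\in L^\infty(Y,m)$, these are exactly the positive linear functionals $\mu$ on $L^\infty(Y,m)$ with $\mu(\mathbf 1)=1$ and $\mu(f\circ\beta)=\mu(f)$ for all $f\in L^\infty(Y,m)$. Meaning of the integral: let $X$ be the maximal ideal space of $L^\infty(Y,m)$, so that the Gelfand transform $f\mapsto\hat f$ identifies $L^\infty(Y,m)$ with $C(X)$ (real continuous functions on a compact Hausdorff space), and let $\hat\mu$ be the regular Borel probability measure on $X$ with $\int_X\hat f\,d\hat\mu=\mu(f)$. Then $\int_Y\ln|\psi|\,d\mu:=\int_X\ln|\hat\psi|\,d\hat\mu\in[-\infty,\infty)$. $t$-entropy: let $M(L^\infty)$ be the set of positive linear functionals $\nu$ on $L^\infty(Y,m)$ with $\nu(\mathbf 1)=1$; a partition of unity in $L^\infty(Y,m)$ is a finite set $D=\{g_1,\dots,g_k\}$ of nonnegative elements with $g_1+\dots+g_k=\mathbf 1$. For $\mu\in M_\beta(Y,m)$, $$\tau(\mu):=\inf_{n\in\mathbb N}\frac{\tau_n(\mu)}{n},\qquad \tau_n(\mu):=\inf_D\tau_n(\mu,D),\qquad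 \tau_n(\mu,D):=\sup_{\nu\in M(L^\infty)}\sum_{g\in D}\mu(g)\ln\frac{\nu(A^ng)}{\mu(g)},$$ the infimum being over all partitions of unity $D$ in $L^\infty(Y,m)$; a summand with $\mu(g)=0$ is set to be zero regardless of $\nu(A^ng)$; and if for some $g\in D$ one has $A^ng=0$ and $\mu(g)>0$, then $\tau(\mu)=-\infty$ (consistently with $\ln0=-\infty$). *)

(* Defs.v *)
From HB Require Import structures.
From mathcomp Require Import all_boot all_order all_algebra finmap.
From mathcomp Require Import all_classical all_reals all_analysis.
From mathcomp Require Import ess_sup_inf.

Set Implicit Arguments.
Unset Strict Implicit.
Unset Printing Implicit Defensive.
Import Order.TTheory GRing.Theory Num.Theory.
Import numFieldNormedType.Exports.
Local Open Scope classical_set_scope.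
Local Open Scope ring_scope.

(* The elements of [LspaceType m p1] are the classes of L^p modulo a.e.
   equality, but the library equips this type with no algebraic structure.  A
   class coerces to one of its representatives, so an identity between classes
   is written below as an a.e. identity between representatives. *)

Section LpOperators.
Context d (Y : measurableType d) (R : realType) (m : {measure set Y -> \bar R}).
Variables (p : \bar R) (p1 : (1 <= p)%E).

Definition Lnorm_op (S : LspaceType m p1 -> LspaceType m p1) : \bar R :=
  ereal_sup [set 'N[m]_p [EFin \o S f]%E
            | f in [set f : LspaceType m p1 | ('N[m]_p [EFin \o f] <= 1)%E]].

Definition spectral_radius (S : LspaceType m p1 -> LspaceType m p1) : \bar R :=
  limn (fun n => (Lnorm_op (iter n S) `^ n%:R^-1)%E).

End LpOperators.

Section Linfty.
Context d (Y : measurableType d) (R : realType) (m : {measure set Y -> \bar R}).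

Definition Linf := LspaceType m (leey 1%E).

HB.instance Definition _ := gen_eqMixin Linf.
HB.instance Definition _ := gen_choiceMixin Linf.

Definition linear_functional (phi : Linf -> R) : Prop :=
  forall (a : R) (f g h : Linf),
    (\forall y \ae m, (h y : R) = a * f y + g y) ->
    phi h = a * phi f + phi g.

Definition multiplicative_functional (phi : Linf -> R) : Prop :=
  forall f g h : Linf,
    (\forall y \ae m, (h y : R) = f y * g y) -> phi h = phi f * phi g.

Definition positive_functional (phi : Linf -> R) : Prop :=
  forall f : Linf, (\forall y \ae m, 0 <= (f y : R)) -> 0 <= phi f.

Definition unital_functional (phi : Linf -> R) : Prop :=
  forall f : Linf, (\forall y \ae m, (f y : R) = 1) -> phi f = 1.

Definition states : set (Linf -> R) :=
  [set nu | [/\ linear_functional nu, positive_functional nu &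
                unital_functional nu]].

(* A maximal ideal of L^oo is identified with the unique character whose kernel
   it is; the Gelfand topology is that of pointwise convergence on L^oo. *)
Definition characters : set {ptws Linf -> R} :=
  [set chi | [/\ linear_functional chi, multiplicative_functional chi &
                 unital_functional chi]].

Lemma characters_nonempty : m [set: Y] != 0%E -> characters !=set0.
Proof.
move=> m0.
have mpos : (0 < m [set: Y])%E by rewrite lt0e m0 measure_ge0.
have PF := ae_properfilter_algebraOfSetsType mpos.
have [G [UG FG]] := ultraFilterLemma PF.
have imU (f : Y -> R) : UltraFilter (f @ G).
  split; first exact: fmap_proper_filter.
  move=> H PH sH; rewrite predeqE => A; split; last exact: sH.
  move=> HA; have [//|GA] := in_ultra_setVsetC (f @^-1` A) UG.
  have HnA : H (~` A) by exact: sH.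
  have : H (A `&` ~` A) by exact: filterI.
  by rewrite setICr => /filter_not_empty.
have cvgf (f : Linf) : cvg ((f : Y -> R) @ G).
  have ff : finite_norm m +oo%E f := Lebesgue_finite.
  have [M Mf] : exists M : R, \forall y \ae m, `|f y : R| <= M.
    move: ff; rewrite /finite_norm unlock mpos /= => ff.
    have := ess_sup_ge m (abse \o (EFin \o f)).
    case: (ess_sup m (abse \o (EFin \o f))) ff => [r _|//|_] H.
      by exists r; apply: filterS H => y; rewrite /= lee_fin.
    by exists 0; apply: filterS H => y; rewrite /= leeNy_eq.
  have := @segment_compact R (- M) M.
  rewrite compact_ultra => /(_ _ (imU f)) []; last first.
    by move=> l [_ fl]; apply/cvg_ex; exists l.
  apply: FG; apply: filterS Mf => y; rewrite /= in_itv /= => h.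
  by rewrite -ler_norml.
exists (fun f => lim ((f : Y -> R) @ G)); split.
- move=> a f g h hE.
  apply/cvg_lim => //.
  have : (fun y => a * (f y : R) + g y) @ G -->
         a * lim ((f : Y -> R) @ G) + lim ((g : Y -> R) @ G).
    by apply: cvgD; [apply: cvgMl_tmp; exact: cvgf|exact: cvgf].
  apply: cvg_trans; apply: near_eq_cvg.
  by apply: FG; apply: filterS hE => y ->.
- move=> f g h hE.
  apply/cvg_lim => //.
  have : (fun y => (f y : R) * g y) @ G -->
         lim ((f : Y -> R) @ G) * lim ((g : Y -> R) @ G).
    by apply: cvgM; exact: cvgf.
  apply: cvg_trans; apply: near_eq_cvg.
  by apply: FG; apply: filterS hE => y ->.
- move=> f f1; apply/cvg_lim => //.
  have : (fun y : Y => 1 : R) @ G --> (1 : R) by exact: cvg_cst.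
  apply: cvg_trans; apply: near_eq_cvg.
  by apply: FG; apply: filterS f1 => y ->.
Qed.

(* The hypothesis on m is used only to make the space pointed, as required by
   [measurableType]. *)
Definition maxideal_space of m [set: Y] != 0%E : Type := set_type characters.

HB.instance Definition _ (m0 : m [set: Y] != 0%E) :=
  Topological.copy (maxideal_space m0) (set_type characters).
HB.instance Definition _ (m0 : m [set: Y] != 0%E) :=
  isPointed.Build (maxideal_space m0)
    (SigSub (mem_set (projT2 (cid (characters_nonempty m0))))).

Definition gelfand (m0 : m [set: Y] != 0%E) (f : Linf) :
  maxideal_space m0 -> R := fun chi => set_val chi f.
Arguments gelfand m0 f chi : clear implicits.

Definition borel_maxideal (m0 : m [set: Y] != 0%E) :=
  g_sigma_algebraType (@open (maxideal_space m0)).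

(* [integral] accepts any set function, being a difference of suprema of
   integrals of simple functions; for a finitely additive probability vanishing
   on m-null sets this is the usual integral on L^oo. *)
Definition fa_integral (mu : {content set Y -> \bar R}) (f : Linf) : R :=
  fine (\int[mu]_y (f y : R)%:E)%E.

Definition regular_measure (m0 : m [set: Y] != 0%E)
    (P : probability (borel_maxideal m0) R) : Prop :=
  forall B : set (borel_maxideal m0), measurable B ->
    P B = ereal_sup [set P K | K in
            [set K : set (maxideal_space m0) | compact K /\ K `<=` B]] /\
    P B = ereal_inf [set P U | U in
            [set U : set (maxideal_space m0) | open U /\ B `<=` U]].

(* The regular Borel probability on the maximal ideal space representing mu;
   [get] selects it, and it exists and is unique by the Riesz theorem. *)
Definition hat_measure (m0 : m [set: Y] != 0%E)
    (mu : {content set Y -> \bar R}) : probability (borel_maxideal m0) R :=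
  get [set P | regular_measure P /\
         forall f : Linf,
           (\int[P]_chi (gelfand m0 f chi)%:E)%E = (fa_integral mu f)%:E].

Definition integral_ln (m0 : m [set: Y] != 0%E)
    (mu : {content set Y -> \bar R}) (psi : Linf) : \bar R :=
  (\int[hat_measure m0 mu]_chi lne `|gelfand m0 psi chi|%:E)%E.

Definition invariant_fa_prob (beta : Y -> Y) : set {content set Y -> \bar R} :=
  [set mu | [/\ mu [set: Y] = 1%E,
      (forall G, measurable G -> m G = 0%E -> mu G = 0%E) &
      (forall G, measurable G -> mu (beta @^-1` G) = mu G)]].

Definition partition_of_unity (D : {fset Linf}) : Prop :=
  (forall g, g \in D -> \forall y \ae m, 0 <= (g y : R)) /\
  (\forall y \ae m, \sum_(g <- D) (g y : R) = 1).

Section t_entropy.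
Variables (A : Linf -> Linf) (mu : {content set Y -> \bar R}).

(* [lne] sends 0 to -oo. *)
Definition tau_nD (n : nat) (D : {fset Linf}) : \bar R :=
  ereal_sup [set (\sum_(g <- D)
      if fa_integral mu g == 0%R then 0
      else (fa_integral mu g)%:E *
           lne (nu (iter n A g) / fa_integral mu g)%:E)%E
    | nu in states].

Definition tau_n (n : nat) : \bar R :=
  ereal_inf [set tau_nD n D | D in partition_of_unity].

Definition t_entropy : \bar R :=
  ereal_inf [set (tau_n n / n%:R%:E)%E | n in [set n | (0 < n)%N]].

End t_entropy.

End Linfty.

(* Main.v *)
(* Put w = |psi|^p and w_N = \prod_(i < N) w \o beta^i. By duality, ||(psi T)^N||^p
   is the essential supremum of A^N w_N.

   Upper bound. For an invariant mu, evaluate tau_n on the level sets of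
   u = \sum_(i < n) ln w \o beta^i (truncated from below). Since ln x <= x - 1,
   tau_n(mu) <= ln ||A^n e^u|| - mu(u), and mu(u) = n p mu(ln |psi|).

   Lower bound. Suppose ||(psi T)^N|| >= e^(N L) for infinitely many N. Choose B_N
   of finite measure on which A^N w_N almost attains its supremum, average the
   normalized densities w_N (1_(B_N) \o beta^N) along beta and let Phi be an
   ultrafilter limit. If \int e^chi (g \o beta^n) <= \int g for all g >= 0, then
   Jensen's inequality along each residue class modulo n gives
   Phi(chi) <= n (Phi(ln w) - p L). Given a partition of unity D, this applies to
   chi = \sum_(g in D) s_g g - ln(A^n h) \o beta^n with
   s_g = ln (Phi(g) / Phi(A^n g)) and h = \sum_g e^(s_g) g, because e^chi times
   A^n h \o beta^n is at most h. It follows that the value at nu = Phi of the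
   expression maximized in tau_n(Phi, D) is at least n (p L - Phi(ln w)).

   The two bounds together also show that ||(psi T)^N||^(1/N) converges to its
   infimum. The integral of ln |psi| is reached by monotone truncation, the
   representing measure on the maximal ideal space being the outer measure built
   from the clopen sets {chi | chi(1_E) = 1}. *)

Require Import Defs.
From HB Require Import structures.
From mathcomp Require Import all_boot all_order all_algebra finmap.
From mathcomp Require Import all_classical all_reals all_analysis.
From mathcomp Require Import ess_sup_inf measurable_realfun.
From mathcomp Require Import lra ring zify.

Set Implicit Arguments.
Unset Strict Implicit.
Unset Printing Implicit Defensive.
Import Order.TTheory GRing.Theory Num.Theory.
Import numFieldNormedType.Exports.
Local Open Scope classical_set_scope.
Local Open Scope ring_scope.

(** * Essentially bounded functions and their means *)

(** States of $L^\infty$, characters, content integrals, normalized densities and ultrafilter limits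
    all fit one notion, [is_mean], and share its calculus on representatives; linearity and
    positivity of [A] are recovered by testing its duality identity on sets of finite measure. The
    t-entropy is an infimum over n and D, so one mean must serve all pairs at once. Hence the
    estimate for the limit mean is stated for every n and every subinvariant chi, with error
    constants independent of N, and only afterwards is chi built from D. Taking the state equal to
    the mean itself, with explicit weights s_g, replaces a minimax argument. Zeros of psi make ln
    |psi| unbounded below. The lower bound needs only w <= e^phi with phi bounded; the upper bound
    compares products of truncated and true weights additively, since their logarithms are not
    close. The maximum is attained and not merely approached: r is the infimum of the N-th roots of
    the norms, so for r > 0 the lower bound can be run with the exact rate ln r, and for r = 0 every
    value is -oo. *)

Section LspaceClasses.
Context d (Y : measurableType d) (R : realType) (m : {measure set Y -> \bar R}).

Lemma ae_eq_Lnorm (p : \bar R) (f g : Y -> R) : (1 <= p)%E ->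
  measurable_fun setT f -> measurable_fun setT g ->
  (\forall y \ae m, f y = g y) -> ('N[m]_p [EFin \o f] = 'N[m]_p [EFin \o g])%E.
Proof.
move=> p1 mf mg fg; rewrite unlock; case: p p1 => [p|_|//].
- move=> p1; congr (_ `^ _)%E.
  have mpow (h : Y -> R) : measurable_fun setT h ->
      measurable_fun setT (fun y => `|(EFin \o h) y| `^ p)%E.
    move=> mh; apply: (@measurableT_comp _ _ _ _ _ _ (@poweR R ^~ p)) => //.
      exact: measurable_poweR.
    by apply: measurableT_comp => //; exact/measurable_EFinP.
  apply: ae_eq_integral => //; [exact: mpow|exact: mpow|].
  by apply: filterS fg => y /= -> _.
- case: ifPn => // m0; apply: eq_ess_sup; apply: filterS fg => y /= -> //.
Qed.

Lemma Lspace_class (p : \bar R) (p1 : (1 <= p)%E) (f : Y -> R) :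
  measurable_fun setT f -> finite_norm m p f ->
  exists F : LspaceType m p1, \forall y \ae m, (F y : R) = f y.
Proof.
move=> mf ff.
pose mfc := @isMeasurableFun.Build _ _ Y (measurableTypeR R) f mf.
pose f' : {mfun Y >-> measurableTypeR R} := HB.pack f mfc.
pose F0 : {mfun_ m, Y >-> measurableTypeR R} := (\pi f')%qT.
have F0E : \forall y \ae m, (F0 y : R) = f y.
  have /eqP := reprK F0.
  by rewrite /F0 eqmodE => /asboolP; apply: filterS => y /= /(_ I).
have ffF : finite_norm m p F0.
  have mF0 : measurable_fun setT (repr F0 : Y -> R).
    exact: (@measurable_funPT _ _ _ _ (repr F0)).
  by rewrite /finite_norm (@ae_eq_Lnorm p F0 f).
pose Fc := @isFinLebesgue.Build _ Y R m p p1 F0 ffF.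
pose F : LspaceType m p1 := HB.pack F0 Fc.
by exists F.
Qed.


Definition essbounded (f : Y -> R) : Prop :=
  measurable_fun setT f /\ exists M : R, \forall y \ae m, `|f y| <= M.

Lemma essbounded_Linf (f : Linf m) : essbounded f.
Proof.
split; first exact: (@measurable_funPT _ _ _ _ (repr (f : {mfun_ m, Y >-> measurableTypeR R}))).
(* For the zero measure the sup-norm is 0 by convention and carries no essential supremum; every
   a.e. statement then holds trivially. *)
have [mY0|mpos] := leP (m setT) 0%E.
  exists 0; exists setT; split => //.
  by apply/eqP; rewrite eq_le mY0 measure_ge0.
have ff : finite_norm m +oo%E f := Lebesgue_finite.
move: ff; rewrite /finite_norm unlock mpos /= => ff.
have := ess_sup_ge m (abse \o (EFin \o f)).
case: (ess_sup m (abse \o (EFin \o f))) ff => [r _|//|_] H.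
  by exists r; apply: filterS H => y; rewrite /= lee_fin.
by exists 0; apply: filterS H => y; rewrite /= leeNy_eq.
Qed.

(** The class is asserted to exist before [f] is assumed essentially bounded, so that [cls] below
    can be a total function; other [f] receive the class of 0. *)
Lemma Linf_class (f : Y -> R) :
  exists F : Linf m, essbounded f -> \forall y \ae m, (F y : R) = f y.
Proof.
have [[mf [M fM]]|nf] := pselect (essbounded f); last first.
  have [|F _] := @Lspace_class +oo%E (leey 1%E) (cst 0) (@measurable_cst _ _ _ _ _ _).
    by rewrite /finite_norm (Lnorm0 m).
  by exists F => /nf.
have [|F FE] := @Lspace_class +oo%E (leey 1%E) f mf; last by exists F.
rewrite /finite_norm unlock; case: ifP => // mpos.
apply: (@le_lt_trans _ _ M%:E); last by rewrite ltry.
by apply/ess_supP; apply: filterS fM => y; rewrite /= lee_fin.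
Qed.

Definition cls (f : Y -> R) : Linf m := projT1 (cid (Linf_class f)).

Lemma clsE f : essbounded f -> \forall y \ae m, (cls f y : R) = f y.
Proof. by rewrite /cls; case: cid. Qed.

Lemma essbounded_cst (c : R) : essbounded (fun=> c).
Proof. by split => //; exists `|c|; near=> y. Unshelve. all: end_near. Qed.

Lemma essboundedD f g : essbounded f -> essbounded g ->
  essbounded (fun y => f y + g y).
Proof.
move=> [mf [M fM]] [mg [N gN]]; split; first exact: measurable_funD.
exists (M + N); apply: filterS2 fM gN => y fM gN.
by rewrite (le_trans (ler_normD _ _))// lerD.
Qed.

Lemma essboundedM f g : essbounded f -> essbounded g ->
  essbounded (fun y => f y * g y).
Proof.
move=> [mf [M fM]] [mg [N gN]]; split; first exact: measurable_funM.
exists (M * N); apply: filterS2 fM gN => y fM gN.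
by rewrite normrM ler_pM.
Qed.

Lemma essboundedZ a f : essbounded f -> essbounded (fun y => a * f y).
Proof. by move=> bf; apply: essboundedM => //; exact: essbounded_cst. Qed.

Lemma essboundedN f : essbounded f -> essbounded (fun y => - f y).
Proof.
by move=> /(essboundedZ (-1)); under eq_fun do rewrite mulN1r.
Qed.

Lemma essboundedB f g : essbounded f -> essbounded g ->
  essbounded (fun y => f y - g y).
Proof. by move=> bf bg; apply: essboundedD => //; exact: essboundedN. Qed.

Lemma essbounded_sum (I : Type) (s : seq I) (P : pred I) (F : I -> Y -> R) :
  (forall i, P i -> essbounded (F i)) ->
  essbounded (fun y => \sum_(i <- s | P i) F i y).
Proof.
move=> bF; elim: s => [|i s ih].
  by under eq_fun do rewrite big_nil; exact: essbounded_cst.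
under eq_fun do rewrite big_cons.
by case Pi: (P i) => //; apply: essboundedD => //; exact: bF.
Qed.

Lemma essbounded_prod (I : Type) (s : seq I) (P : pred I) (F : I -> Y -> R) :
  (forall i, P i -> essbounded (F i)) ->
  essbounded (fun y => \prod_(i <- s | P i) F i y).
Proof.
move=> bF; elim: s => [|i s ih].
  by under eq_fun do rewrite big_nil; exact: essbounded_cst.
under eq_fun do rewrite big_cons.
by case Pi: (P i) => //; apply: essboundedM => //; exact: bF.
Qed.

Lemma essbounded_indic (E : set Y) : measurable E -> essbounded (\1_E : Y -> R).
Proof.
move=> mE; split; first exact: measurable_indic.
exists 1; near=> y; rewrite indicE; case: (y \in E) => /=; rewrite ?normr0 ?normr1 //.
Unshelve. all: end_near. Qed.

Lemma essbounded_comp (phi : R -> R) f : continuous phi -> essbounded f ->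
  essbounded (fun y => phi (f y)).
Proof.
move=> cphi [mf [M fM]]; split.
  by apply: (measurableT_comp _ mf); exact: continuous_measurable_fun.
(* The extreme value theorem needs a nonempty segment; a negative [M] contradicts [0 <= |f y|]
   wherever the bound holds. *)
have [M0|M0] := leP 0 M; last first.
  exists 0; apply: filterS fM => y h.
  by have := lt_le_trans M0 (normr_ge0 (f y)); rewrite ltNge h.
have [||c _ cmax] := @EVT_max R (fun x => `|phi x|) (- M) M.
- by rewrite ge0_cp.
- apply: continuous_subspaceT => x; apply: continuous_comp; first exact: cphi.
  exact: norm_continuous.
exists `|phi c|; apply: filterS fM => y; rewrite ler_norml => fM.
by apply: cmax; rewrite in_itv.
Qed.

Lemma essbounded_expR f : essbounded f -> essbounded (fun y => expR (f y)).
Proof. by apply: essbounded_comp; exact: continuous_expR. Qed.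

Lemma essbounded_norm f : essbounded f -> essbounded (fun y => `|f y|).
Proof. by apply: essbounded_comp; exact: norm_continuous. Qed.

Lemma essbounded_ln f (c : R) : 0 < c -> essbounded f ->
  (forall y, c <= f y) -> essbounded (fun y => ln (f y)).
Proof.
move=> c0 [mf [M fM]] cf; split.
  by apply: (measurableT_comp _ mf); exact: measurable_ln.
exists (`|ln c| + `|ln M|); apply: filterS fM => y fM.
have fy0 : 0 < f y := lt_le_trans c0 (cf y).
have fyM : f y <= M by exact: le_trans (ler_norm _) fM.
have lb : ln c <= ln (f y) by rewrite ler_ln ?posrE// cf.
have ub : ln (f y) <= ln M.
  by rewrite ler_ln ?posrE//; exact: lt_le_trans fyM.
rewrite ler_norml; apply/andP; split.
- rewrite lerNl; apply: (le_trans (y := - ln c)); first by rewrite lerN2.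
  by rewrite (le_trans (ler_norm _))// normrN lerDl.
- by rewrite (le_trans ub)// (le_trans (ler_norm _))// lerDr.
Qed.

Lemma essbounded_max f (c : R) : essbounded f -> essbounded (fun y => Num.max (f y) c).
Proof.
by apply: (@essbounded_comp (fun x => Num.max x c)) => x; apply: continuous_max;
  [exact: cvg_id|exact: cvg_cst].
Qed.

(** A state of $L^\infty$ lifted to representatives. Nothing is prescribed off essentially bounded
    functions, and invariance under a.e. equality is a consequence of positivity. *)
Definition is_mean (Phi : (Y -> R) -> R) : Prop :=
  [/\ forall a f g, essbounded f -> essbounded g ->
        Phi (fun y => a * f y + g y) = a * Phi f + Phi g,
      forall f, essbounded f -> (\forall y \ae m, 0 <= f y) -> 0 <= Phi f &
      Phi (fun=> 1) = 1].

Section Mean.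
Variables (Phi : (Y -> R) -> R) (mPhi : is_mean Phi).

Lemma meanD f g : essbounded f -> essbounded g ->
  Phi (fun y => f y + g y) = Phi f + Phi g.
Proof.
case: mPhi => lin _ _ bf bg; rewrite -(mul1r (Phi f)) -lin//.
by congr Phi; apply/funext => y; rewrite mul1r.
Qed.

Lemma mean0 : Phi (fun=> 0) = 0.
Proof.
have b0 := essbounded_cst 0.
have := meanD b0 b0; under eq_fun do rewrite addr0.
by move/eqP; rewrite addrC -subr_eq subrr => /eqP.
Qed.

Lemma meanZ a f : essbounded f -> Phi (fun y => a * f y) = a * Phi f.
Proof.
case: mPhi => lin _ _ bf.
have := lin a f (fun=> 0) bf (essbounded_cst 0).
by rewrite mean0 addr0; under eq_fun do rewrite addr0.
Qed.

Lemma meanN f : essbounded f -> Phi (fun y => - f y) = - Phi f.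
Proof.
by move=> bf; rewrite -mulN1r -meanZ//; congr Phi; apply/funext => y; rewrite mulN1r.
Qed.

Lemma meanB f g : essbounded f -> essbounded g ->
  Phi (fun y => f y - g y) = Phi f - Phi g.
Proof. by move=> bf bg; rewrite meanD ?meanN//; exact: essboundedN. Qed.

Lemma mean_sum (I : Type) (s : seq I) (P : pred I) (F : I -> Y -> R) :
  (forall i, P i -> essbounded (F i)) ->
  Phi (fun y => \sum_(i <- s | P i) F i y) = \sum_(i <- s | P i) Phi (F i).
Proof.
move=> bF; elim: s => [|i s ih].
  by rewrite big_nil -[RHS]mean0; congr Phi; apply/funext => y; rewrite big_nil.
rewrite big_cons -ih; case Pi : (P i); last first.
  by congr Phi; apply/funext => y; rewrite big_cons Pi.
rewrite -meanD//; [|exact: bF|exact: essbounded_sum].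
by congr Phi; apply/funext => y; rewrite big_cons Pi.
Qed.

Lemma mean_cst c : Phi (fun=> c) = c.
Proof.
have := meanZ c (essbounded_cst 1).
by case: mPhi => _ _ ->; rewrite !mulr1.
Qed.

Lemma mean_ge0 f : essbounded f -> (\forall y \ae m, 0 <= f y) -> 0 <= Phi f.
Proof. by case: mPhi => _ + _; exact. Qed.

Lemma le_mean f g : essbounded f -> essbounded g ->
  (\forall y \ae m, f y <= g y) -> Phi f <= Phi g.
Proof.
move=> bf bg fg; rewrite -subr_ge0 -meanB//; apply: mean_ge0.
  exact: essboundedB.
by apply: filterS fg => y; rewrite subr_ge0.
Qed.

Lemma ae_eq_mean f g : essbounded f -> essbounded g ->
  (\forall y \ae m, f y = g y) -> Phi f = Phi g.
Proof.
move=> bf bg fg; apply/eqP; rewrite eq_le; apply/andP; split;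
  by apply: le_mean => //; apply: filterS fg => y ->.
Qed.

Lemma mean_le_cst f c : essbounded f -> (\forall y \ae m, f y <= c) -> Phi f <= c.
Proof.
move=> bf fc; rewrite -(mean_cst c); apply: le_mean => //; exact: essbounded_cst.
Qed.

Lemma mean_ge_cst f c : essbounded f -> (\forall y \ae m, c <= f y) -> c <= Phi f.
Proof.
move=> bf fc; rewrite -(mean_cst c); apply: le_mean => //; exact: essbounded_cst.
Qed.

Lemma mean_norm_le f c : essbounded f -> (\forall y \ae m, `|f y| <= c) ->
  `|Phi f| <= c.
Proof.
move=> bf fc; rewrite ler_norml; apply/andP; split.
  by apply: mean_ge_cst => //; apply: filterS fc => y; rewrite ler_norml => /andP[].
by apply: mean_le_cst => //; apply: filterS fc => y; rewrite ler_norml => /andP[].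
Qed.

(* Jensen, from the tangent line of the exponential at the mean value *)
Lemma expR_mean_le f : essbounded f -> expR (Phi f) <= Phi (fun y => expR (f y)).
Proof.
move=> bf; set c := Phi f.
have -> : expR c = Phi (fun y => expR c * (1 + (f y - c))).
  have bfc : essbounded (fun y => f y - c).
    by apply: essboundedB => //; exact: essbounded_cst.
  have b1 := essbounded_cst 1.
  rewrite meanZ ?meanD ?meanB ?mean_cst//; [|exact: essbounded_cst|exact: essboundedD].
  by rewrite -/c subrr addr0 mulr1.
apply: le_mean.
- apply: essboundedZ; apply: essboundedD; first exact: essbounded_cst.
  by apply: essboundedB => //; exact: essbounded_cst.
- exact: essbounded_expR.
- apply/nearW => y; rewrite -{2}(subrK c (f y)) expRD mulrC.
  by rewrite ler_pM2r ?expR_gt0// expR_ge1Dx.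
Qed.

(** Jensen for the exponential, applied to [ln f]; the floor [c] keeps [ln f] essentially
    bounded. *)
Lemma mean_ln_le f c : essbounded f -> 0 < c -> (forall y, c <= f y) ->
  Phi (fun y => ln (f y)) <= ln (Phi f).
Proof.
move=> bf c0 cf.
have blnf := essbounded_ln c0 bf cf.
have f0 : 0 < Phi f.
  by apply: lt_le_trans c0 _; apply: mean_ge_cst => //; apply/nearW.
rewrite -ler_expR lnK ?posrE//.
rewrite (le_trans (expR_mean_le blnf))//.
rewrite le_eqVlt; apply/orP; left; apply/eqP; congr Phi; apply/funext => y.
by rewrite lnK// posrE (lt_le_trans c0).
Qed.

End Mean.

Lemma state_mean nu : states nu -> is_mean (fun f => nu (cls f)).
Proof.
move=> [lin pos unit]; split.
- move=> a f g bf bg; apply: lin.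
  have bfg : essbounded (fun y => a * f y + g y).
    by apply: essboundedD => //; exact: essboundedZ.
  by apply: filterS3 (clsE bfg) (clsE bf) (clsE bg) => y -> -> ->.
- move=> f bf f0; apply: pos.
  by apply: filterS2 (clsE bf) f0 => y ->.
- by apply: unit; exact: clsE (essbounded_cst 1).
Qed.

Lemma mean_state Phi : is_mean Phi -> states (fun f : Linf m => Phi f).
Proof.
move=> mPhi; split.
- move=> a f g h hE.
  have bf := essbounded_Linf f; have bg := essbounded_Linf g.
  rewrite -meanZ// -meanD//; last exact: essboundedZ.
  apply: ae_eq_mean => //; first exact: essbounded_Linf.
  by apply: essboundedD => //; exact: essboundedZ.
- by move=> f f0; apply: mean_ge0 => //; exact: essbounded_Linf.
- move=> f f1; rewrite -[RHS](mean_cst mPhi 1); apply: ae_eq_mean => //.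
    exact: essbounded_Linf.
  exact: essbounded_cst.
Qed.

End LspaceClasses.

Import HBNNSimple.
(** * Finitely additive integrals *)

Section FinitelyAdditiveIntegral.
Context d (Y : measurableType d) (R : realType).

Lemma eq_of_le_eps (a b k : R) : (forall e, 0 < e -> `|a - b| <= k * e) -> a = b.
Proof.
move=> H; apply/eqP; rewrite -subr_eq0 -normr_le0; apply/ler_addgt0Pl => e e0.
rewrite addr0; have k0 : 0 < `|k| + 1 by rewrite ltr_pwDr.
apply: (le_trans (H (e / (`|k| + 1)) _)); first by rewrite divr_gt0.
rewrite mulrCA; apply: ler_piMr; first exact: ltW.
by rewrite ler_pdivrMr// mul1r (le_trans (ler_norm _))// lerDl.
Qed.

Section Labels.
Variable mu : {content set Y -> \bar R}.
Hypothesis mu1 : mu setT = 1%E.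

Lemma content_fin_num G : measurable G -> mu G \is a fin_num.
Proof.
move=> mG; rewrite ge0_fin_numE//.
by apply: le_lt_trans (ltry 1); rewrite -mu1 le_measure ?inE.
Qed.

Lemma content_fine G : measurable G -> mu G = (fine (mu G))%:E.
Proof. by move=> mG; rewrite fineK// content_fin_num. Qed.

Lemma fine_content_ge0 G : 0 <= fine (mu G).
Proof. exact: fine_ge0. Qed.

Lemma content_preimage (T : finType) (lab : Y -> T) (Q : pred T) :
  (forall t, measurable (lab @^-1` [set t])) ->
  mu (lab @^-1` [set t | Q t]) =
  (\sum_(t | Q t) fine (mu (lab @^-1` [set t])))%:E.
Proof.
move=> mlab.
have -> : lab @^-1` [set t | Q t] =
    \bigcup_(t in [set` [seq t <- enum T | Q t]]) (lab @^-1` [set t]).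
  apply/seteqP; split => y /=.
    by move=> Qy; exists (lab y) => //=; rewrite mem_filter Qy mem_enum.
  by move=> [t /=]; rewrite mem_filter => /andP[Qt _] ->.
rewrite measure_fin_bigcup//=.
- rewrite -fsbig_seq; last by rewrite filter_uniq// enum_uniq.
  rewrite big_filter big_enum_cond/= -sumEFin; apply: eq_bigr => t _.
  by rewrite -content_fine.
- by move=> i j _ _ [y [/= <- <-]].
Qed.

(* A simple function is written [c \o lab], with [lab] a measurable map into a
   finite type; this is its integral. *)
Definition label_sum (T : finType) (lab : Y -> T) (c : T -> R) : R :=
  \sum_t c t * fine (mu (lab @^-1` [set t])).

(** [sintegral] sums over values, and distinct labels may share a value, so the labels are regrouped
    by their value under [c]. *)
Lemma sintegral_label (T : finType) (lab : Y -> T) (c : T -> R) :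
  (forall t, measurable (lab @^-1` [set t])) ->
  sintegral mu (c \o lab) = (label_sum lab c)%:E.
Proof.
move=> mlab; rewrite /sintegral.
pose r := undup [seq c t | t : T].
have cr t : c t \in r by rewrite mem_undup; apply/mapP; exists t; rewrite ?mem_enum.
rewrite -(fsbig_widen [set` r] setT)//=; last first.
  move=> x [_ /= xr]; rewrite (_ : _ @^-1` _ = set0) ?measure0 ?mule0//.
  apply/seteqP; split => y //= cy; apply: xr; rewrite -cy; exact: cr.
rewrite -fsbig_seq ?undup_uniq//.
transitivity (\sum_(x <- r)
    (\sum_(t | c t == x) x * fine (mu (lab @^-1` [set t])))%:E)%E.
  apply: eq_bigr => x _.
  rewrite (_ : _ @^-1` _ = lab @^-1` [set t | c t == x]); last first.
    by apply/seteqP; split => y /= /eqP.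
  by rewrite content_preimage// -EFinM mulr_sumr.
rewrite sumEFin; congr EFin; rewrite /label_sum.
rewrite (exchange_big_dep xpredT)//=; apply: eq_bigr => t _.
rewrite (eq_bigl (pred1 (c t))); last by move=> x; rewrite /= eq_sym.
by rewrite -big_filter filter_pred1_uniq ?undup_uniq// big_seq1.
Qed.

(** A cell that meets [E] has its two coefficients compared there; a cell that misses [E] is
    null. *)
Lemma label_sum_nonneg_on (E : set Y) (T : finType) (lab : Y -> T) (c c' : T -> R) :
  (forall t, measurable (lab @^-1` [set t])) ->
  measurable E -> mu (~` E) = 0%E ->
  (forall y, E y -> c (lab y) <= c' (lab y)) -> label_sum lab c <= label_sum lab c'.
Proof.
move=> mlab mE E0 cc'; apply: ler_sum => t _.
have [|cE] := pselect (exists2 y, E y & lab y = t).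
  by move=> [y Ey <-]; rewrite ler_wpM2r ?fine_content_ge0// cc'.
rewrite (_ : mu _ = 0%E) ?mulr0//=.
apply: (subset_measure0 _ _ _ E0) => //; first exact: measurableC.
by move=> y /= yt Ey; apply: cE; exists y.
Qed.

Lemma measurable_label_pair (T T' : finType) (lab : Y -> T) (lab' : Y -> T') :
  (forall t, measurable (lab @^-1` [set t])) ->
  (forall t, measurable (lab' @^-1` [set t])) ->
  forall t, measurable ((fun y => (lab y, lab' y)) @^-1` [set t]).
Proof.
move=> mlab mlab' [t t'].
rewrite (_ : _ @^-1` _ = lab @^-1` [set t] `&` lab' @^-1` [set t']).
  exact: measurableI.
by apply/seteqP; split => y /= [-> ->].
Qed.

(** Both sums are rewritten over the common refinement, labelled by pairs. *)
Lemma le_label_sum (E : set Y) (T T' : finType) (lab : Y -> T) (lab' : Y -> T')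
    (c : T -> R) (c' : T' -> R) :
  (forall t, measurable (lab @^-1` [set t])) ->
  (forall t, measurable (lab' @^-1` [set t])) ->
  measurable E -> mu (~` E) = 0%E ->
  (forall y, E y -> c (lab y) <= c' (lab' y)) -> label_sum lab c <= label_sum lab' c'.
Proof.
move=> mlab mlab' mE E0 cc'.
have mp := measurable_label_pair mlab mlab'.
have -> : label_sum lab c = label_sum (fun y => (lab y, lab' y)) (c \o fst).
  by apply: EFin_inj; rewrite -!sintegral_label.
have -> : label_sum lab' c' = label_sum (fun y => (lab y, lab' y)) (c' \o snd).
  by apply: EFin_inj; rewrite -!sintegral_label.
exact: (label_sum_nonneg_on mp mE E0).
Qed.

Lemma nnsfun_label (h : {nnsfun Y >-> R}) :
  exists (T : finType) (lab : Y -> T) (c : T -> R),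
    (forall t, measurable (lab @^-1` [set t])) /\ (h : Y -> R) = c \o lab.
Proof.
have hin y : h y \in fset_set (range h).
  by rewrite in_fset_set ?inE//; exists y.
exists (fset_set (range h) : finType), (fun y => [` hin y]%fset), val; split => //.
move=> t; rewrite (_ : _ @^-1` _ = h @^-1` [set val t]).
  exact: measurable_funPTI.
by apply/seteqP; split => y /= => [<-//|hy]; exact/val_inj.
Qed.

Lemma label_nnsfun (T : finType) (lab : Y -> T) (c : T -> R) :
  (forall t, measurable (lab @^-1` [set t])) -> (forall t, 0 <= c t) ->
  exists h : {nnsfun Y >-> R}, (h : Y -> R) = c \o lab.
Proof.
move=> mlab c0.
have mcl : measurable_fun setT (c \o lab).
  move=> _ B mB; rewrite setTI.
  rewrite (_ : _ @^-1` _ =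
      \bigcup_(t in [set t | c t \in B]) lab @^-1` [set t]).
    apply: fin_bigcup_measurable => // ; exact: finite_finset.
  by apply/seteqP; split => y /= => [By|[t /= /set_mem + ->]//];
    exists (lab y) => //=; exact/mem_set.
have fcl : finite_set (range (c \o lab)).
  apply: (@sub_finite_set _ _ (c @` setT)); first by move=> _ [y _ <-]; exists (lab y).
  by apply: finite_image; exact: finite_finset.
pose h1 := isMeasurableFun.Build _ _ _ _ (c \o lab) mcl.
pose h2 := FiniteImage.Build _ _ (c \o lab) fcl.
pose h3 := isNonNegFun.Build _ _ (c \o lab) (fun y => c0 (lab y)).
pose h : {nnsfun Y >-> R} := HB.pack (c \o lab) h1 h2 h3.
by exists h.
Qed.

Lemma measurable_truncn_eq (g : Y -> R) (i : nat) : measurable_fun setT g ->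
  measurable [set y | Num.truncn (g y) = i].
Proof.
move=> mg.
have mle k : measurable [set y | (Num.truncn (g y) <= k)%N].
  rewrite (_ : mkset _ = g @^-1` `]-oo, k.+1%:R[).
    by rewrite -[X in measurable X]setTI; exact: mg.
  by apply/seteqP; split => y; rewrite /= in_itv/= truncn_le_nat.
case: i => [|i].
  rewrite (_ : mkset _ = [set y | (Num.truncn (g y) <= 0)%N])//.
  by apply/seteqP; split => y /=; rewrite leqn0 => /eqP.
rewrite (_ : mkset _ = [set y | (Num.truncn (g y) <= i.+1)%N] `\`
    [set y | (Num.truncn (g y) <= i)%N]); first exact: measurableD.
apply/seteqP; split => y /=.
  by move=> ->; split => //; rewrite ltnn.
by move=> [le1 /negP]; rewrite -ltnNge => lt1; apply/eqP; rewrite eqn_leq le1.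
Qed.

Lemma essbounded_label (m : {measure set Y -> \bar R}) (f : Y -> R) (e : R) :
  0 < e -> essbounded m f ->
  exists (T : finType) (lab : Y -> T) (c : T -> R) (E : set Y),
    [/\ forall t, measurable (lab @^-1` [set t]), measurable E, m (~` E) = 0%E &
        forall y, E y -> c (lab y) <= f y <= c (lab y) + e].
Proof.
move=> e0 [mf [M [N [mN N0 fN]]]].
pose g y := (f y + M) / e.
have mg : measurable_fun setT g.
  by apply: measurable_funM => //; exact: measurable_funD.
(* The range [-M, M] is cut into [K] intervals of length [e]; the label is the index of the interval
   containing [f y], and [None] collects the points outside the range. *)
pose K := (Num.truncn ((M + M) / e)).+1.
pose lab y : option 'I_K := insub (Num.truncn (g y)).
have mS (i : 'I_K) : measurable (lab @^-1` [set Some i]).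
  rewrite (_ : _ @^-1` _ = [set y | Num.truncn (g y) = i]).
    exact: measurable_truncn_eq.
  apply/seteqP; split => y /=; rewrite /lab.
    by case: insubP => // j _ <- [->].
  by move=> ->; rewrite valK.
exists (option 'I_K), lab,
  (fun t : option 'I_K => if t is Some i then i%:R * e - M else 0), (~` N); split.
- case=> [i|]; first exact: mS.
  rewrite (_ : _ @^-1` _ =
      ~` (\bigcup_(i in [set: 'I_K]) lab @^-1` [set Some i])).
    apply: measurableC; apply: fin_bigcup_measurable => //; exact: finite_finset.
  apply/seteqP; split => y /=; first by move=> labN [i _] /=; rewrite labN.
  by case E : (lab y) => [i|//] H; exfalso; apply: H; exists i.
- exact: measurableC.
- by rewrite setCK.
- move=> y Ny; have {Ny} : `|f y| <= M.
    by apply: contrapT => fM; apply: Ny; exact: fN.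
  rewrite ler_norml => /andP[fM1 fM2].
  have g0 : 0 <= g y by apply: divr_ge0; [lra|exact: ltW].
  have gK : (Num.truncn (g y) < K)%N.
    by rewrite ltnS le_truncn// ler_pM2r ?invr_gt0// lerD2r.
  rewrite /lab insubT/=.
  have /andP[g1 g2] := truncn_itv g0.
  have gE : g y * e = f y + M by rewrite /g divfK// gt_eqF.
  move: g1 (ltW g2); rewrite -natr1 -(ler_pM2r e0) -[X in _ -> is_true X -> _](ler_pM2r e0) gE.
  by rewrite mulrDl mul1r => g1 {}g2; apply/andP; split; lra.
Qed.

Local Open Scope ereal_scope.
Let nnint (g : Y -> \bar R) := ereal_sup [set sintegral mu h |
  h in [set h : {nnsfun Y >-> R} | forall x, (h x)%:E <= g x]].

Let integral_nnint (f : Y -> \bar R) :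
  \int[mu]_y f y = nnint f^\+ - nnint f^\-.
Proof. by rewrite /integral patch_setT. Qed.

Let nnint_le (E : set Y) (T : finType) (lab : Y -> T) (c : T -> R) g :
  (forall t, measurable (lab @^-1` [set t])) ->
  measurable E -> mu (~` E) = 0 -> (forall y, E y -> g y <= (c (lab y))%:E) ->
  nnint g <= (label_sum lab c)%:E.
Proof.
move=> mlab mE E0 gc; apply/ge_ereal_sup => _ [h /= hg <-].
have [T' [lab' [c' [mlab' hE]]]] := nnsfun_label h.
rewrite hE sintegral_label// lee_fin; apply: (le_label_sum mlab' mlab mE E0).
move=> y Ey; rewrite -lee_fin (le_trans _ (gc y Ey))//.
by have := hg y; rewrite hE.
Qed.

Let nnint_ge (E : set Y) (T : finType) (lab : Y -> T) (c : T -> R) g :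
  (forall t, measurable (lab @^-1` [set t])) ->
  measurable E -> mu (~` E) = 0 ->
  (forall t, 0 <= c t)%R -> (forall y, 0 <= g y) ->
  (forall y, E y -> (c (lab y))%:E <= g y) ->
  (label_sum lab c)%:E <= nnint g.
Proof.
move=> mlab mE E0 c0 g0 cg.
(* Off [E] only [0 <= g] is known, so the competing simple function is cut to 0 there. *)
pose lab' y := (lab y, y \in E); pose c' (t : T * bool) := if t.2 then c t.1 else 0%R.
have mlab' t : measurable (lab' @^-1` [set t]).
  apply: (@measurable_label_pair _ _ lab (fun y => y \in E)) => //.
  case; first by rewrite (_ : _ @^-1` _ = E)//;
    apply/seteqP; split => y /=; [move/set_mem|move/mem_set].
  rewrite (_ : _ @^-1` _ = ~` E); first exact: measurableC.
  by apply/seteqP; split => y /=; [move=> /negbT; rewrite notin_setE|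
    move=> nE; apply/negbTE; rewrite notin_setE].
have [h hE] := @label_nnsfun _ lab' c' mlab'
  (fun t => ltac:(by rewrite /c'; case: ifP)).
apply: (@le_trans _ _ (label_sum lab' c')%:E).
  rewrite lee_fin; apply: (le_label_sum mlab mlab' mE E0) => y Ey.
  by rewrite /c' /lab'/= mem_set.
rewrite -sintegral_label// -hE; apply: ereal_sup_ubound; exists h => //= y.
rewrite hE /= /c' /lab'/=; case: ifP => [/set_mem/cg//|_]; exact: g0.
Qed.
Local Close Scope ereal_scope.

Lemma label_sum_cst (T : finType) (lab : Y -> T) (k : R) :
  (forall t, measurable (lab @^-1` [set t])) -> label_sum lab (fun=> k) = k.
Proof.
move=> mlab; rewrite /label_sum -mulr_sumr.
have := content_preimage xpredT mlab.
rewrite (_ : _ @^-1` _ = setT); last by apply/seteqP; split.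
by rewrite mu1 => -[<-]; rewrite mulr1.
Qed.

Lemma label_sumD (T : finType) (lab : Y -> T) (c c' : T -> R) :
  label_sum lab (fun t => c t + c' t) = label_sum lab c + label_sum lab c'.
Proof. by rewrite -big_split/=; apply: eq_bigr => t _; rewrite mulrDl. Qed.

Lemma label_sumZ (T : finType) (lab : Y -> T) k (c : T -> R) :
  label_sum lab (fun t => k * c t) = k * label_sum lab c.
Proof. by rewrite [RHS]mulr_sumr; apply: eq_bigr => t _; rewrite mulrA. Qed.

Lemma integral_label (E : set Y) (T : finType) (lab : Y -> T) (c : T -> R)
    (f : Y -> R) (e : R) :
  (forall t, measurable (lab @^-1` [set t])) ->
  measurable E -> mu (~` E) = 0%E -> 0 <= e ->
  (forall y, E y -> `|f y - c (lab y)| <= e) ->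
  exists2 I : R, (\int[mu]_y (f y)%:E = I%:E)%E & `|I - label_sum lab c| <= e *+ 2.
Proof.
move=> mlab mE E0 e0 fc.
have fc' y : E y -> c (lab y) - e <= f y <= c (lab y) + e.
  by move=> /fc; rewrite ler_distl.
pose cp1 t := Num.max (c t - e) 0; pose cp2 t := Num.max (c t + e) 0.
pose cn1 t := Num.max (- c t - e) 0; pose cn2 t := Num.max (- c t + e) 0.
rewrite integral_nnint -/(EFin \o f).
have fp y : ((EFin \o f)^\+ y = (Num.max (f y) 0)%:E)%E by rewrite unlock /= EFin_max.
have fn y : ((EFin \o f)^\- y = (Num.max (- f y) 0)%:E)%E by rewrite unlock /= EFin_max.
have maxE (a b : R) : a <= b -> Num.max a 0 <= Num.max b 0.
  by move=> ab; rewrite ge_max !le_max ab lexx orbT.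
have P1 : ((label_sum lab cp1)%:E <= nnint (EFin \o f)^\+)%E.
  apply: (nnint_ge mlab mE E0) => [t|y|y /fc' /andP[h1 h2]].
  - by rewrite le_max lexx orbT.
  - by rewrite fp lee_fin le_max lexx orbT.
  - by rewrite fp lee_fin; exact: maxE.
have P2 : (nnint (EFin \o f)^\+ <= (label_sum lab cp2)%:E)%E.
  by apply: (nnint_le mlab mE E0) => y /fc' /andP[h1 h2]; rewrite fp lee_fin; exact: maxE.
have N1 : ((label_sum lab cn1)%:E <= nnint (EFin \o f)^\-)%E.
  apply: (nnint_ge mlab mE E0) => [t|y|y /fc' /andP[h1 h2]].
  - by rewrite le_max lexx orbT.
  - by rewrite fn lee_fin le_max lexx orbT.
  - by rewrite fn lee_fin; apply: maxE; lra.
have N2 : (nnint (EFin \o f)^\- <= (label_sum lab cn2)%:E)%E.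
  apply: (nnint_le mlab mE E0) => y /fc' /andP[h1 h2]; rewrite fn lee_fin; apply: maxE; lra.
have [Ip IpE] : exists I : R, (nnint (EFin \o f)^\+ = I%:E)%E.
  by case: (nnint _) P1 P2 => // r _ _; exists r.
have [In InE] : exists I : R, (nnint (EFin \o f)^\- = I%:E)%E.
  by case: (nnint _) N1 N2 => // r _ _; exists r.
rewrite IpE InE in P1 P2 N1 N2 *; move: P1 P2 N1 N2; rewrite !lee_fin => P1 P2 N1 N2.
exists (Ip - In) => //; rewrite ler_distl.
have S2 := label_sum_cst (e *+ 2) mlab.
(* Termwise, x^+ - x^- = x at x = c + e pairs [cp2] with [cn1]; the next estimate does the same at x
   = c - e. *)
have U : label_sum lab cp2 <= label_sum lab cn1 + (label_sum lab c + e *+ 2).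
  rewrite -{1}S2 -!label_sumD; apply: ler_sum => t _; rewrite ler_wpM2r ?fine_content_ge0//.
  rewrite /cp2 /cn1 /Num.max; case: ltP => ?; case: ltP => ?; lra.
have L : label_sum lab cn2 + label_sum lab c <= label_sum lab cp1 + e *+ 2.
  rewrite -{1}S2 -!label_sumD; apply: ler_sum => t _; rewrite ler_wpM2r ?fine_content_ge0//.
  rewrite /cn2 /cp1 /Num.max; case: ltP => ?; case: ltP => ?; lra.
apply/andP; split; lra.
Qed.

End Labels.

Definition content_mean (mu : {content set Y -> \bar R}) (f : Y -> R) : R :=
  fine (\int[mu]_y (f y)%:E)%E.

Lemma null_setCI (m : {measure set Y -> \bar R}) (E F : set Y) :
  measurable E -> measurable F -> m (~` E) = 0%E -> m (~` F) = 0%E ->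
  m (~` (E `&` F)) = 0%E.
Proof.
move=> mE mF E0 F0; rewrite setCI measureU0//; exact: measurableC.
Qed.

Section ContentMean.
Variables (m : {measure set Y -> \bar R}) (mu : {content set Y -> \bar R}).
Hypothesis mu1 : mu setT = 1%E.
Hypothesis mu0 : forall G, measurable G -> m G = 0%E -> mu G = 0%E.

Lemma content_mean_approx (f : Y -> R) (T : finType) (lab : Y -> T) (c : T -> R)
    (E : set Y) (e : R) :
  (forall t, measurable (lab @^-1` [set t])) ->
  measurable E -> m (~` E) = 0%E -> 0 <= e ->
  (forall y, E y -> `|f y - c (lab y)| <= e) ->
  `|content_mean mu f - label_sum mu lab c| <= e *+ 2.
Proof.
move=> mlab mE E0 e0 fc; rewrite /content_mean.
have E0' : mu (~` E) = 0%E by apply: mu0 => //; exact: measurableC.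
by have [I -> H] := integral_label mu1 mlab mE E0' e0 fc.
Qed.

Lemma essbounded_label2 (f g : Y -> R) (e : R) :
  0 < e -> essbounded m f -> essbounded m g ->
  exists (T : finType) (lab : Y -> T) (c c' : T -> R) (E : set Y),
    [/\ forall t, measurable (lab @^-1` [set t]), measurable E, m (~` E) = 0%E,
        forall y, E y -> `|f y - c (lab y)| <= e &
        forall y, E y -> `|g y - c' (lab y)| <= e].
Proof.
move=> e0 bf bg.
have [T [lab [c [E [mlab mE E0 fE]]]]] := essbounded_label e0 bf.
have [T' [lab' [c' [E' [mlab' mE' E0' gE]]]]] := essbounded_label e0 bg.
exists (T * T')%type, (fun y => (lab y, lab' y)), (c \o fst), (c' \o snd), (E `&` E').
split.
- exact: measurable_label_pair.
- exact: measurableI.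
- exact: null_setCI.
- by move=> y [/fE /andP[h1 h2] _] /=; rewrite ler_distl; apply/andP; split; lra.
- by move=> y [_ /gE /andP[h1 h2]] /=; rewrite ler_distl; apply/andP; split; lra.
Qed.

(** Linearity and positivity are read off a common labelling of the functions involved, up to an
    error proportional to [e]. *)
Lemma is_mean_content_mean : is_mean m (content_mean mu).
Proof.
split.
(* The combination is approximated within (|a| + 1) e, hence its integral within twice that; the
   separate integrals of [f] and [g] contribute another 2 |a| e + 2 e. *)
- move=> a f g bf bg; apply: (@eq_of_le_eps _ _ (4 * `|a| + 4)) => e e0.
  have [T [lab [c [c' [E [mlab mE E0 fE gE]]]]]] := essbounded_label2 e0 bf bg.
  have := content_mean_approx mlab mE E0 (ltW e0) fE.
  have := content_mean_approx mlab mE E0 (ltW e0) gE.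
  have : forall y, E y -> `|(a * f y + g y) - (a * c (lab y) + c' (lab y))| <= (`|a| + 1) * e.
    move=> y Ey; rewrite opprD addrACA -mulrBr (le_trans (ler_normD _ _))//.
    by rewrite mulrDl mul1r lerD ?gE// normrM ler_wpM2l// fE.
  have ae0 : 0 <= (`|a| + 1) * e by rewrite mulr_ge0 ?ltW// ltr_wpDl.
  move=> /(@content_mean_approx _ _ _ (fun t => a * c t + c' t) _ _ mlab mE E0 ae0).
  rewrite label_sumD label_sumZ.
  set I1 := content_mean _ _; set I2 := content_mean _ _; set I3 := content_mean _ _.
  set S1 := label_sum _ _ _; set S2 := label_sum _ _ _.
  move=> h1 h2 h3.
  have -> : I1 - (a * I3 + I2) =
      (I1 - (a * S1 + S2)) - (a * (I3 - S1) + (I2 - S2)) by ring.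
  rewrite (le_trans (ler_normB _ _))//.
  have h4 : `|a * (I3 - S1) + (I2 - S2)| <= `|a| * (e *+ 2) + e *+ 2.
    by rewrite (le_trans (ler_normD _ _))// lerD// normrM ler_wpM2l.
  rewrite (le_trans (lerD h1 h4))//.
  by rewrite le_eqVlt; apply/orP; left; apply/eqP; ring.
- move=> f bf f0; apply/ler_addgt0Pl => e e0.
  have e0' : 0 < e / 3 by rewrite divr_gt0.
  have [T [lab [c [_ [E [mlab mE E0 fE _]]]]]] := essbounded_label2 e0' bf bf.
  have := content_mean_approx mlab mE E0 (ltW e0') fE.
  rewrite ler_distl => /andP[+ _].
  have [N [mN N0 fN]] := f0.
  have : label_sum mu lab (fun=> - (e / 3)) <= label_sum mu lab c.
    apply: (@label_sum_nonneg_on mu (E `&` ~` N)) => //.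
    - by apply: measurableI => //; exact: measurableC.
    - apply: mu0; first by apply: measurableC; apply: measurableI => //; exact: measurableC.
      by apply: null_setCI => //; [exact: measurableC|rewrite setCK].
    - move=> y [Ey Ny]; have := fE _ Ey; rewrite ler_distl => /andP[h1 h2].
      have : 0 <= f y by apply: contrapT => fM; apply: Ny; exact: fN.
      by move: h1 h2; lra.
  rewrite label_sum_cst//; lra.
- apply: (@eq_of_le_eps _ _ 2) => e e0.
  have mlab : forall t, measurable ((fun=> tt) @^-1` [set t] : set Y).
    by case; rewrite (_ : _ @^-1` _ = setT)//; apply/seteqP; split.
  have := @content_mean_approx (fun=> 1) unit (fun=> tt) (fun=> 1) setT 0 mlab
    measurableT _ (lexx 0).
  rewrite setCT measure0 label_sum_cst// mul0rn => /(_ erefl) H.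
  apply: (le_trans (H _)); last by rewrite mulr_ge0// ltW.
  by move=> y _; rewrite subrr normr0.
Qed.

Lemma ae_eq_content_mean (f g : Y -> R) : essbounded m g ->
  (\forall y \ae m, f y = g y) -> content_mean mu f = content_mean mu g.
Proof.
move=> bg [N [mN N0 fN]]; apply: (@eq_of_le_eps _ _ 4) => e e0.
have [T [lab [c [_ [E [mlab mE E0 gE _]]]]]] := essbounded_label2 e0 bg bg.
have mE' : measurable (E `&` ~` N) by apply: measurableI => //; exact: measurableC.
have E0' : m (~` (E `&` ~` N)) = 0%E.
  by apply: null_setCI => //; [exact: measurableC|rewrite setCK].
have := content_mean_approx mlab mE E0 (ltW e0) gE.
have := @content_mean_approx f _ _ c _ _ mlab mE' E0' (ltW e0).
move=> /(_ _)/wrap[|h1 h2].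
  move=> y [Ey Ny]; have -> : f y = g y by apply: contrapT => fM; apply: Ny; exact: fN.
  exact: gE.
move: h1 h2; rewrite !ler_distl => /andP[? ?] /andP[? ?]; apply/andP; split; lra.
Qed.

Lemma content_mean_indic (G : set Y) : measurable G ->
  content_mean mu (\1_G) = fine (mu G).
Proof.
move=> mG; apply: (@eq_of_le_eps _ _ 4) => e e0.
pose lab y := y \in G.
have mlab t : measurable (lab @^-1` [set t]).
  case: t; first by rewrite (_ : _ @^-1` _ = G)//;
    apply/seteqP; split => y /=; [move/set_mem|move/mem_set].
  rewrite (_ : _ @^-1` _ = ~` G); first exact: measurableC.
  by apply/seteqP; split => y /=; [move=> /negbT; rewrite notin_setE|
    move=> nE; apply/negbTE; rewrite notin_setE].
have := @content_mean_approx (\1_G) _ lab (fun b => b%:R) setT 0 mlab measurableT _ (lexx 0).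
rewrite setCT measure0 mul0rn => /(_ erefl)/(_ _)/wrap[|].
  by move=> y _; rewrite indicE subrr normr0.
rewrite /label_sum big_bool/= mul1r mul0r addr0 (_ : lab @^-1` _ = G).
  by move=> /le_trans; apply; rewrite mulr_ge0// ltW.
by apply/seteqP; split => y /=; [move/set_mem|move/mem_set].
Qed.

End ContentMean.

Lemma comp_labelE (T : finType) (lab : Y -> T) (c : T -> R) :
  c \o lab = fun y => \sum_t c t * \1_(lab @^-1` [set t]) y.
Proof.
apply/funext => y; rewrite (bigD1 (lab y))//= big1 ?addr0.
  by rewrite indicE mem_set// mulr1.
move=> t tl; rewrite indicE memNset ?mulr0//= => ltE.
by rewrite ltE eqxx in tl.
Qed.

Lemma essbounded_comp_label (m : {measure set Y -> \bar R}) (T : finType)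
    (lab : Y -> T) (c : T -> R) :
  (forall t, measurable (lab @^-1` [set t])) -> essbounded m (c \o lab).
Proof.
move=> mlab; rewrite comp_labelE.
by apply: essbounded_sum => t _; exact/essboundedZ/essbounded_indic.
Qed.

Section MeanContent.
Variables (m : {measure set Y -> \bar R}) (Phi : (Y -> R) -> R).
Hypothesis mPhi : is_mean m Phi.

Lemma mean_indicU A B : measurable A -> measurable B -> A `&` B = set0 ->
  Phi \1_(A `|` B) = Phi \1_A + Phi \1_B.
Proof.
move=> mA mB AB; rewrite -(meanD mPhi); [|exact: essbounded_indic|exact: essbounded_indic].
congr Phi; apply/funext => y; rewrite !indicE in_setU.
have : (y \in A `&` B) = false by rewrite AB in_set0.
by rewrite in_setI; case: (y \in A); case: (y \in B) => //= _; rewrite ?addr0 ?add0r.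
Qed.

Lemma mean_label (T : finType) (lab : Y -> T) (c : T -> R) :
  (forall t, measurable (lab @^-1` [set t])) ->
  Phi (c \o lab) = \sum_t c t * Phi \1_(lab @^-1` [set t]).
Proof.
move=> mlab; rewrite comp_labelE (mean_sum mPhi); last by move=> t _; exact/essboundedZ/essbounded_indic.
by apply: eq_bigr => t _; rewrite (meanZ mPhi)//; exact: essbounded_indic.
Qed.

(** A content must be nonnegative on all sets, while [Phi] is controlled only on measurable
    functions: hence the default 0. *)
Let muPhi (G : set Y) : \bar R :=
  (if pselect (measurable G) is left _ then Phi \1_G else 0)%:E.

Let muPhiE G : measurable G -> muPhi G = (Phi \1_G)%:E.
Proof. by move=> mG; rewrite /muPhi; case: pselect. Qed.

Let muPhi_ge0 G : (0 <= muPhi G)%E.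
Proof.
rewrite /muPhi; case: pselect => // mG; rewrite lee_fin; apply: (mean_ge0 mPhi).
  exact: essbounded_indic.
by apply/nearW.
Qed.

Let muPhi0 : muPhi set0 = 0%E.
Proof. by rewrite muPhiE// indic0 (mean0 mPhi). Qed.

Let muPhi_additive : measure_function.semi_additive muPhi.
Proof.
apply/(additive2P muPhi0) => A B mA mB AB.
by rewrite !muPhiE ?mean_indicU//; exact: measurableU.
Qed.

HB.instance Definition _ := isContent.Build _ _ _ muPhi muPhi_ge0 muPhi_additive.

(** The converse of [is_mean_content_mean]: means and contents vanishing on null sets are the same
    objects. It turns the ultrafilter limit into a member of the set over which the maximum is
    taken. *)
Lemma mean_content : exists mu : {content set Y -> \bar R},
  [/\ mu setT = 1%E, (forall G, measurable G -> m G = 0%E -> mu G = 0%E),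
      (forall G, measurable G -> mu G = (Phi \1_G)%:E) &
      forall f, essbounded m f -> content_mean mu f = Phi f].
Proof.
pose mu : {content set Y -> \bar R} := muPhi; exists mu.
have mu1 : mu setT = 1%E.
  by rewrite [LHS]muPhiE// indicT; case: mPhi => _ _ ->.
have mu0 G : measurable G -> m G = 0%E -> mu G = 0%E.
  move=> mG G0; rewrite [LHS]muPhiE//; congr EFin.
  rewrite -[RHS](mean0 mPhi); apply: (ae_eq_mean mPhi).
  - exact: essbounded_indic.
  - exact: essbounded_cst.
  - exists G; split => // y /= yG; apply: contrapT => nG; apply: yG.
    by rewrite indicE memNset.
split => // f bf; apply: (@eq_of_le_eps _ _ 3) => e e0.
have [T [lab [c [_ [E [mlab mE E0 fE _]]]]]] := essbounded_label2 e0 bf bf.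
have := content_mean_approx mu1 mu0 mlab mE E0 (ltW e0) fE.
have -> : label_sum mu lab c = Phi (c \o lab).
  rewrite mean_label//; apply: eq_bigr => t _; congr (_ * _).
  by rewrite [mu _]muPhiE.
have bc : essbounded m (c \o lab) by exact: essbounded_comp_label.
have : `|Phi f - Phi (c \o lab)| <= e.
  rewrite -(meanB mPhi)//; apply: (mean_norm_le mPhi); first exact: essboundedB.
  exists (~` E); split => //; first exact: measurableC.
  by move=> y /= yE Ey; apply: yE; exact: fE.
rewrite !ler_distl => /andP[? ?] /andP[? ?]; apply/andP; split; lra.
Qed.

End MeanContent.
End FinitelyAdditiveIntegral.

(** * The maximal ideal space and the Riesz theorem *)

Section MaximalIdealSpace.
Context d (Y : measurableType d) (R : realType) (m : {measure set Y -> \bar R}).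
Variable m0 : m setT != 0%E.

Local Notation X := (maxideal_space m0).
Local Notation ghat f := (@gelfand _ _ _ m m0 f).

Lemma gelfand_character (chi : X) : characters (set_val chi : {ptws Linf m -> R}).
Proof. exact: (set_valP (chi : set_type _)). Qed.

Lemma gelfand_inj (chi chi' : X) : (forall f, ghat f chi = ghat f chi') -> chi = chi'.
Proof. by move=> H; apply: val_inj; apply/funext => f; exact: H. Qed.

Lemma gelfand_continuous f : continuous (ghat f).
Proof.
move=> chi.
apply: (@continuous_comp X {ptws Linf m -> R} R set_val (fun g => g f)).
  exact: (@initial_continuous _ {ptws Linf m -> R} set_val).
exact: (@proj_continuous (Linf m) (fun=> R) f).
Qed.

Lemma cvg_gelfand (F : set_system X) (chi : X) : Filter F ->
  (forall f, ghat f @ F --> ghat f chi) -> F --> chi.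
Proof.
move=> FF H.
have : (set_val @ F) --> (set_val chi : {ptws Linf m -> R}).
  apply/cvg_sup => f A [_ [[W oW <-] /= Wx] WA].
  have : nbhs (ghat f chi) W by exact: open_nbhs_nbhs.
  by move/(H f); rewrite /= /nbhs /=; apply: filterS => x Wx'; exact: WA.
move=> cv A; rewrite /nbhs /= => -[_ [[W oW <-] /= Wx] WA].
by apply: filterS WA _; apply: cv; exact: open_nbhs_nbhs.
Qed.

Lemma gelfand_ae_eq (f g : Linf m) (chi : X) :
  (\forall y \ae m, (f y : R) = g y) -> ghat f chi = ghat g chi.
Proof.
move=> fg; have [lin _ _] := gelfand_character chi.
have := lin 0 f g f; rewrite mul0r add0r; apply.
by apply: filterS fg => y ->; rewrite mul0r add0r.
Qed.

Lemma gelfand_cls (f : Linf m) (chi : X) : ghat (cls m f) chi = ghat f chi.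
Proof. by apply: gelfand_ae_eq; exact: clsE (essbounded_Linf f). Qed.

Lemma gelfandM (chi : X) (f g : Y -> R) : essbounded m f -> essbounded m g ->
  ghat (cls m (fun y => f y * g y)) chi = ghat (cls m f) chi * ghat (cls m g) chi.
Proof.
move=> bf bg; have [_ mul _] := gelfand_character chi; apply: mul.
by apply: filterS3 (clsE (essboundedM bf bg)) (clsE bf) (clsE bg) => y -> -> ->.
Qed.

(** Positivity: a character sends f >= 0 to the square of its value at the square root of f. *)
Lemma gelfand_state (chi : X) : states (fun f => ghat f chi).
Proof.
have [lin mul unit] := gelfand_character chi; split => // f f0.
have bf := essbounded_Linf f.
have bs : essbounded m (fun y => Num.sqrt (f y)).
  by apply: essbounded_comp bf; exact: sqrt_continuous.
rewrite /gelfand (mul (cls m (fun y => Num.sqrt (f y))) (cls m (fun y => Num.sqrt (f y)))).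
  by rewrite -expr2 sqr_ge0.
by apply: filterS2 (clsE bs) f0 => y -> f0; rewrite -expr2 sqr_sqrtr.
Qed.

Lemma gelfand_mean (chi : X) : is_mean m (fun f => ghat (cls m f) chi).
Proof. exact: state_mean (gelfand_state chi). Qed.

Lemma gelfand_bounded (f : Linf m) : exists M : R, forall chi : X, `|ghat f chi| <= M.
Proof.
have bf := essbounded_Linf f; have [_ [M fM]] := bf.
exists M => chi; rewrite -gelfand_cls.
exact: (mean_norm_le (gelfand_mean chi)).
Qed.

(** Along an ultrafilter each Gelfand transform converges, being bounded, and the pointwise limit of
    characters is again a character. *)
Lemma maxideal_compact : compact [set: X].
Proof.
rewrite compact_ultra => F UF _.
have imU (f : X -> R) : UltraFilter (f @ F).
  split; first exact: fmap_proper_filter.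
  move=> H PH sH; rewrite predeqE => A; split; last exact: sH.
  move=> HA; have [//|GA] := in_ultra_setVsetC (f @^-1` A) UF.
  have HnA : H (~` A) by exact: sH.
  have : H (A `&` ~` A) by exact: filterI.
  by rewrite setICr => /filter_not_empty.
have cvgf (f : Linf m) : cvg (ghat f @ F).
  have [M fM] := gelfand_bounded f.
  have := @segment_compact R (- M) M.
  rewrite compact_ultra => /(_ _ (imU (ghat f))) []; last first.
    by move=> l [_ fl]; apply/cvg_ex; exists l.
  by apply/nearW => chi; rewrite /= in_itv /= -ler_norml.
pose l (f : Linf m) : R := lim (ghat f @ F).
have lchar : characters (l : {ptws Linf m -> R}).
  split.
  - move=> a f g h hE; apply/cvg_lim => //.
    have : (fun chi => a * ghat f chi + ghat g chi) @ F --> a * l f + l g.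
      by apply: cvgD; [apply: cvgMl_tmp; exact: cvgf|exact: cvgf].
    apply: cvg_trans; apply: near_eq_cvg; apply/nearW => chi.
    by have [lin _ _] := gelfand_character chi; rewrite [RHS](lin a f g h hE).
  - move=> f g h hE; apply/cvg_lim => //.
    have : (fun chi => ghat f chi * ghat g chi) @ F --> l f * l g.
      by apply: cvgM; exact: cvgf.
    apply: cvg_trans; apply: near_eq_cvg; apply/nearW => chi.
    by have [_ mul _] := gelfand_character chi; rewrite [RHS](mul f g h hE).
  - move=> f f1; apply/cvg_lim => //.
    have : (fun chi : X => 1 : R) @ F --> (1 : R) by exact: cvg_cst.
    apply: cvg_trans; apply: near_eq_cvg; apply/nearW => chi.
    by have [_ _ unit] := gelfand_character chi; rewrite [RHS](unit f f1).
pose chi0 : X := SigSub (mem_set lchar).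
exists chi0; split => //; apply: cvg_gelfand => f.
by rewrite (_ : ghat f chi0 = l f)//; exact: cvgf.
Qed.

(** Indicators are idempotent, so characters take only the values 0 and 1 on them. These sets
    realize X as the Stone space of the measure algebra of m. *)
Definition clopen_of (E : set Y) : set X := [set chi | ghat (cls m \1_E) chi = 1].

Lemma gelfand_indic01 E chi : measurable E ->
  ghat (cls m \1_E) chi = 0 \/ ghat (cls m \1_E) chi = 1.
Proof.
move=> mE; have bE := essbounded_indic m mE.
have := gelfandM chi bE bE.
rewrite (_ : (fun y => _) = \1_E); last first.
  by apply/funext => y; rewrite indicE; case: (y \in E); rewrite ?mulr1 ?mulr0.
set a := ghat _ _ => /eqP; rewrite -subr_eq0 -{1}(mulr1 a) -mulrBr mulf_eq0 subr_eq0.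
by case/orP => /eqP ->; [left|right].
Qed.

Lemma clopen_ofC E : measurable E -> clopen_of (~` E) = ~` clopen_of E.
Proof.
move=> mE; have bE := essbounded_indic m mE.
have E1 chi : ghat (cls m \1_(~` E)) chi = 1 - ghat (cls m \1_E) chi.
  have mc := gelfand_mean chi.
  rewrite -[X in X - _](mean_cst mc 1) -(meanB mc)//; last exact: essbounded_cst.
  congr (ghat (cls m _) _); apply/funext => y; rewrite indicC indicE.
  by case: (y \in E); rewrite /= ?subrr ?subr0.
apply/seteqP; split => chi; rewrite /clopen_of/= E1.
  by move=> + e1; rewrite e1 subrr => /esym/eqP; rewrite oner_eq0.
by have [->|->] := gelfand_indic01 chi mE; rewrite ?subr0.
Qed.

Lemma clopen_ofI E F : measurable E -> measurable F ->
  clopen_of (E `&` F) = clopen_of E `&` clopen_of F.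
Proof.
move=> mE mF; rewrite /clopen_of; apply/seteqP; split => chi /=;
    rewrite indicI (gelfandM _ (essbounded_indic m mE) (essbounded_indic m mF)).
  by have [->|->] := gelfand_indic01 chi mE; rewrite ?mul0r ?mul1r// => /esym/eqP;
    rewrite oner_eq0.
by move=> [-> ->]; rewrite mulr1.
Qed.

Lemma clopen_ofT : clopen_of setT = setT.
Proof.
apply/seteqP; split => // chi _; rewrite /clopen_of/= indicT.
exact: mean_cst (gelfand_mean chi) 1.
Qed.

Lemma clopen_of0 : clopen_of set0 = set0.
Proof. by rewrite -setCT clopen_ofC// clopen_ofT setCT. Qed.

Lemma clopen_ofU E F : measurable E -> measurable F ->
  clopen_of (E `|` F) = clopen_of E `|` clopen_of F.
Proof.
move=> mE mF; rewrite -[E `|` F]setCK setCU clopen_ofC; last first.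
  by apply: measurableI; exact: measurableC.
rewrite clopen_ofI; [|exact: measurableC|exact: measurableC].
by rewrite !clopen_ofC// setCI !setCK.
Qed.

Lemma open_clopen_of E : measurable E -> open (clopen_of E).
Proof.
move=> mE; rewrite (_ : clopen_of E = ghat (cls m \1_E) @^-1` [set x | 0 < x]).
  apply: open_comp; last exact: open_gt.
  by move=> chi _; exact: gelfand_continuous.
apply/seteqP; split => chi; rewrite /clopen_of/=; first by move=> ->.
by have [->|->] := gelfand_indic01 chi mE; rewrite ?ltxx.
Qed.

Lemma closed_clopen_of E : measurable E -> closed (clopen_of E).
Proof.
move=> mE; rewrite -[E]setCK clopen_ofC; last exact: measurableC.
by apply: open_closedC; apply: open_clopen_of; exact: measurableC.
Qed.

(** Restrict m to [E], which is not null: a character for the restricted measure, precomposed with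
    the passage to its classes, is a character for m that sends the indicator of [E] to 1. *)
Lemma clopen_of_nonempty E : measurable E -> m E != 0%E -> clopen_of E !=set0.
Proof.
move=> mE mE0.
pose m' : {measure set Y -> \bar R} := mrestr m mE.
have m'E A : m' A = m (A `&` E) by [].
have m'T : m' setT != 0%E by rewrite m'E setTI.
have ae' (P : Y -> Prop) : (\forall y \ae m, P y) -> \forall y \ae m', P y.
  move=> [N [mN N0 PN]]; exists N; split => //.
  rewrite m'E; apply: (subset_measure0 _ mN _ N0) => //.
  exact: measurableI.
have bnd' f : essbounded m f -> essbounded m' f.
  by move=> [mf [M fM]]; split => //; exists M; exact: ae' fM.
have [chi' [lin mul unit]] := characters_nonempty m'T.
have ebd (f : Linf m) : essbounded m' f by apply: bnd'; exact: essbounded_Linf.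
have chiP : characters ((fun f : Linf m => chi' (cls m' f)) : {ptws Linf m -> R}).
  split.
  - move=> a f g h hE; apply: lin.
    by apply: filterS2 (filterI (clsE (ebd f)) (clsE (ebd g)))
      (filterI (clsE (ebd h)) (ae' _ hE)) => y [-> ->] [->].
  - move=> f g h hE; apply: mul.
    by apply: filterS2 (filterI (clsE (ebd f)) (clsE (ebd g)))
      (filterI (clsE (ebd h)) (ae' _ hE)) => y [-> ->] [->].
  - move=> f f1; apply: unit.
    by apply: filterS2 (clsE (ebd f)) (ae' _ f1) => y ->.
exists (SigSub (mem_set chiP)); rewrite /clopen_of /= /gelfand /=.
apply: unit; have b1 := essbounded_indic m mE.
apply: filterS3 (clsE (ebd (cls m \1_E))) (ae' _ (clsE b1)) _ => [y -> ->|].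
  exact: id.
exists (~` E); split; first exact: measurableC.
  by rewrite m'E setICl measure0.
by move=> y /= + Ey; apply; rewrite indicE mem_set.
Qed.

(** Characters that agree on indicators agree on simple functions, hence everywhere by uniform
    approximation. *)
Lemma clopen_of_separates (chi chi' : X) : chi <> chi' ->
  exists2 E, measurable E & clopen_of E chi /\ ~ clopen_of E chi'.
Proof.
move=> cc'; apply: contrapT => H; apply: cc'.
have H1 E : measurable E -> ghat (cls m \1_E) chi = ghat (cls m \1_E) chi'.
  move=> mE.
  have [e0|e1] := gelfand_indic01 chi mE; have [e0'|e1'] := gelfand_indic01 chi' mE;
    rewrite ?e0 ?e1 ?e0' ?e1' //; exfalso; apply: H.
  - exists (~` E); first exact: measurableC.
    rewrite !clopen_ofC// /clopen_of/= e0 e1'; split => //.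
    by move=> /esym/eqP; rewrite oner_eq0.
  - exists E => //; rewrite /clopen_of/= e0' e1; split => //.
    by move=> /esym/eqP; rewrite oner_eq0.
apply: gelfand_inj => f; rewrite -(gelfand_cls f chi) -(gelfand_cls f chi').
apply: (@eq_of_le_eps _ _ _ 2) => e e0.
have bf := essbounded_Linf f.
have [T [lab [c [E [mlab mE E0 fE]]]]] := essbounded_label e0 bf.
have close (x : X) : `|ghat (cls m f) x - ghat (cls m (c \o lab)) x| <= e.
  have bc : essbounded m (c \o lab) by exact: essbounded_comp_label.
  rewrite -(meanB (gelfand_mean x))//.
  apply: (mean_norm_le (gelfand_mean x)); first exact: essboundedB.
  exists (~` E); split => //; first exact: measurableC.
  move=> y /= yE Ey; apply: yE; have /andP[h1 h2] := fE _ Ey.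
  by rewrite ler_distl; apply/andP; split; lra.
have := close chi; have := close chi'.
rewrite !(mean_label (gelfand_mean _))//.
under eq_bigr do rewrite -H1//.
rewrite !ler_distl => /andP[? ?] /andP[? ?]; apply/andP; split; lra.
Qed.

Lemma clopen_of_bigcap (s : seq (set Y)) : (forall E, E \in s -> measurable E) ->
  measurable (\big[setI/setT]_(E <- s) E) /\
  clopen_of (\big[setI/setT]_(E <- s) E) = \big[setI/setT]_(E <- s) clopen_of E.
Proof.
elim: s => [_|E s ih ms]; first by rewrite !big_nil clopen_ofT.
have [|mI IE] := ih; first by move=> F Fs; apply: ms; rewrite inE Fs orbT.
have mE : measurable E by apply: ms; rewrite inE eqxx.
by rewrite !big_cons clopen_ofI// IE; split => //; exact: measurableI.
Qed.

Lemma clopen_of_bigcup (s : seq (set Y)) : (forall E, E \in s -> measurable E) ->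
  measurable (\big[setU/set0]_(E <- s) E) /\
  clopen_of (\big[setU/set0]_(E <- s) E) = \big[setU/set0]_(E <- s) clopen_of E.
Proof.
elim: s => [_|E s ih ms]; first by rewrite !big_nil clopen_of0.
have [|mI IE] := ih; first by move=> F Fs; apply: ms; rewrite inE Fs orbT.
have mE : measurable E by apply: ms; rewrite inE eqxx.
by rewrite !big_cons clopen_ofU// IE; split => //; exact: measurableU.
Qed.

Lemma closed_maxideal_compact (K : set X) : closed K -> compact K.
Proof.
by move=> cK; apply: (subclosed_compact cK maxideal_compact).
Qed.

(** Each point off [U] is excluded by some clopen set containing [chi]; by compactness finitely many
    suffice, and their intersection is taken. *)
Lemma clopen_of_basis (U : set X) (chi : X) : open U -> U chi ->
  exists E, [/\ measurable E, clopen_of E chi & clopen_of E `<=` U].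
Proof.
move=> oU Uchi.
have cK : compact (~` U) by apply: closed_maxideal_compact; exact: open_closedC.
move: cK; rewrite compact_cover => cK.
pose D := [set E : set Y | measurable E /\ clopen_of E chi].
have [||D' D'D KD'] := cK _ D (fun E => ~` clopen_of E).
- by move=> E [mE _]; rewrite -clopen_ofC//; apply: open_clopen_of; exact: measurableC.
- move=> chi' nU; have [|E mE [Ec nEc]] := @clopen_of_separates chi chi'.
    by move=> ceq; apply: nU; rewrite -ceq.
  by exists E.
have D'P E : E \in enum_fset D' -> D E by move=> /D'D; rewrite inE.
have [|mI IE] := @clopen_of_bigcap (enum_fset D'); first by move=> E /D'P[].
exists (\big[setI/setT]_(E <- D') E); rewrite IE; split => //.
  rewrite -bigcap_seq => E /= /D'P[_]; exact.
move=> x; rewrite -bigcap_seq => xI; apply: contrapT => /KD' [E /= ED' nE].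
by apply: nE; exact: xI.
Qed.

Lemma clopen_of_between (K U : set X) : compact K -> open U -> K `<=` U ->
  exists E, [/\ measurable E, K `<=` clopen_of E & clopen_of E `<=` U].
Proof.
rewrite compact_cover => cK oU KU.
pose D := [set E : set Y | measurable E /\ clopen_of E `<=` U].
have [||D' D'D KD'] := cK _ D clopen_of.
- by move=> E [mE _]; exact: open_clopen_of.
- move=> chi /KU Uchi; have [E [mE Ec EU]] := clopen_of_basis oU Uchi.
  by exists E.
have D'P E : E \in enum_fset D' -> D E by move=> /D'D; rewrite inE.
have [|mI IE] := @clopen_of_bigcup (enum_fset D'); first by move=> E /D'P[].
exists (\big[setU/set0]_(E <- D') E); rewrite IE; split => //.
  by rewrite -bigcup_seq => x /KD' [E ED' Ex]; exists E.
by rewrite -bigcup_seq => x [E /= /D'P[_ EU] /EU].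
Qed.

(** A non-null difference would carry a character. Consequently a mean of an indicator depends only
    on the associated clopen set, monotonically. *)
Lemma clopen_of_subset (E F : set Y) : measurable E -> measurable F ->
  clopen_of E `<=` clopen_of F -> m (E `\` F) = 0%E.
Proof.
move=> mE mF EF; apply: contrapT => /eqP h.
have mD := measurableD mE mF.
have [chi] := clopen_of_nonempty mD h.
rewrite setDE clopen_ofI//; last exact: measurableC.
by rewrite clopen_ofC// => -[/EF].
Qed.
End MaximalIdealSpace.
Arguments clopen_of {d Y R m} m0 E.

(** * The representing measure of a mean on the maximal ideal space *)

Section Riesz.
Context d (Y : measurableType d) (R : realType) (m : {measure set Y -> \bar R}).
Variable m0 : m setT != 0%E.
Variables (Phi : (Y -> R) -> R) (mPhi : is_mean m Phi).
Local Notation X := (maxideal_space m0).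
Local Notation ghat f := (@gelfand _ _ _ m m0 f).
Local Open Scope ereal_scope.

Let wt (E : set Y) := (Phi \1_E)%:E.

Let wt_ge0 E : measurable E -> 0 <= wt E.
Proof.
move=> mE; rewrite lee_fin; apply: (mean_ge0 mPhi); first exact: essbounded_indic.
by apply/nearW => y; rewrite indicE.
Qed.

Let le_wt E F : measurable E -> measurable F ->
  clopen_of m0 E `<=` clopen_of m0 F -> wt E <= wt F.
Proof.
move=> mE mF EF; rewrite lee_fin.
apply: (le_mean mPhi); [exact: essbounded_indic|exact: essbounded_indic|].
exists (E `\` F); split; [exact: measurableD|exact: clopen_of_subset EF|].
move=> y /= h; apply: contrapT => nEF; apply: h; rewrite !indicE.
have [yE|] := boolP (y \in E); last by rewrite ler0n.
rewrite mem_set//; apply: contrapT => nF; apply: nEF; split => //.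
exact: set_mem.
Qed.

(** The weight of clopen sets is extended to open sets from inside; [outer_weight] then extends it
    to all sets from outside. *)
Definition open_weight (U : set X) : \bar R :=
  ereal_sup [set wt E | E in [set E | measurable E /\ clopen_of m0 E `<=` U]].

Let wt_le E U : measurable E -> clopen_of m0 E `<=` U -> wt E <= open_weight U.
Proof. by move=> mE EU; apply: ereal_sup_ubound; exists E. Qed.

Let open_weight_le1 U : open_weight U <= 1.
Proof.
apply/ge_ereal_sup => _ [E [mE _] <-]; rewrite lee_fin.
apply: (mean_le_cst mPhi); first exact: essbounded_indic.
by apply/nearW => y; rewrite indicE lern1 leq_b1.
Qed.

Let open_weight_ge0 U : 0 <= open_weight U.
Proof.
apply: le_trans (@wt_le set0 U measurable0 _); first exact: wt_ge0.
by rewrite clopen_of0.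
Qed.

Let le_open_weight U V : U `<=` V -> open_weight U <= open_weight V.
Proof.
move=> UV; apply/ge_ereal_sup => _ [E [mE EU] <-].
by apply: wt_le => //; exact: subset_trans EU UV.
Qed.

Let wt_split E F : measurable E -> measurable F ->
  wt E <= wt (E `&` F) + wt (E `\` F).
Proof.
move=> mE mF; rewrite -EFinD lee_fin -(mean_indicU mPhi).
- by rewrite setUIDK.
- exact: measurableI.
- exact: measurableD.
- by rewrite setDE setIACA setICr setI0.
Qed.

(** The part of the clopen set left uncovered by the first n sets is compact and lies in the last
    one. A clopen set [F] fits between the two, and E is split along [F]. *)
Let wt_bigcup (U : (set X)^nat) n E : measurable E -> (forall i, open (U i)) ->
  clopen_of m0 E `<=` \bigcup_(i < n) U i ->
  wt E <= \sum_(i < n) open_weight (U i).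
Proof.
move=> mE oU; elim: n E mE => [|n ih] E mE EU.
  rewrite big_ord0; apply: (le_trans (@le_wt E set0 _ _ _)) => //.
    by apply: (subset_trans EU) => x [].
  by rewrite /wt indic0 (mean0 mPhi).
have cK : compact (clopen_of m0 E `\` \bigcup_(i < n) U i).
  apply: closed_maxideal_compact; rewrite setDE; apply: closedI.
    exact: closed_clopen_of.
  by apply: open_closedC; apply: bigcup_open => i _; exact: oU.
have [|F [mF KF FU]] := clopen_of_between cK (oU n).
  move=> x [/EU [i /= ilt Uix] nU].
  have : i = n; last by move=> <-.
  apply/eqP; rewrite eqn_leq -ltnS ilt/= leqNgt; apply/negP => iltn.
  by apply: nU; exists i.
rewrite (le_trans (wt_split mE mF))// big_ord_recr/= addeC; apply: leeD.
  apply: ih; first exact: measurableD.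
  move=> x; rewrite setDE clopen_ofI//; last exact: measurableC.
  rewrite clopen_ofC// => -[Ex nF]; apply: contrapT => nU.
  by apply: nF; apply: KF.
apply: wt_le; first exact: measurableI.
by rewrite clopen_ofI// => x [_ /FU].
Qed.

(** A clopen subset of the union is compact, so the countable cover reduces to a finite one. *)
Let open_weight_bigcup (U : (set X)^nat) : (forall i, open (U i)) ->
  open_weight (\bigcup_i U i) <= \sum_(i <oo) open_weight (U i).
Proof.
move=> oU; apply/ge_ereal_sup => _ [E [mE EU] <-].
have : compact (clopen_of m0 E) by apply: closed_maxideal_compact; exact: closed_clopen_of.
rewrite compact_cover => /(_ nat setT U (fun i _ => oU i) EU) [D _ ED].
pose n := (\max_(i <- D) i).+1.
apply: (@le_trans _ _ (\sum_(i < n) open_weight (U i))).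
  apply: wt_bigcup => // x /ED [i /= iD Uix]; exists i => //=.
  by rewrite ltnS; apply: leq_bigmax_seq.
rewrite -(big_mkord xpredT (fun i => open_weight (U i))).
exact: nneseries_lim_ge.
Qed.

Definition outer_weight (S : set X) : \bar R :=
  ereal_inf [set open_weight U | U in [set U | open U /\ S `<=` U]].

Let outer_weight_open U : open U -> outer_weight U = open_weight U.
Proof.
move=> oU; apply/eqP; rewrite eq_le; apply/andP; split.
  by apply: ereal_inf_lbound; exists U => //; split.
by apply/le_ereal_inf_tmp => _ [V [oV UV] <-]; exact: le_open_weight.
Qed.

Let outer_weight_le S U : open U -> S `<=` U -> outer_weight S <= open_weight U.
Proof. by move=> oU SU; apply: ereal_inf_lbound; exists U. Qed.

Let outer_weight_ge0 S : 0 <= outer_weight S.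
Proof. by apply/le_ereal_inf_tmp => _ [U _ <-]. Qed.

Let outer_weight_fin S : outer_weight S \is a fin_num.
Proof.
rewrite ge0_fin_numE//; apply: (le_lt_trans (@outer_weight_le S setT openT _)) => //.
by apply: le_lt_trans (open_weight_le1 _) _; rewrite ltry.
Qed.

Let outer_weight0 : outer_weight set0 = 0.
Proof.
apply/eqP; rewrite eq_le outer_weight_ge0 andbT.
rewrite (le_trans (@outer_weight_le set0 set0 open0 _))//.
apply/ge_ereal_sup => _ [E [mE E0] <-].
have := @le_wt E set0 mE measurable0.
by rewrite clopen_of0 /wt indic0 (mean0 mPhi); exact.
Qed.

Let le_outer_weight : {homo outer_weight : A B / A `<=` B >-> A <= B}.
Proof.
move=> A B AB; apply/le_ereal_inf_tmp => _ [U [oU BU] <-].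
by apply: outer_weight_le => //; exact: subset_trans AB BU.
Qed.

Let outer_weight_adherent S (e : R) : (0 < e)%R ->
  exists U, [/\ open U, S `<=` U & open_weight U <= outer_weight S + e%:E].
Proof.
move=> e0; have := outer_weight_fin S => Sfin.
have [_ [U [oU SU] <-] /ltW h] := lb_ereal_inf_adherent e0 Sfin.
by exists U.
Qed.

Let outer_weight_sigma_subadditive : sigma_subadditive outer_weight.
Proof.
move=> A; apply/lee_addgt0Pr => e e0.
have := @epsilon_trick R (fun n => outer_weight (A n)) e xpredT
  (fun n => outer_weight_ge0 _) (ltW e0).
apply: le_trans.
have [U UP] : {U : (set X)^nat & forall n, [/\ open (U n), A n `<=` U n &
    open_weight (U n) <= outer_weight (A n) + (e / (2 ^ n.+1)%:R)%:E]}.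
  apply: (@choice _ _ (fun n V => [/\ open V, A n `<=` V &
    open_weight V <= outer_weight (A n) + (e / (2 ^ n.+1)%:R)%:E])) => n.
  by apply: outer_weight_adherent; rewrite divr_gt0// ltr0n expn_gt0.
have oU n : open (U n) by have [] := UP n.
apply: (@le_trans _ _ (open_weight (\bigcup_n U n))).
  apply: outer_weight_le; first by apply: bigcup_open.
  by move=> x [n _ Anx]; exists n => //; have [_ + _] := UP n; exact.
apply: (le_trans (open_weight_bigcup oU)); apply: lee_nneseries => // n _.
by have [_ _] := UP n.
Qed.

HB.instance Definition _ := isOuterMeasure.Build _ _ outer_weight
  outer_weight0 outer_weight_ge0 le_outer_weight outer_weight_sigma_subadditive.

(** Inside an open V containing S choose a clopen E in V and U, then a clopen F in V off E. The
    underlying sets are disjoint modulo m, so their weights add up to at most that of V, while V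
    minus E still covers the part of S outside U. *)
Let open_caratheodory U : open U -> outer_weight.-caratheodory U.
Proof.
move=> oU; apply: le_caratheodory_measurable => S.
apply/le_ereal_inf_tmp => _ [V [oV SV] <-].
apply: (@le_trans _ _ (open_weight (V `&` U) + outer_weight (S `&` ~` U))).
  by apply: leeD2r; apply: outer_weight_le; [exact: openI|exact: setSI].
rewrite -leeBrDr//; apply/ge_ereal_sup => _ [E [mE EVU] <-].
rewrite leeBrDr//.
have oVE : open (V `\` clopen_of m0 E).
  by rewrite setDE; apply: openI => //; apply: closed_openC; exact: closed_clopen_of.
apply: (@le_trans _ _ (wt E + open_weight (V `\` clopen_of m0 E))).
  apply: leeD2l; apply: outer_weight_le => // x [Sx nUx]; split; first exact: SV.
  by move=> /EVU [_ /nUx].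
rewrite addeC -leeBrDr//; apply/ge_ereal_sup => _ [F [mF FV] <-]; rewrite leeBrDr//.
have EF0 : m (E `&` F) = 0.
  rewrite -(setD0 (E `&` F)); apply: (@clopen_of_subset _ _ _ _ m0) => //.
    exact: measurableI.
  by rewrite clopen_ofI// => x [Ex /FV [_ /(_ Ex)]].
apply: (@le_trans _ _ (wt (F `|` E))); last first.
  apply: wt_le; first exact: measurableU.
  by rewrite clopen_ofU// => x [/FV[]//|/EVU[]].
rewrite -EFinD lee_fin.
have bE := essbounded_indic m mE; have bF := essbounded_indic m mF.
rewrite -(meanD mPhi)//; apply: (le_mean mPhi).
- exact: essboundedD.
- by apply: essbounded_indic; exact: measurableU.
- exists (E `&` F); split => //; first exact: measurableI.
  move=> y /= h; apply: contrapT => nEF; apply: h; rewrite !indicE in_setU.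
  case: (boolP (y \in E)); case: (boolP (y \in F)) => //= yF yE;
    rewrite ?addr0 ?add0r//.
  by exfalso; apply: nEF; split; exact: set_mem.
Qed.

Let borel_caratheodory (B : set (borel_maxideal m0)) :
  measurable B -> outer_weight.-caratheodory B.
Proof.
move: B; apply: smallest_sub; last by move=> U; exact: open_caratheodory.
exact: (@sigma_algebra_measurable _ (caratheodory_type outer_weight)).
Qed.

Let riesz (B : set (borel_maxideal m0)) := outer_weight B.

Let riesz0 : riesz set0 = 0. Proof. exact: outer_weight0. Qed.

Let riesz_ge0 B : 0 <= riesz B. Proof. exact: outer_weight_ge0. Qed.

Let riesz_sigma_additive : semi_sigma_additive riesz.
Proof.
move=> A mA tA mUA.
apply: (@caratheodory_measure_sigma_additive R X outer_weight) => //.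
  by move=> i; apply: borel_caratheodory.
exact: borel_caratheodory.
Qed.

HB.instance Definition _ :=
  isMeasure.Build _ _ _ riesz riesz0 riesz_ge0 riesz_sigma_additive.

Let riesz1 : riesz setT = 1.
Proof.
rewrite /riesz outer_weight_open; last exact: openT.
apply/eqP; rewrite eq_le open_weight_le1/=.
have := @wt_le setT setT measurableT (fun _ _ => I).
by rewrite /wt indicT; case: mPhi => _ _ ->.
Qed.

HB.instance Definition _ := Measure_isProbability.Build _ _ _ riesz riesz1.

(** Outer regularity is the definition of [outer_weight]. Inner regularity is outer regularity of
    the complement, closed sets being compact. *)
Let riesz_regular : regular_measure (riesz : probability (borel_maxideal m0) R).
Proof.
move=> B mB; set P : probability _ _ := riesz.
have mopen (U : set X) : open U -> measurable (U : set (borel_maxideal m0)).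
  by move=> oU; exact: sub_sigma_algebra.
have Pfin (C : set (borel_maxideal m0)) : P C \is a fin_num by exact: outer_weight_fin.
split; last first.
  rewrite [LHS]/(outer_weight B) /outer_weight; congr ereal_inf.
  by apply/seteqP; split => _ [U [oU BU] <-]; exists U => //;
    rewrite /P/= /riesz outer_weight_open.
apply/eqP; rewrite eq_le; apply/andP; split; last first.
  by apply/ge_ereal_sup => _ [K [cK KB] <-]; exact: le_outer_weight.
apply/lee_addgt0Pr => e e0.
have [U [oU BU PU]] := outer_weight_adherent (~` B) e0.
have cK : closed (~` U : set X) by exact: open_closedC.
apply: (@le_trans _ _ (P (~` U) + e%:E)).
  rewrite probability_setC; last exact: mopen.
  have : P U <= P (~` B) + e%:E by rewrite [leLHS]outer_weight_open.
  rewrite probability_setC//.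
  rewrite -(fineK (Pfin U)) -(fineK (Pfin B)) -!EFinB -!EFinD !lee_fin; lra.
apply: leeD2r; apply: ereal_sup_ubound; exists (~` U) => //; split.
  exact: closed_maxideal_compact.
by rewrite -[B]setCK; exact: subsetC.
Qed.

Let riesz_clopen E : measurable E -> riesz (clopen_of m0 E) = wt E.
Proof.
move=> mE; rewrite /riesz outer_weight_open; last exact: open_clopen_of.
apply/eqP; rewrite eq_le wt_le// andbT.
by apply/ge_ereal_sup => _ [F [mF FE] <-]; exact: le_wt.
Qed.
Local Close Scope ereal_scope.

Lemma measurable_gelfand f :
  measurable_fun setT (ghat f : borel_maxideal m0 -> R).
Proof.
apply: (measurability _ (RGenOpens.measurableE R)) => // _ [_ [a [b ->] <-]].
rewrite setTI; apply: sub_sigma_algebra.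
by apply: open_comp; [move=> chi _; exact: gelfand_continuous|exact: interval_open].
Qed.

Lemma essbounded_gelfand (P : {measure set (borel_maxideal m0) -> \bar R}) f :
  essbounded P (ghat f : borel_maxideal m0 -> R).
Proof.
split; first exact: measurable_gelfand.
by have [M fM] := gelfand_bounded m0 f; exists M; apply/nearW.
Qed.

Lemma riesz_representation : exists P : probability (borel_maxideal m0) R,
  regular_measure P /\
  forall f : Linf m, (\int[P]_chi (ghat f chi)%:E = (Phi f)%:E)%E.
Proof.
pose P : probability (borel_maxideal m0) R := riesz; exists P.
split; first exact: riesz_regular.
move=> f.
have P1 : P setT = 1%E := riesz1.
have P0 (G : set (borel_maxideal m0)) : measurable G -> P G = 0%E -> P G = 0%E by [].
(* A probability is in particular a content vanishing on its own null sets, so integration against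
   [P] is also a mean and obeys the same calculus. *)
have mP := is_mean_content_mean P1 P0.
have -> : (\int[P]_chi (ghat f chi)%:E = (content_mean P (ghat f))%:E)%E.
  have [T [lab [c [E [mlab mE E0 fE]]]]] :=
    essbounded_label (ltr01 : 0 < 1 :> R) (essbounded_gelfand P f).
  have [|I IE _] := @integral_label _ _ _ P P1 E T lab c (ghat f) 1 mlab mE E0 ler01.
    by move=> y /fE /andP[h1 h2]; rewrite ler_distl; apply/andP; split; lra.
  by rewrite /content_mean IE.
congr EFin; apply: (@eq_of_le_eps _ _ _ 2) => e e0.
have bf := essbounded_Linf f.
have [T [lab [c [E [mlab mE E0 fE]]]]] := essbounded_label e0 bf.
have bc := essbounded_comp_label m c mlab.
have fce : \forall y \ae m, `|f y - c (lab y)| <= e.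
  exists (~` E); split => //; first exact: measurableC.
  move=> y /= yE Ey; apply: yE; have /andP[h1 h2] := fE _ Ey.
  by rewrite ler_distl; apply/andP; split; lra.
have h1 : `|Phi f - Phi (c \o lab)| <= e.
  by rewrite -(meanB mPhi)//; apply: (mean_norm_le mPhi) => //; exact: essboundedB.
have mclop t : measurable (clopen_of m0 (lab @^-1` [set t]) : set (borel_maxideal m0)).
  by apply: sub_sigma_algebra; exact: open_clopen_of.
have bg : essbounded P (ghat (cls m (c \o lab)) : borel_maxideal m0 -> R).
  exact: essbounded_gelfand.
have h2 : `|content_mean P (ghat f) - content_mean P (ghat (cls m (c \o lab)))| <= e.
  rewrite -(meanB mP)//; last exact: essbounded_gelfand.
  apply: (mean_norm_le mP); first by apply: essboundedB => //; exact: essbounded_gelfand.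
  apply/nearW => chi; rewrite -(gelfand_cls f chi) -(meanB (gelfand_mean chi))//.
  by apply: (mean_norm_le (gelfand_mean chi)) => //; exact: essboundedB.
(* The Gelfand transform of a simple function is simple over the corresponding clopen sets, whose
   measure is prescribed. *)
have h3 : content_mean P (ghat (cls m (c \o lab))) = Phi (c \o lab).
  have -> : ghat (cls m (c \o lab)) =
      (fun chi => \sum_t c t * \1_(clopen_of m0 (lab @^-1` [set t])) chi).
    apply/funext => chi; rewrite (mean_label (gelfand_mean chi))//.
    apply: eq_bigr => t _; congr (_ * _); rewrite indicE.
    have [h|h] := gelfand_indic01 chi (mlab t); rewrite h.
      by rewrite memNset// /clopen_of/= h => /esym/eqP; rewrite oner_eq0.
    by rewrite mem_set.
  rewrite (mean_sum mP); last by move=> t _; apply: essboundedZ; exact: essbounded_indic.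
  rewrite (mean_label mPhi)//; apply: eq_bigr => t _.
  rewrite (meanZ mP); last exact: essbounded_indic.
  congr (_ * _); rewrite (content_mean_indic P1 P0)//.
  exact: (congr1 fine (riesz_clopen (mlab t))).
move: h1 h2; rewrite h3 !ler_distl => /andP[? ?] /andP[? ?]; apply/andP; split; lra.
Qed.

End Riesz.

(** * The integral of ln |psi| through truncations of the logarithm *)

Section IntegralLn.
Context d (Y : measurableType d) (R : realType) (m : {measure set Y -> \bar R}).

(** This is max(ln |x|, -l). The cut is made inside the logarithm because [ln 0] is 0 by default,
    whereas the value -l is wanted at x = 0. *)
Definition ln_trunc (l : nat) (x : R) : R := ln (Num.max `|x| (expR (- l%:R))).

Lemma ln_trunc_lipschitz l (x y : R) :
  `|ln_trunc l x - ln_trunc l y| <= expR l%:R * `|x - y|.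
Proof.
have key (u v : R) : expR (- l%:R) <= v -> v <= u ->
    ln u - ln v <= expR l%:R * (u - v).
  move=> cv vu.
  have v0 : 0 < v by apply: lt_le_trans cv; exact: expR_gt0.
  have u0 : 0 < u by exact: lt_le_trans vu.
  rewrite -ln_div ?posrE//.
  have -> : u / v = 1 + (u / v - 1) by rewrite addrC subrK.
  apply: le_trans (le_ln1Dx _) _.
    by rewrite ltrBrDl subrr divr_gt0.
  have -> : u / v - 1 = v^-1 * (u - v) by rewrite mulrBr mulVf ?gt_eqF// mulrC.
  rewrite ler_wpM2r ?subr_ge0//.
  by rewrite -[leRHS]invrK -expRN lef_pV2 ?posrE// expR_gt0.
pose c := expR (- l%:R) : R.
have sym (x' y' : R) : `|y'| <= `|x'| ->
    `|ln_trunc l x' - ln_trunc l y'| <= expR l%:R * `|x' - y'|.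
  move=> yx; have cy : c <= Num.max `|y'| c by rewrite le_max lexx orbT.
  have yx' : Num.max `|y'| c <= Num.max `|x'| c.
    by rewrite ge_max !le_max yx lexx orbT.
  have y0 : 0 < Num.max `|y'| c by apply: lt_le_trans cy; exact: expR_gt0.
  rewrite ger0_norm; last first.
    by rewrite subr_ge0 ler_ln// posrE// (lt_le_trans y0).
  apply: (le_trans (key _ _ cy yx')); rewrite ler_wpM2l ?expR_ge0//.
  apply: (@le_trans _ _ (`|x'| - `|y'|)); last exact: lerB_dist.
  by rewrite /Num.max; do 2 case: ltP => ?; lra.
have [|/ltW] := leP `|y| `|x|; first exact: sym.
by rewrite (distrC x y) (distrC (ln_trunc l x)); exact: sym.
Qed.

Lemma essbounded_ln_trunc l f : essbounded m f ->
  essbounded m (fun y => ln_trunc l (f y)).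
Proof.
move=> bf; apply: (@essbounded_ln _ _ _ _ _ (expR (- l%:R))).
- exact: expR_gt0.
- by apply: essbounded_max; exact: essbounded_norm.
- by move=> y; rewrite le_max lexx orbT.
Qed.

Variable m0 : m setT != 0%E.
Local Notation X := (maxideal_space m0).
Local Notation ghat f := (@gelfand _ _ _ m m0 f).

(* the variance of [f] under a character vanishes *)
Lemma gelfand_lipschitz (phi : R -> R) (k : R) f (chi : X) :
  (forall x y, `|phi x - phi y| <= k * `|x - y|) ->
  essbounded m f -> essbounded m (fun y => phi (f y)) ->
  ghat (cls m (fun y => phi (f y))) chi = phi (ghat (cls m f) chi).
Proof.
move=> lip bf bphi; have mc := gelfand_mean chi.
set a := ghat (cls m f) chi.
have ba := essbounded_cst m a.
have bfa : essbounded m (fun y => f y - a) by exact: essboundedB.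
have bn := essbounded_norm bfa.
have n0 : ghat (cls m (fun y => `|f y - a|)) chi = 0.
  apply/eqP; rewrite -sqrf_eq0 expr2 -(gelfandM chi bn bn).
  rewrite (_ : (fun y => _) = (fun y => (f y - a) * (f y - a))); last first.
    by apply/funext => y; rewrite -normrM ger0_norm// -expr2 sqr_ge0.
  by rewrite (gelfandM chi bfa bfa) (meanB mc)// (mean_cst mc) subrr mulr0.
apply/eqP; rewrite -subr_eq0 -normr_le0.
have bc := essbounded_cst m (phi a).
rewrite -{1}(mean_cst mc (phi a)) -(meanB mc)//.
have -> : 0 = k * ghat (cls m (fun y => `|f y - a|)) chi by rewrite n0 mulr0.
rewrite -(meanZ mc)//.
have bB : essbounded m (fun y => phi (f y) - phi a) by exact: essboundedB.
have bZ : essbounded m (fun y => k * `|f y - a|) by exact: essboundedZ.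
rewrite ler_norml -(meanN mc)//; apply/andP; split; apply: (le_mean mc) => //.
- exact: essboundedN.
- by apply/nearW => y; have := lip (f y) a; rewrite ler_norml => /andP[].
- by apply/nearW => y; have := lip (f y) a; rewrite ler_norml => /andP[].
Qed.

Lemma gelfand_ln_trunc l (psi : Linf m) (chi : X) :
  ghat (cls m (fun y => ln_trunc l (psi y))) chi = ln_trunc l (ghat psi chi).
Proof.
have bp := essbounded_Linf psi; rewrite -(gelfand_cls psi chi).
apply: (@gelfand_lipschitz (ln_trunc l) (expR l%:R)) => //.
  exact: ln_trunc_lipschitz.
exact: essbounded_ln_trunc.
Qed.

Variable mu : {content set Y -> \bar R}.
Hypothesis mu1 : mu setT = 1%E.
Hypothesis mu0 : forall G, measurable G -> m G = 0%E -> mu G = 0%E.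

Lemma hat_measureE (f : Linf m) :
  (\int[hat_measure m0 mu]_chi (ghat f chi)%:E = (content_mean mu f)%:E)%E.
Proof.
have [P PP] := riesz_representation m0 (is_mean_content_mean mu1 mu0).
pose S := [set P : probability (borel_maxideal m0) R | regular_measure P /\
  forall f : Linf m, (\int[P]_chi (ghat f chi)%:E = (fa_integral mu f)%:E)%E].
have /getPex[_] : exists P, S P by exists P.
exact.
Qed.

Variable psi : Linf m.
Let P := hat_measure m0 mu.
Let u (chi : X) : \bar R := lne `|ghat psi chi|%:E.
Let g l (chi : X) : \bar R := (ln_trunc l (ghat psi chi))%:E.
Let M l := content_mean mu (fun y => ln_trunc l (psi y)).

Let bpsi l : essbounded m (fun y => ln_trunc l (psi y)).
Proof. by apply: essbounded_ln_trunc; exact: essbounded_Linf. Qed.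

Let gE l : (\int[P]_chi g l chi = (M l)%:E)%E.
Proof.
rewrite /M -(ae_eq_content_mean mu1 mu0 (bpsi l) (clsE (bpsi l))) -hat_measureE.
by apply: eq_integral => chi _; rewrite gelfand_ln_trunc.
Qed.

Let mg l : measurable_fun setT (g l : borel_maxideal m0 -> \bar R).
Proof.
rewrite (_ : g l = EFin \o ghat (cls m (fun y => ln_trunc l (psi y)))).
  by apply/measurable_EFinP; exact: measurable_gelfand.
by apply/funext => chi; rewrite /= gelfand_ln_trunc.
Qed.

Local Open Scope ereal_scope.

(** The cut level -l is at most 0, so truncation alters only the negative part, which becomes its
    minimum with l. *)
Let gpos l : (g l)^\+ = u^\+.
Proof.
apply/funext => chi; rewrite !unlock /= /g /u /ln_trunc.
set x := (`|ghat psi chi|)%R; have x0 : (0 <= x)%R by exact: normr_ge0.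
have e1 : (expR (- l%:R) <= 1 :> R)%R by rewrite -expR0 ler_expR oppr_le0.
have [x1|x1] := leP x 1%R.
  rewrite [RHS]max_r ?lne_le0 ?lee_fin// [LHS]max_r// lee_fin.
  by apply: ln_le0; rewrite ge_max x1.
have -> : (Num.max x (expR (- l%:R)) = x)%R by apply/max_idPl; exact: ltW (le_lt_trans e1 x1).
by rewrite lne_EFin// (lt_trans ltr01).
Qed.

Let gneg l : (g l)^\- = fun chi => mine (u^\- chi) l%:R%:E.
Proof.
apply/funext => chi; rewrite !unlock /= /g /u /ln_trunc.
set x := (`|ghat psi chi|)%R; have x0 : (0 <= x)%R by exact: normr_ge0.
have e0 : (0 < expR (- l%:R) :> R)%R by exact: expR_gt0.
have l0 : (0 <= l%:R :> R)%R by [].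
have [xe|xe] := leP x (expR (- l%:R)).
  rewrite expRK opprK [LHS]max_l ?lee_fin//.
  apply/esym/min_idPr; rewrite le_max; apply/orP; left.
  have [->|xn0] := eqVneq x 0%R; first by rewrite le0_lneNy// leey.
  have xgt0 : (0 < x)%R by rewrite lt0r xn0 x0.
  by rewrite lne_EFin// -EFinN lee_fin lerNr -[leRHS]expRK ler_ln// posrE.
have xgt0 : (0 < x)%R by exact: lt_trans xe.
rewrite lne_EFin//; apply/esym/min_idPl; rewrite ge_max -EFinN !lee_fin l0 andbT.
by rewrite lerNl -[leLHS]expRK ler_ln ?posrE// ltW.
Qed.

(** The integral of [g l] is a real number, which a difference with an infinite term never is. *)
Let gfin l : (\int[P]_chi u^\+ chi \is a fin_num) /\ (\int[P]_chi (g l)^\- chi \is a fin_num).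
Proof.
have := gE l; rewrite integralE gpos.
by case: (\int[P]_chi u^\+ chi) => [r| |]; case: (\int[P]_chi (g l)^\- chi) => [s| |].
Qed.

Let gneg_cvg (chi : X) : (g l)^\- chi @[l --> \oo] --> u^\- chi.
Proof.
under eq_fun do rewrite gneg.
have : 0 <= u^\- chi by exact: funeneg_ge0.
case: (u^\- chi) => [r r0|_|//].
  apply: cvg_near_cst; near=> l; apply/min_idPl; rewrite lee_fin.
  by near: l; exact: nbhs_infty_ger.
under eq_fun do rewrite min_r ?leey//.
by apply/cvgenyP; exact: cvg_id.
Unshelve. all: end_near. Qed.

Let mgneg l : measurable_fun setT ((g l)^\- : borel_maxideal m0 -> \bar R).
Proof. exact: measurable_funeneg. Qed.

Let muneg : measurable_fun setT (u^\- : borel_maxideal m0 -> \bar R).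
Proof.
by apply: (@emeasurable_fun_cvg _ (borel_maxideal m0) R setT (fun l => (g l)^\-)).
Qed.

Lemma integral_ln_le l : integral_ln m0 mu psi <= (M l)%:E.
Proof.
rewrite -gE /integral_ln [leLHS]integralE [leRHS]integralE gpos; apply: leeB => //.
by apply: ge0_le_integral => // chi _; rewrite gneg ge_min lexx.
Qed.

(** Monotone convergence of the negative parts min(u^-, l); the common positive part has a finite
    integral and can be moved across. *)
Lemma integral_ln_ge (c : R) : (forall l, c <= M l)%R -> c%:E <= integral_ln m0 mu psi.
Proof.
move=> cM; rewrite /integral_ln integralE -/P -/u.
have [ufin _] := gfin 0.
have ineg l : \int[P]_chi (g l)^\- chi <= \int[P]_chi u^\+ chi - c%:E.
  have [_ gl] := gfin l.
  have := gE l; rewrite integralE gpos -(fineK ufin) -(fineK gl) -!EFinB lee_fin.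
  by move=> [h]; have := cM l; lra.
have : \int[P]_chi u^\- chi <= \int[P]_chi u^\+ chi - c%:E.
  have := @cvg_monotone_convergence _ (borel_maxideal m0) R P setT measurableT
    (fun l => (g l)^\-) mgneg (fun l chi _ => funeneg_ge0 _ chi).
  have lim chi : limn (fun l => (g l)^\- chi) = u^\- chi by apply/cvg_lim => //.
  under [X in _ -> _ --> X]eq_integral do rewrite lim.
  move=> /(_ _)/wrap[chi _ k l kl|H].
    by rewrite !gneg le_min !ge_min lexx/= lee_fin ler_nat kl orbT.
  rewrite -(cvg_lim _ H)//; apply: lime_le; first by apply/cvg_ex; eexists; exact: H.
  by apply/nearW.
rewrite -(fineK ufin) -EFinB.
have : 0 <= \int[P]_chi u^\- chi by apply: integral_ge0 => chi _; exact: funeneg_ge0.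
case: (\int[P]_chi u^\- chi) => [r _|//|//].
by rewrite -EFinB !lee_fin; lra.
Qed.

End IntegralLn.

(** * Duality for the transfer operator *)

Section RealIntegral.
Context d (Y : measurableType d) (R : realType) (m : {measure set Y -> \bar R}).

Definition L1fun (g : Y -> R) : Prop := m.-integrable setT (EFin \o g).

Definition integ (g : Y -> R) : R := fine (\int[m]_y (g y)%:E)%E.

Lemma L1fun_measurable g : L1fun g -> measurable_fun setT g.
Proof. by move=> /measurable_int /measurable_EFinP. Qed.

Lemma integE g : L1fun g -> (\int[m]_y (g y)%:E = (integ g)%:E)%E.
Proof. by move=> ig; rewrite /integ fineK//; exact: integrable_fin_num ig. Qed.

Lemma L1funD f g : L1fun f -> L1fun g -> L1fun (fun y => f y + g y).
Proof. by move=> lf lg; exact: (integrableD measurableT lf lg). Qed.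

Lemma L1funZ a f : L1fun f -> L1fun (fun y => a * f y).
Proof. by move=> lf; exact: (integrableZl measurableT a lf). Qed.

Lemma integD f g : L1fun f -> L1fun g ->
  integ (fun y => f y + g y) = integ f + integ g.
Proof.
move=> lf lg; apply: EFin_inj; rewrite -integE; last exact: L1funD.
rewrite EFinD -!integE// -(integralD measurableT)//.
Qed.

Lemma integZ a f : L1fun f -> integ (fun y => a * f y) = a * integ f.
Proof.
move=> lf; apply: EFin_inj; rewrite -integE; last exact: L1funZ.
by rewrite EFinM -!integE// -(integralZl measurableT).
Qed.

Lemma integ_ae_eq (f g : Y -> R) : measurable_fun setT f -> measurable_fun setT g ->
  (\forall y \ae m, f y = g y) -> integ f = integ g.
Proof.
move=> mf mg fg; congr fine; apply: ae_eq_integral => //.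
- exact/measurable_EFinP.
- exact/measurable_EFinP.
- by apply: filterS fg => y -> _.
Qed.

Lemma L1fun_ae_le (f g : Y -> R) : measurable_fun setT f -> L1fun g ->
  (\forall y \ae m, `|f y| <= g y) -> L1fun f.
Proof.
move=> mf lg fg; apply/integrableP; split; first exact/measurable_EFinP.
have [mg gfin] := integrableP _ _ _ lg.
apply: le_lt_trans gfin; apply: ae_ge0_le_integral => //.
- by do 2 apply: measurableT_comp => //.
- by apply: measurableT_comp.
- apply: filterS fg => y fg _ /=; rewrite lee_fin.
  by rewrite (le_trans fg)// ler_norm.
Qed.

Lemma L1fun_essM f g : essbounded m f -> L1fun g -> L1fun (fun y => f y * g y).
Proof.
move=> [mf [M fM]] lg; have mg := L1fun_measurable lg.
have lng : L1fun (fun y => `|g y|) by exact: (integrable_abse lg).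
apply: (@L1fun_ae_le _ (fun y => M * `|g y|)).
- exact: measurable_funM.
- exact: L1funZ.
- by apply: filterS fM => y fM; rewrite normrM ler_wpM2r.
Qed.

Lemma integ_ge0 f : L1fun f -> (\forall y \ae m, 0 <= f y) -> 0 <= integ f.
Proof.
move=> lf f0; have mf := L1fun_measurable lf.
rewrite (@integ_ae_eq _ (fun y => `|f y|))//.
- by apply/fine_ge0/integral_ge0 => y _; rewrite lee_fin.
- exact: measurableT_comp.
- by apply: filterS f0 => y; move/ger0_norm.
Qed.

Lemma le_integ f g : L1fun f -> L1fun g -> (\forall y \ae m, f y <= g y) ->
  integ f <= integ g.
Proof.
move=> lf lg fg; rewrite -subr_ge0 -mulN1r -integZ// -integD//; last exact: L1funZ.
apply: integ_ge0; first by apply: L1funD => //; exact: L1funZ.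
by apply: filterS fg => y; rewrite mulN1r subr_ge0.
Qed.

Lemma L1fun_indic B : measurable B -> (m B < +oo)%E -> L1fun (\1_B).
Proof.
move=> mB Bfin; apply/integrableP; split; first exact/measurable_EFinP.
under eq_integral do rewrite /= ger0_norm//.
by rewrite integral_indic// setIT.
Qed.

Lemma integ_indic B : measurable B -> integ \1_B = fine (m B).
Proof. by move=> mB; rewrite /integ integral_indic// setIT. Qed.

Lemma is_mean_density (v : Y -> R) : L1fun v -> (\forall y \ae m, 0 <= v y) ->
  0 < integ v -> is_mean m (fun f => integ (fun y => f y * v y) / integ v).
Proof.
move=> lv v0 iv0; split.
- move=> a f g bf bg.
  rewrite (_ : (fun y => _) = (fun y => a * (f y * v y) + g y * v y)); last first.
    by apply/funext => y; rewrite mulrDl mulrA.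
  rewrite integD ?integZ; [|exact: L1fun_essM|by apply: L1funZ; exact: L1fun_essM|
    exact: L1fun_essM].
  by rewrite mulrDl mulrA.
- move=> f bf f0; apply: divr_ge0; last exact: ltW.
  apply: integ_ge0; first exact: L1fun_essM.
  by apply: filterS2 f0 v0 => y; exact: mulr_ge0.
- rewrite (_ : (fun y => _) = v); first by rewrite divff// gt_eqF.
  by apply/funext => y; rewrite mul1r.
Qed.

Hypothesis m_sfinite : sigma_finite setT m.

Lemma sigma_finite_pos_subset P : measurable P -> m P != 0%E ->
  exists B, [/\ measurable B, B `<=` P, (0 < m B)%E & (m B < +oo)%E].
Proof.
move=> mP P0; have [F FT Ffin] := m_sfinite.
apply: contrapT => H; move/eqP: P0; apply.
have PF : P = \bigcup_k (P `&` F k) by rewrite -setI_bigcupr -FT setIT.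
have : m.-negligible (\bigcup_k (P `&` F k)).
  apply: negligible_bigcup => k; have [mF Fk] := Ffin k.
  have mPF : measurable (P `&` F k) by exact: measurableI.
  apply/negligibleP => //; apply/eqP; rewrite eq_le measure_ge0 andbT leNgt.
  apply/negP => PF0; apply: H; exists (P `&` F k); split => //.
  by apply: le_lt_trans Fk; apply: le_measure; rewrite ?inE.
by rewrite -PF => /negligibleP; exact.
Qed.

Lemma not_ae_pos_subset (P : Y -> Prop) : measurable [set y | ~ P y] ->
  ~ (\forall y \ae m, P y) ->
  exists B, [/\ measurable B, B `<=` [set y | ~ P y], (0 < m B)%E & (m B < +oo)%E].
Proof.
move=> mP nP; apply: sigma_finite_pos_subset => //.
by apply/negP => /eqP P0; apply: nP; exists [set y | ~ P y]; split.
Qed.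

(** [A] is known only through pairings with integrable functions. By sigma-finiteness, indicators of
    sets of finite measure already detect a non-null set where f < -1/(k+1). *)
Lemma ae_ge0_test (f : Y -> R) : essbounded m f ->
  (forall B, measurable B -> (m B < +oo)%E -> 0 <= integ (fun y => f y * \1_B y)) ->
  \forall y \ae m, 0 <= f y.
Proof.
move=> bf H.
suff : forall k : nat, \forall y \ae m, - k.+1%:R^-1 <= f y.
  move=> /ae_foralln; apply: filterS => y h; apply/ler_addgt0Pl => e e0.
  have [k ke] := ltr_add_invr e0.
  rewrite add0r in ke; rewrite -(subrr k.+1%:R^-1).
  by apply: lerD; [exact: ltW|exact: h].
move=> k; apply: contrapT => nk.
have mS : measurable [set y | ~ (- k.+1%:R^-1 <= f y)].
  rewrite (_ : mkset _ = f @^-1` `]-oo, - k.+1%:R^-1[).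
    by rewrite -[X in measurable X]setTI; apply: bf.1.
  by apply/seteqP; split => y; rewrite /= in_itv/= ltNge => /negP.
have [B [mB BS B0 Bfin]] := not_ae_pos_subset mS nk.
have := H B mB Bfin; apply/negP; rewrite -ltNge.
have lB := L1fun_indic mB Bfin.
have c0 : 0 < (k.+1%:R^-1 : R) by rewrite invr_gt0.
apply: (@le_lt_trans _ _ (integ (fun y => - k.+1%:R^-1 * \1_B y))).
  apply: le_integ; [exact: L1fun_essM|exact: L1funZ|].
  apply/nearW => y; rewrite indicE; have [/set_mem /BS/= /negP|] := boolP (y \in B).
    by rewrite -ltNge => /ltW; rewrite !mulr1.
  by rewrite !mulr0.
rewrite integZ// integ_indic// mulNr oppr_lt0 mulr_gt0// fine_gt0//.
by rewrite B0 Bfin.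
Qed.

Lemma ae_le_test (f g : Y -> R) : essbounded m f -> essbounded m g ->
  (forall B, measurable B -> (m B < +oo)%E ->
    integ (fun y => f y * \1_B y) <= integ (fun y => g y * \1_B y)) ->
  \forall y \ae m, f y <= g y.
Proof.
move=> bf bg H.
have : \forall y \ae m, 0 <= g y - f y.
  apply: ae_ge0_test; first exact: essboundedB.
  move=> B mB Bfin; have lB := L1fun_indic mB Bfin.
  rewrite (_ : (fun y => _) = (fun y => g y * \1_B y + -1 * (f y * \1_B y))).
    rewrite integD ?integZ; [|exact: L1fun_essM|exact: L1fun_essM|
      by apply: L1funZ; exact: L1fun_essM].
    by rewrite mulN1r subr_ge0 H.
  by apply/funext => y; rewrite mulrBl mulN1r.
by apply: filterS => y; rewrite subr_ge0.
Qed.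

Lemma ae_eq_test (f g : Y -> R) : essbounded m f -> essbounded m g ->
  (forall B, measurable B -> (m B < +oo)%E ->
    integ (fun y => f y * \1_B y) = integ (fun y => g y * \1_B y)) ->
  \forall y \ae m, f y = g y.
Proof.
move=> bf bg H; apply: filterS2 (ae_le_test bf bg _) (ae_le_test bg bf _) => [y h1 h2||].
- by apply/eqP; rewrite eq_le h1 h2.
- by move=> B mB Bfin; rewrite H.
- by move=> B mB Bfin; rewrite H.
Qed.

End RealIntegral.

Section Transfer.
Context d (Y : measurableType d) (R : realType) (m : {measure set Y -> \bar R}).
Hypothesis m_sfinite : sigma_finite setT m.
Variables (beta : Y -> Y) (C : R).
Hypothesis mbeta : measurable_fun setT beta.
Hypothesis beta_bound : forall G : set Y, measurable G ->
  (m (beta @^-1` G) <= C%:E * m G)%E.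
Variable A : Linf m -> Linf m.
Hypothesis AE : forall (f : Linf m) (g : LspaceType1 m),
  (\int[m]_y ((f y : R) * g (beta y))%:E = \int[m]_y ((A f y : R) * g y)%:E)%E.

Lemma measurable_beta_preimage G : measurable G -> measurable (beta @^-1` G).
Proof. by move=> mG; rewrite -[X in measurable X]setTI; exact: mbeta. Qed.

Lemma ae_beta (P : Y -> Prop) : (\forall y \ae m, P y) -> \forall y \ae m, P (beta y).
Proof.
move=> [N [mN N0 PN]]; exists (beta @^-1` N); split.
- exact: measurable_beta_preimage.
- apply/eqP; rewrite eq_le measure_ge0 andbT (le_trans (beta_bound mN))//.
  by rewrite N0 mule0.
- by move=> y /= h; apply: PN.
Qed.

Lemma essbounded_beta f : essbounded m f -> essbounded m (fun y => f (beta y)).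
Proof.
move=> [mf [M fM]]; split; first exact: measurableT_comp.
by exists M; exact: ae_beta fM.
Qed.

Lemma measurable_iter_beta n : measurable_fun setT (iter n beta).
Proof. elim: n => [|n ih]; [exact: measurable_id|exact: (measurableT_comp mbeta ih)]. Qed.

Lemma essbounded_iter_beta n f : essbounded m f ->
  essbounded m (fun y => f (iter n beta y)).
Proof.
by elim: n f => // n ih f bf; apply: (ih (fun y => f (beta y))); exact: essbounded_beta.
Qed.

Lemma ae_iter_beta n (P : Y -> Prop) :
  (\forall y \ae m, P y) -> \forall y \ae m, P (iter n beta y).
Proof.
by elim: n P => // n ih P aP; apply: (ih (fun y => P (beta y))); exact: ae_beta.
Qed.

Lemma L1_class g : L1fun m g -> exists G : LspaceType1 m, \forall y \ae m, (G y : R) = g y.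
Proof.
move=> lg; apply: Lspace_class; first exact: L1fun_measurable lg.
rewrite /finite_norm Lnorm1; have [_] := integrableP _ _ _ lg.
exact.
Qed.

Let mG (G : LspaceType1 m) : measurable_fun setT (G : Y -> R).
Proof. exact: (@measurable_funPT _ _ _ _ (repr (G : {mfun_ m, Y >-> measurableTypeR R}))). Qed.

(** Replacing a class by a representative under [beta] relies on preimages of null sets being null.
    Integrability of g o beta is the duality identity itself, read at f = 1 and |g|. *)
Lemma transfer_duality1 (f : Linf m) (g : Y -> R) : L1fun m g ->
  L1fun m (fun y => g (beta y)) /\
  integ m (fun y => f y * g (beta y)) = integ m (fun y => A f y * g y).
Proof.
have dual (F : Linf m) (h : Y -> R) : L1fun m h ->
    (\int[m]_y (F y * h (beta y))%:E = \int[m]_y (A F y * h y)%:E)%E.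
  move=> lh; have [H HE] := L1_class lh.
  have mh := L1fun_measurable lh.
  have mF : measurable_fun setT (F : Y -> R) by have [] := essbounded_Linf F.
  have mAF : measurable_fun setT (A F : Y -> R) by have [] := essbounded_Linf (A F).
  have mH := mG H.
  transitivity (\int[m]_y (F y * H (beta y))%:E)%E.
    apply: ae_eq_integral => //.
    - apply/measurable_EFinP; apply: measurable_funM => //.
      exact: measurableT_comp.
    - apply/measurable_EFinP; apply: measurable_funM => //.
      exact: measurableT_comp.
    - by apply: filterS (ae_beta HE) => y -> _.
  rewrite AE; apply: ae_eq_integral => //.
  - by apply/measurable_EFinP; exact: measurable_funM.
  - by apply/measurable_EFinP; exact: measurable_funM.
  - by apply: filterS HE => y -> _.
move=> lg; split; last by rewrite /integ dual.
have lng : L1fun m (fun y => `|g y|) by exact: (integrable_abse lg).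
have mg := L1fun_measurable lg.
apply/integrableP; split; first by apply/measurable_EFinP; exact: measurableT_comp.
have b1 := essbounded_cst m (1 : R).
have -> : (\int[m]_y `|(EFin \o (fun y => g (beta y))) y| =
    \int[m]_y (cls m (fun=> 1) y * `|g (beta y)|)%:E)%E.
  apply: ae_eq_integral => //.
  - by apply: measurableT_comp => //; apply/measurable_EFinP; exact: measurableT_comp.
  - apply/measurable_EFinP; apply: measurable_funM.
      by have [] := essbounded_Linf (cls m (fun=> 1 : R)).
    by apply: measurableT_comp => //; exact: measurableT_comp.
  - by apply: filterS (clsE b1) => y -> _; rewrite mul1r.
rewrite (dual _ (fun y => `|g y|))//.
have := L1fun_essM (essbounded_Linf (A (cls m (fun=> 1)))) lng.
by move=> /integrable_fin_num; rewrite fin_numElt => /(_ measurableT)/andP[].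
Qed.

Lemma L1fun_iter_beta n g : L1fun m g -> L1fun m (fun y => g (iter n beta y)).
Proof.
elim: n g => // n ih g lg; apply: (ih (fun y => g (beta y))).
by have [] := transfer_duality1 (cls m g) lg.
Qed.

Definition transfer (n : nat) (f : Y -> R) : Y -> R := iter n A (cls m f).

Lemma essbounded_transfer n f : essbounded m (transfer n f).
Proof. exact: essbounded_Linf. Qed.

Lemma transfer_duality n (f g : Y -> R) : essbounded m f -> L1fun m g ->
  integ m (fun y => f y * g (iter n beta y)) = integ m (fun y => transfer n f y * g y).
Proof.
move=> bf; elim: n g => [|n ih] g lg.
  have mg := L1fun_measurable lg.
  apply: integ_ae_eq.
  - by apply: measurable_funM => //; have [] := bf.
  - by apply: measurable_funM => //; have [] := essbounded_transfer 0 f.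
  - by apply: filterS (clsE bf) => y; rewrite /transfer/= => ->.
have [lgb E] := transfer_duality1 (iter n A (cls m f)) lg.
by rewrite (ih (fun y => g (beta y)))// E.
Qed.

Lemma transfer_le_cst n (f : Y -> R) (c : R) : essbounded m f ->
  (forall B, measurable B -> (m B < +oo)%E ->
     integ m (fun y => f y * \1_B (iter n beta y)) <= c * fine (m B)) ->
  \forall y \ae m, transfer n f y <= c.
Proof.
move=> bf H; apply: ae_le_test => //; [exact: essbounded_transfer|exact: essbounded_cst|].
move=> B mB Bfin; have lB := L1fun_indic mB Bfin.
by rewrite integZ// integ_indic// -transfer_duality// H.
Qed.

(** [A] is an arbitrary map satisfying the duality identity; linearity follows a.e. since both sides
    have the same pairings with indicators. *)
Lemma transferZD n a (f g : Y -> R) : essbounded m f -> essbounded m g ->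
  \forall y \ae m, transfer n (fun y => a * f y + g y) y =
                   a * transfer n f y + transfer n g y.
Proof.
move=> bf bg; have btf := essbounded_transfer n f; have btg := essbounded_transfer n g.
have baf : essbounded m (fun y => a * f y + g y).
  by apply: essboundedD => //; exact: essboundedZ.
apply: ae_eq_test => //; first exact: essbounded_transfer.
  by apply: essboundedD => //; exact: essboundedZ.
move=> B mB Bfin; have lB := L1fun_indic mB Bfin.
have lBn := L1fun_iter_beta n lB.
rewrite -transfer_duality//.
transitivity (a * integ m (fun y => f y * \1_B (iter n beta y)) +
    integ m (fun y => g y * \1_B (iter n beta y))).
  rewrite -integZ -?integD.
  - by congr integ; apply/funext => y; rewrite mulrDl mulrA.
  - by apply: L1funZ; exact: L1fun_essM.
  - exact: L1fun_essM.
  - exact: L1fun_essM.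
rewrite !transfer_duality// -integZ -?integD.
- by congr integ; apply/funext => y; rewrite mulrDl mulrA.
- by apply: L1funZ; exact: L1fun_essM.
- exact: L1fun_essM.
- exact: L1fun_essM.
Qed.

Lemma transfer_ge0 n (f : Y -> R) : essbounded m f -> (\forall y \ae m, 0 <= f y) ->
  \forall y \ae m, 0 <= transfer n f y.
Proof.
move=> bf f0; apply: ae_ge0_test => //; first exact: essbounded_transfer.
move=> B mB Bfin; have lB := L1fun_indic mB Bfin.
rewrite -transfer_duality//; apply: integ_ge0.
  by apply: L1fun_essM => //; exact: L1fun_iter_beta.
by apply: filterS f0 => y f0; rewrite mulr_ge0// indicE.
Qed.

Lemma le_transfer n (f g : Y -> R) : essbounded m f -> essbounded m g ->
  (\forall y \ae m, f y <= g y) -> \forall y \ae m, transfer n f y <= transfer n g y.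
Proof.
move=> bf bg fg; apply: ae_le_test => //; [exact: essbounded_transfer|
  exact: essbounded_transfer|].
move=> B mB Bfin; have lB := L1fun_indic mB Bfin.
rewrite -!transfer_duality//; apply: le_integ.
- by apply: L1fun_essM => //; exact: L1fun_iter_beta.
- by apply: L1fun_essM => //; exact: L1fun_iter_beta.
- by apply: filterS fg => y fg; rewrite ler_wpM2r// indicE.
Qed.

Lemma transfer_sum n (I : Type) (s : seq I) (c : I -> R) (F : I -> Y -> R) :
  (forall i, essbounded m (F i)) ->
  \forall y \ae m, transfer n (fun y => \sum_(i <- s) c i * F i y) y =
                   \sum_(i <- s) c i * transfer n (F i) y.
Proof.
move=> bF; elim: s => [|i s ih].
  have b0 := essbounded_cst m (0 : R).
  (* The empty sum: linearity with coefficient -1 gives A^n 0 = - A^n 0 + A^n 0 = 0. *)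
  apply: filterS (transferZD n (-1) b0 b0) => y.
  rewrite big_nil mulr0 addr0 mulN1r addNr => E; rewrite -[RHS]E; congr (transfer n _ y).
  by apply/funext => z; rewrite big_nil.
have bs : essbounded m (fun y => \sum_(i <- s) c i * F i y).
  by apply: essbounded_sum => j _; exact: essboundedZ.
apply: filterS2 ih (transferZD n (c i) (bF i) bs) => y ih E.
rewrite big_cons -ih -E; congr (transfer n _ y).
by apply/funext => z; rewrite big_cons.
Qed.

(** The bound on preimages says A 1 <= C; duality then gives one factor [C] per step. *)
Lemma integ_beta_le (g : Y -> R) (k : nat) : 0 <= C -> L1fun m g ->
  (\forall y \ae m, 0 <= g y) ->
  integ m (fun y => g (iter k beta y)) <= C ^+ k * integ m g.
Proof.
move=> C0; have b1 := essbounded_cst m (1 : R).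
have A1 : \forall y \ae m, transfer 1 (fun=> 1) y <= C.
  apply: transfer_le_cst => // B mB Bfin.
  have lB := L1fun_indic mB Bfin.
  rewrite (_ : (fun y => _) = \1_(beta @^-1` B)); last first.
    by apply/funext => y; rewrite mul1r.
  rewrite integ_indic; last exact: measurable_beta_preimage.
  have := beta_bound mB; move: Bfin; rewrite -ge0_fin_numE// => /fineK <-.
  case: (m (beta @^-1` B)) => [r|//|/= _]; first by rewrite -EFinM lee_fin.
  by rewrite mulr_ge0// fine_ge0.
elim: k g => [|k ih] g lg g0; first by rewrite expr0 mul1r.
have lgb : L1fun m (fun y => g (beta y)) := L1fun_iter_beta 1 lg.
rewrite (le_trans (ih (fun y => g (beta y)) lgb (ae_beta g0)))//.
rewrite exprSr -mulrA ler_wpM2l ?exprn_ge0//.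
have := @transfer_duality 1 (fun=> 1) g b1 lg.
rewrite (_ : (fun y => _) = (fun y => g (beta y))); last first.
  by apply/funext => y; rewrite mul1r.
move=> ->; rewrite -integZ//; apply: le_integ.
- by apply: L1fun_essM => //; exact: essbounded_transfer.
- exact: L1funZ.
- by apply: filterS2 A1 g0 => y h1 h2; rewrite ler_wpM2r.
Qed.

End Transfer.

(** * Bounds for the t-entropy *)

Section UpperBound.
Context d (Y : measurableType d) (R : realType) (m : {measure set Y -> \bar R}).
Hypothesis m_sfinite : sigma_finite setT m.
Variables (beta : Y -> Y) (C : R).
Hypothesis mbeta : measurable_fun setT beta.
Hypothesis beta_bound : forall G : set Y, measurable G ->
  (m (beta @^-1` G) <= C%:E * m G)%E.
Variable A : Linf m -> Linf m.
Hypothesis AE : forall (f : Linf m) (g : LspaceType1 m),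
  (\int[m]_y ((f y : R) * g (beta y))%:E = \int[m]_y ((A f y : R) * g y)%:E)%E.
Variable mu : {content set Y -> \bar R}.
Hypothesis mu1 : mu setT = 1%E.
Hypothesis mu0 : forall G, measurable G -> m G = 0%E -> mu G = 0%E.

Lemma state_ae_eq (nu : Linf m -> R) (f g : Linf m) : states nu ->
  (\forall y \ae m, (f y : R) = g y) -> nu f = nu g.
Proof.
move=> [lin _ _] fg; have := lin 0 f g f; rewrite mul0r add0r; apply.
by apply: filterS fg => y ->; rewrite mul0r add0r.
Qed.

Lemma state_cls (nu : Linf m -> R) (f : Linf m) : states nu -> nu (cls m f) = nu f.
Proof. by move=> snu; apply: state_ae_eq => //; exact: clsE (essbounded_Linf f). Qed.

(* ln x <= x - 1 at x = b e^k / (a K) *)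
Lemma gibbs_term (a b k K : R) : 0 <= a -> 0 <= b -> 0 < K ->
  ((if a == 0%R then 0 else a%:E * lne (b / a)%:E) <=
   (b * expR k / K - a - a * k + a * ln K)%:E)%E.
Proof.
move=> a0 b0 K0; have [->|an0] := eqVneq a 0.
  rewrite lee_fin !mul0r addr0 !subr0; apply: divr_ge0; last exact: ltW.
  by rewrite mulr_ge0// expR_ge0.
have agt0 : 0 < a by rewrite lt0r an0.
have [->|bn0] := eqVneq b 0.
  by rewrite mul0r le0_lneNy// gt0_muleNy ?leNye// lte_fin.
have bgt0 : 0 < b by rewrite lt0r bn0.
have ba0 : 0 < b / a by rewrite divr_gt0.
rewrite lne_EFin// -EFinM lee_fin.
pose x := b * expR k / (a * K).
have x0 : 0 < x by rewrite divr_gt0 ?mulr_gt0// expR_gt0.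
have lnx : ln x = ln (b / a) + k - ln K.
  have -> : x = (b / a) * expR k / K by rewrite /x invfM; ring.
  have e1 : ln (b / a * expR k) = ln (b / a) + k.
    by rewrite lnM ?posrE ?expR_gt0// expRK.
  by rewrite ln_div ?e1// posrE mulr_gt0// expR_gt0.
have : ln x <= x - 1.
  have -> : x = 1 + (x - 1) by rewrite addrC subrK.
  by rewrite [X in _ <= X]addrAC subrr add0r; apply: le_ln1Dx; rewrite ltrBrDl subrr.
rewrite -(ler_pM2l agt0 (ln x)) lnx.
have -> : a * (x - 1) = b * expR k / K - a.
  by rewrite /x; field; rewrite an0 gt_eqF.
by rewrite mulrBr mulrDr => ?; lra.
Qed.

(** [e] is the width of the level sets of [u], on which [k] satisfies k <= u <= k + e: the left
    inequality bounds A^n e^k by [K], the right one costs [e] in the mean of [u]. *)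
Lemma tau_n_le n (u : Y -> R) (K e : R) : 0 < e -> 0 < K -> essbounded m u ->
  (\forall y \ae m, transfer A n (fun y => expR (u y)) y <= K) ->
  (tau_n A mu n <= (ln K - content_mean mu u + e)%:E)%E.
Proof.
move=> e0 K0 bu uK.
have [T [lab [k [E [mlab mE E0 uE]]]]] := essbounded_label e0 bu.
pose cell t := lab @^-1` [set t] : set Y.
(* A partition of unity is a finite set of classes, so distinct cells must give distinct classes;
   null cells would all give the class of 0. *)
pose s := [seq t <- enum T | m (cell t) != 0%E].
have bcell t : essbounded m (\1_(cell t) : Y -> R).
  by apply: essbounded_indic; exact: mlab.
pose h t := cls m \1_(cell t).
have us : uniq s by rewrite filter_uniq// enum_uniq.
have ncell : \forall y \ae m, lab y \in s.
  have : \forall y \ae m, forall t, m (cell t) = 0%E -> lab y <> t.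
    apply: filter_forall => t; have [t0|t0] := pselect (m (cell t) = 0%E).
      by exists (cell t); split => //; [exact: mlab|move=> y /= /not_implyP[_ /contrapT]].
    by apply/nearW => y /t0.
  apply: filterS => y H; rewrite mem_filter mem_enum andbT.
  by apply/eqP => /H; exact.
pose step (c : T -> R) y := \sum_(t <- s) c t * \1_(cell t) y.
have bstep c : essbounded m (step c).
  by apply: essbounded_sum => t _; exact: essboundedZ.
have stepE c : \forall y \ae m, step c y = c (lab y).
  apply: filterS ncell => y ys; rewrite /step (bigD1_seq (lab y))//= big1 ?addr0.
    by rewrite indicE mem_set// mulr1.
  move=> t tl; rewrite indicE memNset ?mulr0//= => ltE.
  by rewrite -ltE eqxx in tl.
have hE : \forall y \ae m, forall t, (h t y : R) = \1_(cell t) y.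
  by apply: filter_forall => t; exact: clsE.
have h_inj : {in s &, injective h}.
  move=> t t'; rewrite mem_filter => /andP[/eqP t0 _] _ htt'; apply: contrapT => tt'.
  apply: t0; apply/negligibleP; first exact: mlab.
  have [N [mN N0 hN]] := hE; exists N; split => // y yt; apply: hN => /= hy.
  have e1 : \1_(cell t) y = 1 :> R by rewrite indicE mem_set.
  have e2 : \1_(cell t') y = 0 :> R.
    by rewrite indicE memNset// /cell/= => yt'; apply: tt'; rewrite -yt' -yt.
  by have := hy t; rewrite htt' hy e1 e2 => /esym/eqP; rewrite oner_eq0.
pose D : {fset Linf m} := [fset g in [seq h t | t <- s]]%fset.
have Dperm : perm_eq (enum_fset D) [seq h t | t <- s].
  apply: uniq_perm; first exact: fset_uniq.
    by rewrite map_inj_in_uniq.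
  by move=> g; rewrite !inE.
have PD : partition_of_unity D.
  split.
    move=> g; rewrite !inE => /mapP[t _ ->].
    by apply: filterS (clsE (bcell t)) => y ->; rewrite indicE.
  apply: filterS2 hE (stepE (fun=> 1)) => y {}hE sE; rewrite -[RHS]sE.
  rewrite (perm_big _ Dperm) big_map /step; apply: eq_bigr => t _.
  by rewrite hE mul1r.
apply: (@le_trans _ _ (tau_nD A mu n D)).
  by apply: ereal_inf_lbound; exists D.
apply/ge_ereal_sup => _ [nu snu <-].
rewrite (perm_big _ Dperm) big_map.
have mM := is_mean_content_mean mu1 mu0.
pose Nu (f : Y -> R) := nu (cls m f).
have mN : is_mean m Nu := state_mean snu.
pose a t := content_mean mu \1_(cell t).
pose b t := Nu (transfer A n \1_(cell t)).
have aE t : fa_integral mu (h t) = a t.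
  by apply: (ae_eq_content_mean mu1 mu0) => //; exact: clsE.
have bE t : nu (iter n A (h t)) = b t by rewrite /b /Nu /transfer state_cls.
have a0 t : 0 <= a t.
  by apply: (mean_ge0 mM) => //; apply/nearW => y; rewrite indicE.
have b0 t : 0 <= b t.
  apply: (mean_ge0 mN); first exact: essbounded_transfer.
  by apply: (transfer_ge0 m_sfinite mbeta beta_bound AE) => //; apply/nearW => y; rewrite indicE.
apply: (@le_trans _ _ (\sum_(t <- s)
    (b t * expR (k t) / K - a t - a t * k t + a t * ln K))%:E).
  rewrite -sumEFin; apply: lee_sum => t _; rewrite aE bE.
  exact: gibbs_term.
rewrite lee_fin.
have asum c : \sum_(t <- s) a t * c t = content_mean mu (step c).
  rewrite /step (mean_sum mM); last by move=> t _; exact: essboundedZ.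
  by apply: eq_bigr => t _; rewrite (meanZ mM)// mulrC.
have bsum : \sum_(t <- s) b t * expR (k t) <= K.
  apply: (@le_trans _ _ (Nu (transfer A n (step (fun t => expR (k t)))))).
    rewrite (@ae_eq_mean _ _ _ _ _ mN _
      (fun y => \sum_(t <- s) expR (k t) * transfer A n \1_(cell t) y)).
    - rewrite (mean_sum mN); last first.
        by move=> t _; apply: essboundedZ; exact: essbounded_transfer.
      rewrite le_eqVlt; apply/orP; left; apply/eqP; apply: eq_bigr => t _.
      by rewrite (meanZ mN) 1?mulrC//; exact: essbounded_transfer.
    - exact: essbounded_transfer.
    - by apply: essbounded_sum => t _; apply: essboundedZ; exact: essbounded_transfer.
    - exact: (transfer_sum m_sfinite mbeta beta_bound AE).
  apply: (mean_le_cst mN); first exact: essbounded_transfer.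
  apply: filterS2 uK (@le_transfer _ _ _ _ m_sfinite _ _ mbeta beta_bound _ AE n
    (step (fun t => expR (k t))) (fun y => expR (u y)) _ _ _) => //.
  - by move=> y h1 h2; exact: le_trans h2 h1.
  - exact: essbounded_expR.
  - have aeE : \forall y \ae m, E y.
      exists (~` E); split => //; exact: measurableC.
    apply: filterS2 aeE (stepE (fun t => expR (k t))) => y Ey ->.
    by rewrite ler_expR; have /andP[] := uE _ Ey.
have asum1 : \sum_(t <- s) a t = 1.
  rewrite -[RHS](mean_cst mM 1) -(@ae_eq_mean _ _ _ _ _ mM (step (fun=> 1)))//.
  - by rewrite -asum; apply: eq_bigr => t _; rewrite mulr1.
  - exact: essbounded_cst.
have asumk : content_mean mu u - e <= \sum_(t <- s) a t * k t.
  rewrite asum -{1}(mean_cst mM e) -(meanB mM)//; last exact: essbounded_cst.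
  apply: (le_mean mM) => //.
    by apply: essboundedB => //; exact: essbounded_cst.
  have aeE : \forall y \ae m, E y.
    exists (~` E); split => //; exact: measurableC.
  apply: filterS2 aeE (stepE k) => y Ey ->.
  by have /andP[_ ] := uE _ Ey; rewrite lerBlDr.
rewrite big_split/= !sumrB -!mulr_suml asum1 mul1r.
have : (\sum_(t <- s) b t * expR (k t)) / K <= 1.
  by rewrite ler_pdivrMr// mul1r.
by move: asumk => ? ?; lra.
Qed.

End UpperBound.

(** * Passage to the limit in regularized entropy sums *)

Section EntropySums.
Context (R : realType) (I : eqType) (s : seq I) (a b : I -> R) (K kap : R).
Hypothesis a0 : forall i, 0 <= a i.
Hypothesis b0 : forall i, 0 <= b i.
Hypothesis H : forall e, 0 < e ->
  \sum_(i <- s) a i * ln (a i / (b i + e)) <= kap + K * e.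

Let term_ge e i : 0 < e -> e <= 1 ->
  - `|a i * ln (a i / (b i + 1))| <= a i * ln (a i / (b i + e)).
Proof.
move=> e0 e1; have [->|an0] := eqVneq (a i) 0; first by rewrite !mul0r normr0 oppr0.
have agt0 : 0 < a i by rewrite lt0r an0 a0.
apply: (@le_trans _ _ (a i * ln (a i / (b i + 1)))); first by rewrite lerNl -normrN ler_norm.
have be : 0 < b i + e by rewrite ltr_wpDl.
have b1 : 0 < b i + 1 by rewrite ltr_wpDl.
rewrite ler_pM2l// ler_ln ?posrE ?divr_gt0// ler_pM2l// lef_pV2 ?posrE//.
by rewrite lerD2l.
Qed.

(** If b i = 0 < a i, the term a i ln(a i / e) blows up as e tends to 0, while the other terms stay
    bounded below and the right side of [H] stays bounded. *)
Let b_gt0 i : i \in s -> a i != 0 -> 0 < b i.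
Proof.
move=> si an0; rewrite lt0r b0 andbT; apply/negP => /eqP bi0.
have agt0 : 0 < a i by rewrite lt0r an0 a0.
pose B := \sum_(j <- s) `|a j * ln (a j / (b j + 1))|.
(* [M] exceeds the right side of [H] for e <= 1 plus the possible negative contribution [B] of all
   terms; [e] is then chosen so that term i is at least [M]. *)
pose M := `|kap| + `|K| + B + 1.
have M0 : 0 <= M by rewrite !addr_ge0// sumr_ge0.
pose e := Num.min 1 (a i * expR (- (M / a i))).
have e0 : 0 < e by rewrite lt_min ltr01 mulr_gt0// expR_gt0.
have e1 : e <= 1 by rewrite ge_min lexx.
have := H e0; apply/negP; rewrite -ltNge.
have lni : M <= a i * ln (a i / (b i + e)).
  rewrite bi0 add0r -ler_pdivrMl// mulrC -ler_expR lnK ?posrE ?divr_gt0//.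
  rewrite ler_pdivlMr// -ler_pdivlMl ?expR_gt0// -expRN.
  by rewrite /e ge_min [X in expR (- X)]mulrC [X in _ || (X <= _)]mulrC lexx orbT.
apply: (@lt_le_trans _ _ (M - B)).
  have : kap <= `|kap| := ler_norm _.
  have : K * e <= `|K| by rewrite (le_trans (ler_norm _))// normrM ler_piMr// ger0_norm// ltW.
  rewrite /M => ? ?; lra.
have [s1 [s2 sE]] : exists s1 s2, s = s1 ++ i :: s2.
  by case/splitPr: si => s1 s2; exists s1, s2.
have part t : - (\sum_(j <- t) `|a j * ln (a j / (b j + 1))|) <=
    \sum_(j <- t) a j * ln (a j / (b j + e)).
  by rewrite -sumrN; apply: ler_sum => j _; exact: term_ge.
rewrite /B sE !big_cat !big_cons/=.
have := part s1; have := part s2; have := normr_ge0 (a i * ln (a i / (b i + 1))).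
by move: lni => ? ? ? ?; lra.
Qed.

(** Let e tend to 0 in [H]: all logarithms that matter are finite by [b_gt0], and removing the shift
    costs at most e a i / b i per term since ln(1 + x) <= x. *)
Lemma entropy_sum_ge : ((- kap)%:E <=
  \sum_(i <- s) (if a i == 0%R then 0 else (a i)%:E * lne (b i / a i)%:E))%E.
Proof.
have -> : (\sum_(i <- s) (if a i == 0%R then 0 else (a i)%:E * lne (b i / a i)%:E) =
    (\sum_(i <- s) a i * ln (b i / a i))%:E)%E.
  rewrite -sumEFin !big_seq; apply: eq_bigr => i si.
  have [->|an0] := eqVneq (a i) 0; first by rewrite mul0r.
  have agt0 : 0 < a i by rewrite lt0r an0 a0.
  by rewrite lne_EFin ?divr_gt0// b_gt0.
rewrite lee_fin lerNl; apply/ler_addgt0Pl => e e0.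
pose Q := `|K| + \sum_(i <- s) a i / b i + 1.
have Q0 : 0 < Q.
  by rewrite ltr_wpDl// addr_ge0// sumr_ge0// => i _; rewrite divr_ge0.
have eQ0 : 0 < e / Q by rewrite divr_gt0.
have := H eQ0.
have : - \sum_(i <- s) a i * ln (b i / a i) - (\sum_(i <- s) a i / b i) * (e / Q) <=
    \sum_(i <- s) a i * ln (a i / (b i + e / Q)).
  rewrite mulr_suml -sumrN -sumrB !big_seq; apply: ler_sum => i si.
  have [->|an0] := eqVneq (a i) 0; first by rewrite !mul0r oppr0 addr0.
  have agt0 : 0 < a i by rewrite lt0r an0 a0.
  have bgt0 := b_gt0 si an0.
  have beQ : 0 < b i + e / Q by rewrite addr_gt0.
  have : a i * ln (1 + (e / Q) / b i) <= a i * ((e / Q) / b i).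
    by rewrite ler_pM2l// le_ln1Dx// (lt_trans (ltrN10 _))// divr_gt0.
  have -> : 1 + (e / Q) / b i = (b i + e / Q) / b i by rewrite mulrDl divff// gt_eqF.
  rewrite !ln_div ?posrE//.
  have -> : a i * ((e / Q) / b i) = a i / b i * (e / Q) by ring.
  by rewrite !mulrBr => ?; lra.
have : K * (e / Q) + (\sum_(i <- s) a i / b i) * (e / Q) <= e.
  rewrite -mulrDl mulrCA; apply: ler_piMr; first exact: ltW.
  rewrite ler_pdivrMr// mul1r /Q.
  by rewrite (le_trans (lerD (ler_norm K) (lexx _)))// lerDl.
by move=> ? ? ?; lra.
Qed.

End EntropySums.

Section LowerEntropy.
Context d (Y : measurableType d) (R : realType) (m : {measure set Y -> \bar R}).
Hypothesis m_sfinite : sigma_finite setT m.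
Variables (beta : Y -> Y) (C : R).
Hypothesis mbeta : measurable_fun setT beta.
Hypothesis beta_bound : forall G : set Y, measurable G ->
  (m (beta @^-1` G) <= C%:E * m G)%E.
Variable A : Linf m -> Linf m.
Hypothesis AE : forall (f : Linf m) (g : LspaceType1 m),
  (\int[m]_y ((f y : R) * g (beta y))%:E = \int[m]_y ((A f y : R) * g y)%:E)%E.

(** For essentially bounded chi this says, by duality, that A^n e^chi <= 1 a.e.; tested against
    integrable functions it can be iterated directly. *)
Definition subinvariant n (chi : Y -> R) : Prop :=
  forall g, L1fun m g -> (\forall y \ae m, 0 <= g y) ->
    integ m (fun y => expR (chi y) * g (iter n beta y)) <= integ m g.

(** [A] is an arbitrary function on [Linf], so replacing g by [cls m g] under [A] needs true
    equality of classes. *)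
Lemma Linf_ae_eq (f g : Linf m) : (\forall y \ae m, (f y : R) = g y) -> f = g.
Proof.
case: f => f [[ff]]; case: g => g [[gf]] /= fg.
have E : f = g.
  apply/eqP; rewrite -[f]reprK -[g]reprK eqmodE; apply/asboolP.
  by apply: filterS fg.
by subst g; congr LebesgueSpace.Pack; congr LebesgueSpace.Class;
  congr isFinLebesgue.Axioms_; exact: Prop_irrelevance.
Qed.

Lemma cls_Linf (f : Linf m) : cls m f = f.
Proof. by apply: Linf_ae_eq; exact: clsE (essbounded_Linf f). Qed.

Variable mu : {content set Y -> \bar R}.
Hypothesis mu1 : mu setT = 1%E.
Hypothesis mu0 : forall G, measurable G -> m G = 0%E -> mu G = 0%E.
Hypothesis mu_inv : forall f, essbounded m f ->
  content_mean mu (fun y => f (beta y)) = content_mean mu f.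

Let mM := is_mean_content_mean mu1 mu0.

Lemma content_mean_iter n f : essbounded m f ->
  content_mean mu (fun y => f (iter n beta y)) = content_mean mu f.
Proof.
elim: n f => // n ih f bf.
by rewrite (ih (fun y => f (beta y))) ?mu_inv//; exact: (essbounded_beta mbeta beta_bound).
Qed.

(* the supremum over states in [tau_nD] is bounded below by its value at [mu] itself *)
Lemma tau_nD_ge n (D : {fset Linf m}) (kap : R) : partition_of_unity D ->
  (forall chi, essbounded m chi ->
     subinvariant n chi ->
     content_mean mu chi <= kap) ->
  ((- kap)%:E <= tau_nD A mu n D)%E.
Proof.
move=> [D0 D1] Hchi.
pose a (g : Linf m) := content_mean mu g.
pose b (g : Linf m) := content_mean mu (iter n A g).
have a0 g : g \in D -> 0 <= a g.
  by move=> gD; apply: (mean_ge0 mM); [exact: essbounded_Linf|exact: D0].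
have b0 g : g \in D -> 0 <= b g.
  move=> gD; have -> : b g = content_mean mu (transfer A n g).
    by rewrite /b /transfer cls_Linf.
  apply: (mean_ge0 mM); first exact: essbounded_transfer.
  apply: (transfer_ge0 m_sfinite mbeta beta_bound AE); first exact: essbounded_Linf.
  exact: D0.
pose N := (size (enum_fset D))%:R + 1 : R.
have N0 : 0 <= N by rewrite addr_ge0.
have main e : 0 < e ->
    \sum_(g <- D) `|a g| * ln (`|a g| / (`|b g| + e)) <= kap + N * e.
  move=> e0.
  (* The optimal weight ln(a/b), regularized by [e] against vanishing a or b; the absolute values
     change nothing on [D] and give nonnegativity for all g. *)
  pose sg (g : Linf m) := ln ((`|a g| + e) / (`|b g| + e)).
  have sgE g : expR (sg g) = (`|a g| + e) / (`|b g| + e).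
    by rewrite lnK// posrE divr_gt0// ltr_wpDl.
  pose lam y := \sum_(g <- D) sg g * (g y : R).
  pose h y := \sum_(g <- D) expR (sg g) * (g y : R).
  pose Th y := \sum_(g <- D) expR (sg g) * transfer A n g y.
  have bl : essbounded m lam.
    by apply: essbounded_sum => g _; apply: essboundedZ; exact: essbounded_Linf.
  have bh : essbounded m h.
    by apply: essbounded_sum => g _; apply: essboundedZ; exact: essbounded_Linf.
  have bTh : essbounded m Th.
    by apply: essbounded_sum => g _; apply: essboundedZ; exact: essbounded_transfer.
  have ThE : \forall y \ae m, transfer A n h y = Th y.
    apply: (transfer_sum m_sfinite mbeta beta_bound AE) => g; exact: essbounded_Linf.
  (* A version of A^n h that is bounded away from 0 at every point, so that [ln (q y)] is
     essentially bounded. *)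
  pose q y := `|Th y| + e.
  have bq : essbounded m q.
    by apply: essboundedD; [exact: essbounded_norm|exact: essbounded_cst].
  have qe y : e <= q y by rewrite lerDr.
  have q0 y : 0 < q y by exact: lt_le_trans (qe y).
  have blq : essbounded m (fun y => ln (q y)) by exact: (essbounded_ln e0).
  pose chi y := lam y - ln (q (iter n beta y)).
  have blqn : essbounded m (fun y => ln (q (iter n beta y))).
    exact: (essbounded_iter_beta mbeta beta_bound n blq).
  have bchi : essbounded m chi by exact: essboundedB.
  have D0' : \forall y \ae m, forall g, g \in D -> 0 <= (g y : R).
    have : \forall y \ae m, forall g : D, 0 <= ((val g : Linf m) y : R).
      by apply: filter_forall => g; apply: D0; exact: valP.
    by apply: filterS => y H g gD; exact: H [` gD]%fset.
  (* Convexity of the exponential with weights g(y), which sum to 1, from 1 + x <= e^x about the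
     barycentre [lam y]. *)
  have explam : \forall y \ae m, expR (lam y) <= h y.
    apply: filterS2 D0' D1 => y g0 g1.
    have -> : h y = expR (lam y) * \sum_(g <- D) expR (sg g - lam y) * (g y : R).
      rewrite mulr_sumr; apply: eq_bigr => g _.
      by rewrite mulrA -expRD addrC subrK.
    rewrite -[leLHS]mulr1 ler_pM2l ?expR_gt0//.
    apply: (@le_trans _ _ (\sum_(g <- D) (1 + (sg g - lam y)) * (g y : R))).
      rewrite (eq_bigr (fun g : Linf m => (g y : R) * (1 - lam y) + sg g * (g y : R))); last first.
        by move=> g _; ring.
      rewrite big_split/= -mulr_suml g1 -/(lam y).
      by rewrite mul1r subrK.
    rewrite !big_seq; apply: ler_sum => g gD; rewrite ler_wpM2r ?g0//.
    exact: expR_ge1Dx.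
  (* [chi] is subinvariant since [expR lam <= h] and [A^n h <= q] *)
  have chile : content_mean mu chi <= kap.
    apply: Hchi => // g lg g0.
    pose G y := (q y)^-1 * g y.
    have bqi : essbounded m (fun y => (q y)^-1).
      rewrite (_ : (fun y => _) = (fun y => expR (- ln (q y)))).
        by apply: essbounded_expR; exact: essboundedN.
      by apply/funext => y; rewrite expRN lnK// posrE.
    have lG : L1fun m G by exact: L1fun_essM.
    have lGn := L1fun_iter_beta mbeta beta_bound AE n lG.
    have lgn := L1fun_iter_beta mbeta beta_bound AE n lg.
    have G0 : \forall y \ae m, 0 <= G y.
      by apply: filterS g0 => y g0; rewrite mulr_ge0// invr_ge0 ltW.
    have G0n := ae_iter_beta mbeta beta_bound n G0.
    apply: (@le_trans _ _ (integ m (fun y => h y * G (iter n beta y)))).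
      apply: le_integ.
      - by apply: L1fun_essM => //; exact: essbounded_expR.
      - exact: L1fun_essM.
      - apply: filterS2 explam G0n => y h1 h2.
        rewrite /chi expRD expRN lnK ?posrE// -mulrA.
        by rewrite ler_wpM2r.
    rewrite (transfer_duality mbeta beta_bound AE)//; apply: le_integ => //.
      by apply: L1fun_essM => //; exact: essbounded_transfer.
    apply: filterS2 ThE g0 => y -> g0; rewrite /G mulrA.
    apply: ler_piMl => //; rewrite ler_pdivrMr// mul1r /q.
    by rewrite (le_trans (ler_norm _))// lerDl ltW.
  have : content_mean mu chi = content_mean mu lam - content_mean mu (fun y => ln (q y)).
    rewrite (meanB mM)// (content_mean_iter n blq)//.
  have -> : content_mean mu lam = \sum_(g <- D) sg g * a g.
    rewrite (mean_sum mM); last by move=> g _; apply: essboundedZ; exact: essbounded_Linf.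
    by apply: eq_bigr => g _; rewrite (meanZ mM)//; exact: essbounded_Linf.
  have asum : \sum_(g <- D) a g = 1.
    rewrite -[RHS](mean_cst mM 1) -(mean_sum mM); last by move=> g _; exact: essbounded_Linf.
    apply: (ae_eq_mean mM) => //; last exact: essbounded_cst.
    by apply: essbounded_sum => g _; exact: essbounded_Linf.
  (* By concavity of ln it suffices to bound the mean of [q]. With the chosen weights, e^(s_g) b_g
     <= a_g + e, so that mean is at most 1 + N e: one [e] for each g in [D] and one from [q]. *)
  have lnq : content_mean mu (fun y => ln (q y)) <= N * e.
    apply: (le_trans (mean_ln_le mM bq e0 qe)).
    have -> : content_mean mu q = \sum_(g <- D) expR (sg g) * b g + e.
      have Th0 : \forall y \ae m, 0 <= Th y.
        have : \forall y \ae m, forall g : D, 0 <= transfer A n (val g : Linf m) y.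
          apply: filter_forall => g.
          apply: (transfer_ge0 m_sfinite mbeta beta_bound AE); first exact: essbounded_Linf.
          by apply: D0; exact: valP.
        apply: filterS => y H; rewrite /Th big_seq; apply: sumr_ge0 => g gD.
        by rewrite mulr_ge0 ?expR_ge0//; exact: H [` gD]%fset.
      rewrite /q (meanD mM) ?(mean_cst mM)//; [|exact: essbounded_norm|exact: essbounded_cst].
      rewrite (@ae_eq_mean _ _ _ _ _ mM _ Th)//; last 2 first.
      - exact: essbounded_norm.
      - by apply: filterS Th0 => y /ger0_norm.
      rewrite (mean_sum mM); last first.
        by move=> g _; apply: essboundedZ; exact: essbounded_transfer.
      congr (_ + _); apply: eq_bigr => g _; rewrite (meanZ mM)//; last exact: essbounded_transfer.
      by rewrite /b /transfer cls_Linf.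
    have le1 : \sum_(g <- D) expR (sg g) * b g <= 1 + (size (enum_fset D))%:R * e.
      have <- : \sum_(g <- D) (a g + e) = 1 + (size (enum_fset D))%:R * e.
        by rewrite big_split/= asum big_const_seq count_predT iter_addr addr0 mulr_natl.
      rewrite !big_seq.
      apply: ler_sum => g gD; rewrite sgE (ger0_norm (a0 g gD)) (ger0_norm (b0 g gD)).
      have bge : 0 < b g + e by rewrite ltr_wpDl// b0.
      rewrite mulrAC ler_pdivrMr// ler_wpM2l// ?lerDl ?ltW//.
      by rewrite ltr_wpDl// a0.
    apply: (@le_trans _ _ (ln (1 + N * e))).
      rewrite ler_ln ?posrE.
      - by rewrite /N mulrDl mul1r addrA lerD2r.
      - rewrite ltr_wpDl// big_seq; apply: sumr_ge0 => g gD.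
        by rewrite mulr_ge0 ?expR_ge0// b0.
      - by rewrite ltr_wpDr// mulr_ge0// ltW.
    apply: le_ln1Dx; apply: (@lt_le_trans _ _ 0) => //.
    by rewrite mulr_ge0// ltW.
  have : \sum_(g <- D) `|a g| * ln (`|a g| / (`|b g| + e)) <= \sum_(g <- D) sg g * a g.
    rewrite !big_seq; apply: ler_sum => g gD; rewrite (ger0_norm (a0 g gD)) mulrC.
    have [->|an0] := eqVneq (a g) 0; first by rewrite !mulr0.
    have agt0 : 0 < a g by rewrite lt0r an0 a0.
    have bge : 0 < `|b g| + e by rewrite ltr_wpDl.
    rewrite ler_wpM2r ?a0// /sg ler_ln ?posrE ?divr_gt0 ?ltr_wpDl//.
    by rewrite ler_pM2r ?invr_gt0// (ger0_norm (a0 g gD)) lerDl ltW.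
  by move: chile lnq => ? ? ? ?; lra.
have := @entropy_sum_ge _ _ (enum_fset D) (fun g => `|a g|) (fun g => `|b g|) N kap
  (fun g => normr_ge0 _) (fun g => normr_ge0 _) main.
move=> /le_trans; apply; apply: ereal_sup_ubound.
exists (fun f : Linf m => content_mean mu f); first exact: mean_state.
rewrite !big_seq; apply: eq_bigr => g gD.
by rewrite (ger0_norm (a0 g gD)) (ger0_norm (b0 g gD)).
Qed.

Lemma t_entropy_ge (kap : R) :
  (forall n chi, (0 < n)%N -> essbounded m chi ->
     subinvariant n chi ->
     content_mean mu chi <= n%:R * kap) ->
  ((- kap)%:E <= t_entropy A mu)%E.
Proof.
move=> H; apply/le_ereal_inf_tmp => _ [n /= n0 <-].
have n0' : 0 < n%:R :> R by rewrite ltr0n.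
rewrite inver gt_eqF// lee_pdivlMr//.
apply/le_ereal_inf_tmp => _ [D PD <-].
rewrite -EFinM mulNr mulrC; apply: tau_nD_ge => // chi; exact: H.
Qed.

End LowerEntropy.

(** * Invariant means carried by densities of large norm *)

Section AveragedLimit.
Context d (Y : measurableType d) (R : realType) (m : {measure set Y -> \bar R}).
Variables (beta : Y -> Y).
Hypothesis bbeta : forall n f, essbounded m f -> essbounded m (fun y => f (iter n beta y)).
Hypothesis ae_beta_iter : forall n (P : Y -> Prop),
  (\forall y \ae m, P y) -> \forall y \ae m, P (iter n beta y).

(* Krylov-Bogolyubov averages, with an ultrafilter in place of compactness. *)
Lemma averaged_limit (S : set nat) (rho : nat -> (Y -> R) -> R) :
  (forall K, exists2 N, (K <= N)%N & S N) -> (forall N, is_mean m (rho N)) ->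
  exists Phi, [/\ is_mean m Phi,
    forall f, essbounded m f -> Phi (fun y => f (beta y)) = Phi f &
    forall f c K N0, essbounded m f ->
      (forall N, S N -> (N0 <= N)%N ->
        \sum_(0 <= i < N) rho N (fun y => f (iter i beta y)) <= N%:R * c + K) ->
      Phi f <= c].
Proof.
move=> Sinf mrho.
(* The trace on [S] of the filter of cofinite sets: the limit sees only the large indices lying in
   [S]. *)
pose F : set_system nat := [set V | exists K, forall N, (K <= N)%N -> S N -> V N].
have FF : ProperFilter F.
  split.
    by move=> [K H]; have [N KN SN] := Sinf K; exact: H SN.
  split; first by exists 0%N.
  - move=> P Q [K1 H1] [K2 H2]; exists (maxn K1 K2) => N; rewrite geq_max => /andP[h1 h2] SN.
    by split; [exact: H1|exact: H2].
  - by move=> P Q PQ [K H]; exists K => N h SN; apply: PQ; exact: H.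
have [G [UG FG]] := ultraFilterLemma FF.
have PG : ProperFilter G by case: UG.
have imU (u : nat -> R) : UltraFilter (u @ G).
  split; first exact: fmap_proper_filter.
  move=> H PH sH; rewrite predeqE => B; split; last exact: sH.
  move=> HB; have [//|GB] := in_ultra_setVsetC (u @^-1` B) UG.
  have HnB : H (~` B) by exact: sH.
  have : H (B `&` ~` B) by exact: filterI.
  by rewrite setICr => /filter_not_empty.
have near_N (P : nat -> Prop) : (forall N, S N -> (0 < N)%N -> P N) -> \forall N \near G, P N.
  by move=> H; apply: FG; exists 1%N => N N0 SN; exact: H.
pose av N f := N%:R^-1 * \sum_(0 <= i < N) rho N (fun y => f (iter i beta y)).
have av_bound f M N : essbounded m f -> (\forall y \ae m, `|f y| <= M) -> (0 < N)%N ->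
    `|av N f| <= M.
  move=> bf fM N0; rewrite /av normrM ger0_norm ?invr_ge0//.
  rewrite mulrC ler_pdivrMr ?ltr0n// (le_trans (ler_norm_sum _ _ _))//.
  apply: (@le_trans _ _ (\sum_(0 <= i < N) M)).
    apply: ler_sum => i _; apply: (mean_norm_le (mrho N)); first exact: bbeta.
    exact: (ae_beta_iter i fM).
  by rewrite sumr_const_nat subn0 mulr_natr.
have cvgav f : essbounded m f -> cvg (av ^~ f @ G).
  move=> bf; have [mf [M fM]] := bf.
  have := @segment_compact R (- M) M.
  rewrite compact_ultra => /(_ _ (imU (av ^~ f))) []; last first.
    by move=> l [_ fl]; apply/cvg_ex; exists l.
  apply: near_N => N SN N0; rewrite /= in_itv/= -ler_norml.
  exact: av_bound.
have limE (u : nat -> R) l : u @ G --> l -> lim (u @ G) = l by move=> /cvg_lim; exact.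
exists (fun f => lim (av ^~ f @ G)); split.
- split.
  + move=> a f g bf bg; apply: limE.
    have -> : av ^~ (fun y => a * f y + g y) = (fun N => a * av N f + av N g).
      apply/funext => N; rewrite /av mulrCA -mulrDr; congr (_ * _).
      rewrite mulr_sumr -big_split/=; apply: eq_bigr => i _.
      by case: (mrho N) => lin _ _; rewrite lin//; exact: bbeta.
    by apply: cvgD; [apply: cvgMl_tmp; exact: cvgav|exact: cvgav].
  + move=> f bf f0; apply: limr_ge; first exact: cvgav.
    apply: near_N => N _ N0; rewrite mulr_ge0 ?invr_ge0//; apply: sumr_ge0 => i _.
    by apply: (mean_ge0 (mrho N)); [exact: bbeta|exact: (ae_beta_iter i f0)].
  + apply: limE; apply: (@cvg_trans _ ((fun=> 1 : R) @ G)); last exact: cvg_cst.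
    apply: near_eq_cvg; apply: near_N => N _ N0; rewrite /av.
    under eq_bigr do rewrite (mean_cst (mrho N)).
    by rewrite sumr_const_nat subn0 mulVf// pnatr_eq0 -lt0n.
- move=> f bf; have bfb := bbeta 1 bf; have [mf [M fM]] := bf.
  suff H0 : (fun N => av N (fun y => f (beta y)) - av N f) @ G --> (0 : R).
    apply: limE; rewrite -[lim _]addr0.
    rewrite [X in X @ G](_ : _ = (fun N => av N f +
      (av N (fun y => f (beta y)) - av N f))); first exact: cvgD (cvgav f bf) H0.
    by apply/funext => N; rewrite addrC subrK.
  apply/cvgr0Pnorm_le => e e0.
  have M0 : 0 <= `|M| + 1 by rewrite addr_ge0.
  have [K KM] : exists K : nat, 2 * (`|M| + 1) / e <= K%:R.
    exists (Num.truncn (2 * (`|M| + 1) / e)).+1.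
    by apply: ltW; exact: truncnS_gt.
  apply: FG; exists K.+1 => N KN SN.
  have N0 : (0 < N)%N by exact: leq_ltn_trans KN.
  rewrite /av -mulrBr.
  (* Invariance of the limit: the shifted and unshifted sums telescope to two bounded boundary
     terms, which disappear after division by N. *)
  have -> : \sum_(0 <= i < N) rho N (fun y => f (beta (iter i beta y))) -
      \sum_(0 <= i < N) rho N (fun y => f (iter i beta y)) =
      rho N (fun y => f (iter N beta y)) - rho N f.
    by rewrite -sumrB (telescope_sumr_eq (fun i => rho N (fun y => f (iter i beta y)))).
  rewrite normrM ger0_norm ?invr_ge0// mulrC ler_pdivrMr ?ltr0n//.
  have h i : `|rho N (fun y => f (iter i beta y))| <= `|M| + 1.
    apply: (mean_norm_le (mrho N)); first exact: bbeta.
    apply: (@ae_beta_iter i (fun y => `|f y| <= `|M| + 1)).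
    by apply: filterS fM => y /le_trans; apply; rewrite (le_trans (ler_norm _))// lerDl.
  have := ler_normB (rho N (fun y => f (iter N beta y))) (rho N f).
  have := h N; have := h 0%N; rewrite /=.
  have : 2 * (`|M| + 1) <= e * N%:R.
    rewrite mulrC [leRHS]mulrC -ler_pdivrMr// mulrC (le_trans KM)// ler_nat; exact: ltnW.
  by move=> ? ? ? ?; lra.
- move=> f c K N0 bf H; apply/ler_addgt0Pr => e e0.
  apply: limr_le; first exact: cvgav.
  apply: FG.
  have [L KL] : exists L : nat, `|K| / e <= L%:R.
    exists (Num.truncn (`|K| / e)).+1.
    by apply: ltW; exact: truncnS_gt.
  exists (L.+1 + N0)%N => N LN SN.
  have [N0N LN' Npos] : [/\ (N0 <= N)%N, (L <= N)%N & (0 < N)%N] by split; lia.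
  rewrite /av mulrC ler_pdivrMr ?ltr0n// (le_trans (H N SN N0N))//.
  have : `|K| <= e * N%:R.
    by rewrite [leRHS]mulrC -ler_pdivrMr// (le_trans KL)// ler_nat.
  have := ler_norm K; rewrite mulrDl [N%:R * c]mulrC => ? ?; lra.
Qed.

End AveragedLimit.

(** * Orbit sums regrouped by residue classes, blocks and windows *)

Section Sequences.
Variable R : realType.

Lemma sum_residues (a : nat -> R) n M :
  \sum_(0 <= j < n) \sum_(0 <= k < M) a (n * k + j)%N = \sum_(0 <= i < n * M) a i.
Proof.
elim: M => [|M ih].
  by rewrite muln0 big_nil big1// => j _; rewrite big_nil.
under eq_bigr do rewrite big_nat_recr//=.
rewrite big_split/= ih mulnSr (@big_cat_nat _ _ _ (n * M)%N 0 (n * M + n)%N) ?leq_addr//=.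
congr +%R; have := big_addn 0 (n * M + n) (n * M) predT a.
rewrite add0n addKn => ->.
by apply: eq_bigr => j _; rewrite addnC.
Qed.

Lemma sum_blocks (a : nat -> R) n j M :
  \sum_(0 <= k < M) \sum_(0 <= i < n) a (i + (n * k + j))%N =
  \sum_(j <= i < j + n * M) a i.
Proof.
elim: M => [|M ih]; first by rewrite muln0 addn0 !big_geq.
rewrite big_nat_recr//= ih mulnSr addnA
  (@big_cat_nat _ _ _ (j + n * M)%N j (j + n * M + n)%N) ?leq_addr//=.
congr +%R; have := big_addn 0 (j + n * M + n) (j + n * M) predT a.
rewrite add0n addKn => ->.
by apply: eq_bigr => i _; rewrite [(j + _)%N]addnC.
Qed.

Lemma norm_sum_le (a : nat -> R) L i j : (forall k, `|a k| <= L) ->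
  `|\sum_(i <= k < j) a k| <= (j - i)%:R * L.
Proof.
move=> aL; rewrite (le_trans (ler_norm_sum _ _ _))//.
rewrite (le_trans (ler_sum _ (fun k _ => aL k)))//.
by rewrite sumr_const_nat mulr_natl.
Qed.

Lemma sum_window_le (a : nat -> R) L i j N : (i <= j)%N -> (j <= N)%N ->
  (forall k, `|a k| <= L) ->
  \sum_(0 <= k < N) a k - \sum_(i <= k < j) a k <= (N - (j - i))%:R * L.
Proof.
move=> ij jN aL.
rewrite (@big_cat_nat _ _ _ j 0 N)//= (@big_cat_nat _ _ _ i 0 j)//=.
have h1 := le_trans (ler_norm _) (norm_sum_le 0 i aL).
have h2 := le_trans (ler_norm _) (norm_sum_le j N aL).
have -> : (N - (j - i) = (i - 0) + (N - j))%N by lia.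
rewrite natrD mulrDl; lra.
Qed.

End Sequences.

Section LowerBound.
Context d (Y : measurableType d) (R : realType) (m : {measure set Y -> \bar R}).
Hypothesis m0 : m [set: Y] != 0%E.
Hypothesis m_sfinite : sigma_finite setT m.
Variables (beta : Y -> Y) (C : R).
Hypothesis C1 : 1 <= C.
Hypothesis mbeta : measurable_fun setT beta.
Hypothesis beta_bound : forall G : set Y, measurable G ->
  (m (beta @^-1` G) <= C%:E * m G)%E.
Variable A : Linf m -> Linf m.
Hypothesis AE : forall (f : Linf m) (g : LspaceType1 m),
  (\int[m]_y ((f y : R) * g (beta y))%:E = \int[m]_y ((A f y : R) * g y)%:E)%E.

Let C0 : 0 <= C. Proof. exact: le_trans C1. Qed.

Let biter n f : essbounded m f -> essbounded m (fun y => f (iter n beta y)).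
Proof. exact: (essbounded_iter_beta mbeta beta_bound). Qed.

Let aeiter n (P : Y -> Prop) : (\forall y \ae m, P y) -> \forall y \ae m, P (iter n beta y).
Proof. exact: (ae_iter_beta mbeta beta_bound). Qed.

Let liter n g : L1fun m g -> L1fun m (fun y => g (iter n beta y)).
Proof. exact: (L1fun_iter_beta mbeta beta_bound AE). Qed.

Local Notation subinvariant := (subinvariant m beta).

(** The product for M + 1 is e^chi times the product for M composed with beta^n, so subinvariance
    removes one factor at a time without any constant. *)
Lemma subinvariant_chain n chi M g : essbounded m chi -> subinvariant n chi ->
  L1fun m g -> (\forall y \ae m, 0 <= g y) ->
  integ m (fun y => expR (\sum_(0 <= k < M) chi (iter (n * k) beta y)) *
                    g (iter (n * M) beta y)) <= integ m g.
Proof.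
move=> bchi Hchi lg g0; elim: M => [|M ih].
  rewrite le_eqVlt; apply/orP; left; apply/eqP; congr integ; apply/funext => y.
  by rewrite big_geq// expR0 mul1r muln0.
apply: le_trans ih; set G := (X in _ <= integ m X).
have lG : L1fun m G.
  apply: L1fun_essM; last exact: liter.
  by apply: essbounded_expR; apply: essbounded_sum => k _; exact: biter.
have G0 : \forall y \ae m, 0 <= G y.
  by apply: filterS (aeiter (n * M) g0) => y g0'; rewrite mulr_ge0// expR_ge0.
apply: le_trans (Hchi G lG G0); rewrite le_eqVlt; apply/orP; left; apply/eqP.
congr integ; apply/funext => y; rewrite /G mulrA -expRD big_nat_recl//= muln0/=.
congr (expR (_ + _) * g _); last by rewrite -iterD mulnSr.
by apply: eq_bigr => k _; rewrite -iterD mulnSr.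
Qed.

Lemma subinvariant_chain_shift n chi j M g : essbounded m chi -> subinvariant n chi ->
  L1fun m g -> (\forall y \ae m, 0 <= g y) ->
  integ m (fun y => expR (\sum_(0 <= k < M) chi (iter (n * k + j) beta y)) *
                    g (iter (n * M + j) beta y)) <= C ^+ j * integ m g.
Proof.
move=> bchi Hchi lg g0.
pose G y := expR (\sum_(0 <= k < M) chi (iter (n * k) beta y)) * g (iter (n * M) beta y).
have lG : L1fun m G.
  apply: L1fun_essM; last exact: liter.
  by apply: essbounded_expR; apply: essbounded_sum => k _; exact: biter.
have G0 : \forall y \ae m, 0 <= G y.
  by apply: filterS (aeiter (n * M) g0) => y g0'; rewrite mulr_ge0// expR_ge0.
apply: (@le_trans _ _ (integ m (fun y => G (iter j beta y)))).
  rewrite le_eqVlt; apply/orP; left; apply/eqP; congr integ; apply/funext => y.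
  rewrite /G -iterD; congr (expR _ * _).
  by apply: eq_bigr => k _; rewrite iterD.
apply: (le_trans (integ_beta_le m_sfinite mbeta beta_bound AE j C0 lG G0)).
by rewrite ler_wpM2l ?exprn_ge0//; exact: subinvariant_chain.
Qed.

Variable w : Y -> R.
Hypothesis bw : essbounded m w.
Hypothesis w0 : forall y, 0 <= w y.

Definition cocycle N y := \prod_(0 <= i < N) w (iter i beta y).

Lemma essbounded_cocycle N : essbounded m (cocycle N).
Proof. by apply: essbounded_prod => i _; exact: biter. Qed.

Lemma cocycle_ge0 N y : 0 <= cocycle N y.
Proof. by apply: prodr_ge0 => i _. Qed.

Lemma cocycle_window (phi : Y -> R) (L : R) i j N y : (i <= j)%N -> (j <= N)%N ->
  (forall k, w (iter k beta y) <= expR (phi (iter k beta y))) ->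
  (forall k, `|phi (iter k beta y)| <= L) ->
  cocycle N y <= expR (\sum_(i <= k < j) phi (iter k beta y) + (N - (j - i))%:R * L).
Proof.
move=> ij jN wphi phiL; apply: (@le_trans _ _ (expR (\sum_(0 <= k < N) phi (iter k beta y)))).
  by rewrite expR_sum; apply: ler_prod => k _; rewrite w0 wphi.
rewrite ler_expR addrC -lerBlDr.
exact: (@sum_window_le R (fun k => phi (iter k beta y))).
Qed.

Variables (S : set nat) (lam : R).
Hypothesis Sinf : forall K, exists2 N, (K <= N)%N & S N.
Hypothesis growth : forall N, S N -> exists B, [/\ measurable B, (0 < m B)%E,
  (m B < +oo)%E &
  expR (N%:R * lam) / 2 * fine (m B) <=
  integ m (fun y => cocycle N y * \1_B (iter N beta y))].

(** The constant does not depend on N: 2 comes from the halved growth, e^(2nL) from the factors of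
    the cocycle outside the window, and C^(2n) from the j initial and q final iterates of beta, as j
    + q = N - n M <= 2 n. *)
Lemma block_mean_le N B n j M phi L chi :
  measurable B -> (0 < m B)%E -> (m B < +oo)%E ->
  expR (N%:R * lam) / 2 * fine (m B) <=
    integ m (fun y => cocycle N y * \1_B (iter N beta y)) ->
  (n * M + j <= N)%N -> (N <= n * M + 2 * n)%N -> 0 <= L ->
  essbounded m phi -> (\forall y \ae m, w y <= expR (phi y)) ->
  (\forall y \ae m, `|phi y| <= L) ->
  essbounded m chi -> subinvariant n chi ->
  integ m (fun y => (\sum_(0 <= k < M) (chi (iter (n * k + j) beta y) -
      \sum_(0 <= i < n) phi (iter i beta (iter (n * k + j) beta y)))) *
      (cocycle N y * \1_B (iter N beta y))) /
    integ m (fun y => cocycle N y * \1_B (iter N beta y))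
  <= ln (2 * expR ((2 * n)%:R * L) * C ^+ (2 * n)) - N%:R * lam.
Proof.
move=> mB B0 Bfin gr jN Nn L0 bphi wphi phiL bchi Hchi.
pose v y := cocycle N y * \1_B (iter N beta y); rewrite -/v.
pose theta y := chi y - \sum_(0 <= i < n) phi (iter i beta y).
have lB := L1fun_indic mB Bfin.
have lv : L1fun m v by apply: L1fun_essM; [exact: essbounded_cocycle|exact: liter].
have v0 : \forall y \ae m, 0 <= v y.
  by apply/nearW => y; rewrite mulr_ge0 ?cocycle_ge0// indicE.
have mB0 : 0 < fine (m B) by rewrite fine_gt0// B0 Bfin.
have Z0 : 0 < integ m v.
  by apply: lt_le_trans gr; rewrite mulr_gt0// divr_gt0// expR_gt0.
have mr := is_mean_density lv v0 Z0.
have bS : essbounded m (fun y => \sum_(0 <= i < n) phi (iter i beta y)).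
  by apply: essbounded_sum => i _; exact: biter.
have bth : essbounded m theta by exact: essboundedB.
pose f y := \sum_(0 <= k < M) theta (iter (n * k + j) beta y).
have bf : essbounded m f by apply: essbounded_sum => k _; exact: biter.
pose D := 2 * expR ((2 * n)%:R * L) * C ^+ (2 * n).
have D0 : 0 < D.
  by rewrite !mulr_gt0// ?expR_gt0// exprn_gt0// (lt_le_trans ltr01).
rewrite -ler_expR expRD expRN lnK ?posrE//.
(* Jensen; the terms of [cocycle N] outside the window j <= i < j + n M, at most
   2 n of them, are bounded by [expR L] *)
apply: (le_trans (expR_mean_le mr bf)).
rewrite ler_pdivrMr//.
(* The number of iterates between the end of the chain for residue j and time N, where the indicator
   of [B] is evaluated. *)
pose q := (N - (n * M + j))%N.
pose F y := expR (\sum_(0 <= k < M) chi (iter (n * k + j) beta y)) *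
  \1_B (iter q beta (iter (n * M + j) beta y)).
have lBq : L1fun m (fun y => \1_B (iter q beta y)) by exact: liter.
have lF : L1fun m F.
  apply: L1fun_essM; last exact: (@liter (n * M + j) (fun y => \1_B (iter q beta y))).
  by apply: essbounded_expR; apply: essbounded_sum => k _; exact: biter.
have NE : (N = q + (n * M + j))%N by rewrite /q subnK.
apply: (@le_trans _ _ (integ m (fun y => expR ((2 * n)%:R * L) * F y))).
  apply: le_integ.
  - by apply: L1fun_essM => //; exact: essbounded_expR.
  - exact: L1funZ.
  - have wA : \forall y \ae m, forall k, w (iter k beta y) <= expR (phi (iter k beta y)).
      by apply/ae_foralln => k; exact: (aeiter k wphi).
    have pA : \forall y \ae m, forall k, `|phi (iter k beta y)| <= L.
      by apply/ae_foralln => k; exact: (aeiter k phiL).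
    apply: filterS2 wA pA => y wy py.
    rewrite /v /F -iterD -NE !mulrA ler_wpM2r ?indicE//.
    have -> : f y = \sum_(0 <= k < M) chi (iter (n * k + j) beta y) -
        \sum_(j <= i < j + n * M) phi (iter i beta y).
      rewrite -(sum_blocks (fun i => phi (iter i beta y))) -sumrB.
      apply: eq_bigr => k _; congr (_ - _); apply: eq_bigr => i _.
      by rewrite -iterD.
    have jM : (j <= j + n * M)%N by rewrite leq_addr.
    have jMN : (j + n * M <= N)%N by rewrite addnC.
    have := cocycle_window jM jMN wy py.
    set s := \sum_(j <= k < _) _; set t := \sum_(0 <= k < M) _ => cw.
    apply: (@le_trans _ _ (expR (t - s) * expR (s + (2 * n)%:R * L))).
      rewrite ler_wpM2l ?expR_ge0// (le_trans cw)// ler_expR lerD2l.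
      by rewrite ler_wpM2r// ler_nat; clear -Nn; lia.
    by rewrite -!expRD ler_expR; lra.
rewrite integZ//.
have h1 := @subinvariant_chain_shift n chi j M (fun y => \1_B (iter q beta y)) bchi Hchi lBq.
have B0' : \forall y \ae m, 0 <= (\1_B y : R) by apply/nearW => y; rewrite indicE.
have h2 := integ_beta_le m_sfinite mbeta beta_bound AE q C0 lB B0'.
have h3 : integ m F <= C ^+ (2 * n) * fine (m B).
  apply: (le_trans (h1 _)); first exact: (aeiter q B0').
  apply: (@le_trans _ _ (C ^+ (j + q) * fine (m B))).
    by rewrite exprD -mulrA ler_wpM2l ?exprn_ge0// -integ_indic.
  by rewrite ler_wpM2r ?(ltW mB0)// ler_weXn2l// /q; clear -Nn jN; lia.
apply: (@le_trans _ _ (expR ((2 * n)%:R * L) * (C ^+ (2 * n) * fine (m B)))).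
  by rewrite ler_wpM2l ?expR_ge0.
have eN : 0 < expR (N%:R * lam) by exact: expR_gt0.
rewrite mulrAC ler_pdivlMr//.
rewrite /D; set a := expR _; set b := C ^+ _.
have ab0 : 0 <= 2 * a * b by rewrite !mulr_ge0// ?expR_ge0// exprn_ge0.
apply: le_trans (ler_wpM2l ab0 gr).
by rewrite le_eqVlt; apply/orP; left; apply/eqP; field.
Qed.

(** [Phi] is chosen before phi, n and chi: the same mean handles every truncation level of ln w,
    every n and every partition of unity. *)
Lemma limit_mean_exists : exists Phi, [/\ is_mean m Phi,
  forall f, essbounded m f -> Phi (fun y => f (beta y)) = Phi f &
  forall phi n chi, essbounded m phi -> (\forall y \ae m, w y <= expR (phi y)) ->
    (0 < n)%N -> essbounded m chi -> subinvariant n chi ->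
    Phi chi <= n%:R * (Phi phi - lam)].
Proof.
have exv N : exists vB : (Y -> R) * set Y, [/\ L1fun m vB.1, (\forall y \ae m, 0 <= vB.1 y),
    0 < integ m vB.1 &
    S N -> [/\ measurable vB.2, (0 < m vB.2)%E, (m vB.2 < +oo)%E,
      vB.1 = (fun y => cocycle N y * \1_(vB.2) (iter N beta y)) &
      expR (N%:R * lam) / 2 * fine (m vB.2) <= integ m vB.1]].
  have [SN|nS] := pselect (S N).
    have [B [mB B0 Bfin gr]] := growth SN.
    exists (fun y => cocycle N y * \1_B (iter N beta y), B) => /=; split => //.
    - apply: L1fun_essM; first exact: essbounded_cocycle.
      by apply: liter; exact: L1fun_indic.
    - by apply/nearW => y; rewrite mulr_ge0 ?cocycle_ge0// indicE.
    - by apply: lt_le_trans gr; rewrite mulr_gt0 ?divr_gt0 ?expR_gt0// fine_gt0// B0 Bfin.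
  (* A placeholder density for N outside [S], so that [rho N] is a mean for every N. *)
  have [B [mB _ B0 Bfin]] := sigma_finite_pos_subset m_sfinite measurableT m0.
  exists (\1_B, B) => /=; split => //.
  - exact: L1fun_indic.
  - by apply/nearW => y; rewrite indicE.
  - by rewrite integ_indic// fine_gt0// B0 Bfin.
have [vB vBP] := choice exv.
pose rho N f := integ m (fun y => f y * (vB N).1 y) / integ m (vB N).1.
have mrho N : is_mean m (rho N) by have [lv v0 Z0 _] := vBP N; exact: is_mean_density.
have [Phi [mPhi Pinv Plim]] := averaged_limit biter aeiter Sinf mrho.
exists Phi; split => // phi n chi bphi wphi n0 bchi Hchi.
have Piter k f : essbounded m f -> Phi (fun y => f (iter k beta y)) = Phi f.
  elim: k f => // k ih f bf.
  by rewrite (ih (fun y => f (beta y))) ?Pinv//; exact: (essbounded_beta mbeta beta_bound).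
pose theta y := chi y - \sum_(0 <= i < n) phi (iter i beta y).
have bS : essbounded m (fun y => \sum_(0 <= i < n) phi (iter i beta y)).
  by apply: essbounded_sum => i _; exact: biter.
have bth : essbounded m theta by exact: essboundedB.
suff : Phi theta <= - (n%:R * lam).
  rewrite (meanB mPhi)// (mean_sum mPhi); last by move=> i _; exact: biter.
  under eq_bigr do rewrite Piter//.
  rewrite sumr_const_nat subn0 -[Phi phi *+ n]mulr_natl mulrBr => ?; lra.
have [_ [L' L'P]] := bphi; pose L := `|L'|.
have phiL : \forall y \ae m, `|phi y| <= L.
  by apply: filterS L'P => y /le_trans; apply; exact: ler_norm.
have [_ [Lt LtP]] := bth.
pose D := ln (2 * expR ((2 * n)%:R * L) * C ^+ (2 * n)).
have Lt0 : 0 <= `|Lt| by [].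
(* Each of the n residue classes contributes D - N lam, and the at most 2 n leftover indices
   contribute [|Lt|] each; only - n N lam survives division by N. *)
apply: (Plim _ _ (n%:R * D + (2 * n)%:R * `|Lt|) n bth) => N SN nN.
have [lv v0 Z0 /(_ SN) [mB B0 Bfin vE gr]] := vBP N.
(* One block is given up so that every shift j < n still fits below N; the threshold n <= N makes
   the quotient positive. *)
pose M := (N %/ n).-1.
have Mn : (n * M + n <= N)%N.
  rewrite -mulnSr prednK ?divn_gt0// mulnC; exact: leq_trunc_div.
have Nn : (N <= n * M + 2 * n)%N.
  have := ltn_ceil N n0; rewrite -[(N %/ n)%N]prednK ?divn_gt0// -/M => /ltnW.
  by rewrite mulnC !mulnS; clear; lia.
rewrite (@big_cat_nat _ _ _ (n * M)%N 0 N)//=; last by clear -Mn; lia.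
rewrite -sum_residues.
have h1 : \sum_(0 <= j < n) \sum_(0 <= k < M) rho N (fun y => theta (iter (n * k + j) beta y))
    <= \sum_(0 <= j < n) (D - N%:R * lam).
  rewrite !big_nat; apply: ler_sum => j /andP[_ jn].
  rewrite -(mean_sum (mrho N)); last by move=> k _; exact: biter.
  rewrite /rho vE; apply: block_mean_le => //; [by rewrite -vE|by clear -jn Mn; lia|exact: normr_ge0].
have h2 : \sum_(n * M <= i < N) rho N (fun y => theta (iter i beta y)) <=
    (N - n * M)%:R * `|Lt|.
  apply: (le_trans (ler_norm _)); apply: norm_sum_le => k.
  apply: (mean_norm_le (mrho N)); first exact: biter.
  apply: (@aeiter k (fun y => `|theta y| <= `|Lt|)).
  by apply: filterS LtP => y /le_trans; apply; exact: ler_norm.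
have h3 : (N - n * M)%:R * `|Lt| <= (2 * n)%:R * `|Lt|.
  by rewrite ler_wpM2r// ler_nat; clear -Nn; lia.
apply: (le_trans (lerD h1 (le_trans h2 h3))).
rewrite sumr_const_nat subn0 -[_ *+ n]mulr_natl addrA lerD2r.
by rewrite le_eqVlt; apply/orP; left; apply/eqP; ring.
Qed.

End LowerBound.

(** * Norms of powers of the weighted shift *)

Section OperatorNorm.
Context d (Y : measurableType d) (R : realType) (m : {measure set Y -> \bar R}).
Hypothesis m_sfinite : sigma_finite setT m.
Variables (beta : Y -> Y) (C : R).
Hypothesis mbeta : measurable_fun setT beta.
Hypothesis beta_bound : forall G : set Y, measurable G ->
  (m (beta @^-1` G) <= C%:E * m G)%E.
Variable A : Linf m -> Linf m.
Hypothesis AE : forall (f : Linf m) (g : LspaceType1 m),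
  (\int[m]_y ((f y : R) * g (beta y))%:E = \int[m]_y ((A f y : R) * g y)%:E)%E.
Variables (p : R) (p1 : (1 <= p%:E)%E).
Variable T : LspaceType m p1 -> LspaceType m p1.
Hypothesis TE : forall f : LspaceType m p1, \forall x \ae m, T f x = f (beta x).
Variable psi : Linf m.
Variable psiT : LspaceType m p1 -> LspaceType m p1.
Hypothesis psiTE : forall f : LspaceType m p1,
  \forall x \ae m, (psiT f x : R) = psi x * T f x.

Let p_ge1 : 1 <= p. Proof. by move: p1; rewrite lee_fin. Qed.
Let p_gt0 : 0 < p. Proof. exact: lt_le_trans p_ge1. Qed.
Let p_neq0 : p != 0. Proof. by rewrite gt_eqF. Qed.

Lemma Lnorm_le_integral (f : Y -> R) (x : R) : 0 <= x ->
  ('N[m]_(p%:E) [EFin \o f] <= x%:E)%E =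
  (\int[m]_y (`|f y| `^ p)%:E <= (x `^ p)%:E)%E.
Proof.
move=> x0.
have -> : (\int[m]_y (`|f y| `^ p)%:E = 'N[m]_(p%:E) [EFin \o f] `^ p)%E.
  by rewrite powR_Lnorm//; apply: eq_integral => y _; rewrite /= poweR_EFin.
rewrite -poweR_EFin; have mono (r : R) (a b : \bar R) : 0 <= r -> (0 <= a)%E -> (0 <= b)%E -> (a <= b)%E ->
    (a `^ r <= b `^ r)%E.
  by move=> r0 a0 b0; apply: gt0_ler_poweR => //; rewrite in_itv/= leey ?a0 ?b0.
apply/idP/idP => h.
  by apply: mono; rewrite ?Lnorm_ge0 ?(ltW p_gt0).
have : (('N[m]_(p%:E) [EFin \o f] `^ p) `^ p^-1 <= (x%:E `^ p) `^ p^-1)%E.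
  by apply: mono; rewrite ?poweR_ge0 ?invr_ge0 ?(ltW p_gt0).
by rewrite -!poweRrM divff// !poweRe1// ?Lnorm_ge0// lee_fin.
Qed.

Lemma measurable_Lspace (f : LspaceType m p1) : measurable_fun setT (f : Y -> R).
Proof. exact: (@measurable_funPT _ _ _ _ (repr (f : {mfun_ m, Y >-> measurableTypeR R}))). Qed.

Lemma measurable_lpow (f : Y -> R) : measurable_fun setT f ->
  measurable_fun setT (fun y => `|f y| `^ p).
Proof.
move=> mf; apply: (@measurableT_comp _ _ _ _ _ _ (fun x => x `^ p)) => //.
exact: measurableT_comp.
Qed.

Lemma L1fun_lpow (f : LspaceType m p1) : L1fun m (fun y => `|f y : R| `^ p).
Proof.
apply/integrableP; split.
  by apply/measurable_EFinP; apply: measurable_lpow; exact: measurable_Lspace.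
have -> : (\int[m]_y `|(EFin \o (fun y => (`|f y : R| `^ p)%R)) y| =
    'N[m]_(p%:E) [EFin \o f] `^ p)%E.
  rewrite powR_Lnorm//; apply: eq_integral => y _ /=.
  by rewrite ger0_norm// powR_ge0.
by apply: poweR_lty; exact: (Lebesgue_finite (s := f)).
Qed.

Lemma Lnorm_le_integ (f : LspaceType m p1) (x : R) : 0 <= x ->
  ('N[m]_(p%:E) [EFin \o f] <= x%:E)%E =
  (integ m (fun y => `|f y : R| `^ p) <= x `^ p).
Proof.
by move=> x0; rewrite Lnorm_le_integral// (integE (L1fun_lpow f)) lee_fin.
Qed.

Lemma iter_psiTE N (f : LspaceType m p1) :
  \forall y \ae m, (iter N psiT f y : R) =
    (\prod_(0 <= i < N) (psi (iter i beta y) : R)) * f (iter N beta y).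
Proof.
elim: N f => [|N ih] f; first by apply/nearW => y; rewrite big_geq// mul1r.
have h1 := psiTE (iter N psiT f); have h2 := TE (iter N psiT f).
have h3 := ae_beta mbeta beta_bound (ih f).
apply: filterS3 h1 h2 h3 => y h1 h2 h3.
rewrite iterS h1 h2 h3 big_nat_recl//= mulrA.
congr (_ * _ * f _); last by rewrite -iterSr.
by apply: eq_bigr => i _; rewrite -iterSr.
Qed.

Definition weight y := `|psi y : R| `^ p.

Lemma weight_ge0 y : 0 <= weight y. Proof. exact: powR_ge0. Qed.

Lemma essbounded_weight : essbounded m weight.
Proof.
have [mpsi [M psiM]] := essbounded_Linf psi.
split; first exact: measurable_lpow.
exists (`|M| `^ p); apply: filterS psiM => y psiM.
rewrite ger0_norm ?powR_ge0// /weight.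
apply: ge0_ler_powR; rewrite ?nnegrE ?(ltW p_gt0)//.
exact: le_trans (ler_norm _).
Qed.

Lemma cocycle_weight N y :
  cocycle beta weight N y = `|\prod_(0 <= i < N) (psi (iter i beta y) : R)| `^ p.
Proof.
rewrite /cocycle/weight; symmetry.
apply: (big_morph (fun x : R => `|x| `^ p)).
  by move=> a b; rewrite normrM powRM.
by rewrite normr1 powR1.
Qed.

Let bcoc N : essbounded m (cocycle beta weight N).
Proof. exact: (essbounded_cocycle mbeta beta_bound essbounded_weight). Qed.

(** |(psi T)^N f|^p is the cocycle of |psi|^p times |f|^p o beta^N, to which duality applies; the
    norm becomes a question about the essential supremum of A^N w_N. *)
Lemma integ_iter_psiT N (f : LspaceType m p1) :
  integ m (fun y => `|iter N psiT f y : R| `^ p) =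
  integ m (fun y => transfer A N (cocycle beta weight N) y * (`|f y : R| `^ p)).
Proof.
rewrite -(transfer_duality mbeta beta_bound AE)//; last exact: L1fun_lpow.
apply: integ_ae_eq.
- by apply: measurable_lpow; exact: measurable_Lspace.
- apply: measurable_funM; first by have [] := bcoc N.
  apply: (@measurable_lpow (fun y => f (iter N beta y))).
  by apply: measurableT_comp; [exact: measurable_Lspace|exact: measurable_iter_beta].
- apply: filterS (iter_psiTE N f) => y ->.
  by rewrite normrM powRM// cocycle_weight.
Qed.

Lemma Lnorm_op_le N (c : R) : 0 <= c ->
  (\forall y \ae m, transfer A N (cocycle beta weight N) y <= c) ->
  (Lnorm_op (iter N psiT) <= (c `^ p^-1)%:E)%E.
Proof.
move=> c0 Hc; apply/ge_ereal_sup => _ [f /= f1 <-].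
rewrite Lnorm_le_integ ?powR_ge0// -powRrM mulVf// powRr1//.
rewrite integ_iter_psiT; move: f1; rewrite Lnorm_le_integ// powR1 => f1.
have lf := L1fun_lpow f.
apply: (@le_trans _ _ (integ m (fun y => c * `|f y : R| `^ p))).
  apply: le_integ; [|exact: L1funZ|].
    by apply: L1fun_essM => //; exact: essbounded_transfer.
  by apply: filterS Hc => y Hc; rewrite ler_wpM2r// powR_ge0.
by rewrite integZ// ler_piMr.
Qed.

Lemma Lnorm_op_ge N (x : R) : 0 <= x -> (Lnorm_op (iter N psiT) <= x%:E)%E ->
  \forall y \ae m, transfer A N (cocycle beta weight N) y <= x `^ p.
Proof.
move=> x0 Hx; apply: (transfer_le_cst m_sfinite mbeta beta_bound AE) => // B mB Bfin.
have lB := L1fun_indic mB Bfin.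
rewrite (transfer_duality mbeta beta_bound AE)//.
have [B0|B0] := eqVneq (m B) 0%E.
  rewrite B0 mulr0 (@integ_ae_eq _ _ _ _ _ (fun y => 0)).
  - by rewrite /integ integral0.
  - apply: measurable_funM; first by have [] := essbounded_transfer A N (cocycle beta weight N).
    exact: measurable_indic.
  - exact: measurable_cst.
  - exists B; split => // y /=; apply: contra_notP => yB.
    by rewrite indicE memNset// mulr0.
have Bgt0 : 0 < fine (m B) by rewrite fine_gt0// lt0e B0 measure_ge0.
pose b := fine (m B).
(* The normalized indicator of [B], of norm 1 in L^p; it tests the average of A^N w_N over [B]. *)
pose f y : R := (b^-1 `^ p^-1) * \1_B y.
have fE y : `|f y| `^ p = b^-1 * \1_B y.
  rewrite normrM powRM// ger0_norm ?powR_ge0// -powRrM mulVf// powRr1 ?invr_ge0 ?ltW//.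
  rewrite indicE; case: (y \in B); rewrite /= ?normr1 ?powR1// normr0 powR0//.
have mf : measurable_fun setT f.
  by apply: measurable_funM => //; exact: measurable_indic.
have fle : ('N[m]_(p%:E) [EFin \o f] <= 1)%E.
  rewrite Lnorm_le_integral// powR1.
  under eq_integral do rewrite fE.
  by rewrite integE ?lee_fin ?integZ ?integ_indic// ?mulVf ?gt_eqF//; exact: L1funZ.
have [F FE] : exists F : LspaceType m p1, \forall y \ae m, (F y : R) = f y.
  by apply: Lspace_class => //; rewrite /finite_norm (le_lt_trans fle)// ltry.
have F1 : ('N[m]_(p%:E) [EFin \o F] <= 1)%E.
  by rewrite (@ae_eq_Lnorm _ _ _ m p%:E F f)//; exact: measurable_Lspace.
have : ('N[m]_(p%:E) [EFin \o iter N psiT F] <= x%:E)%E.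
  by apply: le_trans Hx; apply: ereal_sup_ubound; exists F.
rewrite Lnorm_le_integ// integ_iter_psiT.
rewrite (@integ_ae_eq _ _ _ _ _
  (fun y => b^-1 * (transfer A N (cocycle beta weight N) y * \1_B y))).
- rewrite integZ; last by apply: L1fun_essM => //; exact: essbounded_transfer.
  by rewrite mulrC ler_pdivrMr.
- apply: measurable_funM; first by have [] := essbounded_transfer A N (cocycle beta weight N).
  by apply: measurable_lpow; exact: measurable_Lspace.
- apply: measurable_funM => //; apply: measurable_funM.
    by have [] := essbounded_transfer A N (cocycle beta weight N).
  exact: measurable_indic.
- by apply: filterS FE => y ->; rewrite fE mulrCA.
Qed.

Lemma Lnorm_op_lty N : (Lnorm_op (iter N psiT) < +oo)%E.
Proof.
have [_ [M HM]] := essbounded_transfer A N (cocycle beta weight N).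
apply: le_lt_trans (ltry (`|M| `^ p^-1)); apply: Lnorm_op_le => //.
by apply: filterS HM => y /(le_trans (ler_norm _))/le_trans; apply; exact: ler_norm.
Qed.

Lemma Lnorm_op_ge0 N : (0 <= Lnorm_op (iter N psiT))%E.
Proof.
(* The class of 0 lies in the unit ball, so the supremum defining the norm is not over the empty
   set. *)
have [F FE] : exists F : LspaceType m p1, \forall y \ae m, (F y : R) = 0.
  apply: (@Lspace_class _ _ _ m _ p1 (fun=> 0 : R)) => //.
  by rewrite /finite_norm (Lnorm0 m)// ltry.
have F0 : ('N[m]_(p%:E) [EFin \o F] <= 1)%E.
  rewrite (@ae_eq_Lnorm _ _ _ m p%:E F (fun=> 0))//; last exact: measurable_Lspace.
  by rewrite (Lnorm0 m)// lee01.
apply: (@le_trans _ _ ('N[m]_(p%:E) [EFin \o iter N psiT F])%E).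
  exact: Lnorm_ge0.
by apply: ereal_sup_ubound; exists F.
Qed.

(** Were A^N w_N at most x^p / 2 a.e., the norm would be less than x; so it exceeds this level on a
    set of positive finite measure. The factor 1/2 is lost in N-th roots. *)
Lemma Lnorm_op_growth N (x : R) : 0 < x -> (x%:E <= Lnorm_op (iter N psiT))%E ->
  exists B, [/\ measurable B, (0 < m B)%E, (m B < +oo)%E &
    x `^ p / 2 * fine (m B) <=
    integ m (fun y => cocycle beta weight N y * \1_B (iter N beta y))].
Proof.
move=> x0 Hx; pose c := x `^ p / 2.
have xp0 : 0 < x `^ p by exact: powR_gt0.
have bt := essbounded_transfer A N (cocycle beta weight N).
have [Hc|nHc] := pselect (\forall y \ae m, transfer A N (cocycle beta weight N) y <= c).
  have c0 : 0 <= c by rewrite divr_ge0// ltW.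
  have := le_trans Hx (Lnorm_op_le c0 Hc); rewrite lee_fin => h.
  have : x `^ p <= c.
    rewrite -[leRHS]powRr1// -(mulVf p_neq0) powRrM.
    by apply: ge0_ler_powR; rewrite ?nnegrE ?powR_ge0 ?(ltW p_gt0) ?(ltW x0).
  by rewrite /c => ?; exfalso; lra.
have mS : measurable [set y | ~ transfer A N (cocycle beta weight N) y <= c].
  rewrite (_ : mkset _ = transfer A N (cocycle beta weight N) @^-1` `]c, +oo[).
    by rewrite -[X in measurable X]setTI; apply: bt.1.
  by apply/seteqP; split => y; rewrite /= in_itv/= andbT ltNge => /negP.
have [B [mB BS B0 Bfin]] := not_ae_pos_subset m_sfinite mS nHc.
have lB := L1fun_indic mB Bfin.
exists B; split => //.
rewrite (transfer_duality mbeta beta_bound AE)// -/c -integ_indic// -integZ//.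
apply: le_integ; [exact: L1funZ|exact: L1fun_essM|].
apply/nearW => y; rewrite indicE; have [/set_mem /BS/= /negP|] := boolP (y \in B).
  by rewrite -ltNge => /ltW; rewrite !mulr1.
by rewrite !mulr0.
Qed.

End OperatorNorm.

Section MeanExtensionality.
Context d (Y : measurableType d) (R : realType) (m : {measure set Y -> \bar R}).

Lemma mean_indic_ext (Phi Psi : (Y -> R) -> R) (f : Y -> R) :
  is_mean m Phi -> is_mean m Psi ->
  (forall G, measurable G -> Phi \1_G = Psi \1_G) -> essbounded m f -> Phi f = Psi f.
Proof.
move=> mPhi mPsi H bf; apply: (@eq_of_le_eps _ _ _ 2) => e e0.
have [T [lab [c [E [mlab mE E0 fE]]]]] := essbounded_label e0 bf.
have bc : essbounded m (c \o lab) by exact: essbounded_comp_label.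
have key (Q : (Y -> R) -> R) : is_mean m Q -> `|Q f - Q (c \o lab)| <= e.
  move=> mQ; rewrite -(meanB mQ)//; apply: (mean_norm_le mQ); first exact: essboundedB.
  exists (~` E); split => //; first exact: measurableC.
  move=> y /= yE Ey; apply: yE; have := fE _ Ey; rewrite ler_distl.
  by move=> /andP[? ?]; apply/andP; split; lra.
have := key _ mPhi; have := key _ mPsi.
have -> : Phi (c \o lab) = Psi (c \o lab).
  by rewrite (mean_label mPhi)// (mean_label mPsi)//; apply: eq_bigr => t _; rewrite H.
by rewrite !ler_distl => /andP[? ?] /andP[? ?]; apply/andP; split; lra.
Qed.

End MeanExtensionality.

(** * The variational principle *)

Section ValueUpperBound.
Context d (Y : measurableType d) (R : realType) (m : {measure set Y -> \bar R}).
Hypothesis m0 : m [set: Y] != 0%E.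
Hypothesis m_sfinite : sigma_finite setT m.
Variables (beta : Y -> Y) (C : R).
Hypothesis C1 : 1 <= C.
Hypothesis mbeta : measurable_fun setT beta.
Hypothesis beta_bound : forall G : set Y, measurable G ->
  (m (beta @^-1` G) <= C%:E * m G)%E.
Variable A : Linf m -> Linf m.
Hypothesis AE : forall (f : Linf m) (g : LspaceType1 m),
  (\int[m]_y ((f y : R) * g (beta y))%:E = \int[m]_y ((A f y : R) * g y)%:E)%E.

(** Both sides are means in f, hence determined by indicators, where the identity is the invariance
    of [mu]. *)
Lemma content_mean_beta (mu : {content set Y -> \bar R}) f :
  invariant_fa_prob m beta mu -> essbounded m f ->
  content_mean mu (fun y => f (beta y)) = content_mean mu f.
Proof.
move=> [mu1 mu0 mui] bf.
have mM := is_mean_content_mean mu1 mu0.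
have bb := essbounded_beta mbeta beta_bound.
apply: (@mean_indic_ext _ _ _ m (fun f => content_mean mu (fun y => f (beta y)))) => //.
  split.
  - by move=> a g h bg bh; case: mM => lin _ _; rewrite -lin//; exact: bb.
  - move=> g bg g0; apply: (mean_ge0 mM); first exact: bb.
    exact: ae_beta mbeta beta_bound _ g0.
  - exact: (mean_cst mM).
move=> G mG; have mbG := measurable_beta_preimage mbeta mG.
by rewrite [RHS](content_mean_indic mu1 mu0)// -mui// -(content_mean_indic mu1 mu0 mbG).
Qed.

(** Replacing one factor at a time costs at most e B^n each. An additive comparison is used since b
    i may vanish, as the weight does at zeros of psi. *)
Lemma prod_le_prodD n (a b : nat -> R) (B e : R) : 1 <= B -> 0 <= e ->
  (forall i, [/\ 0 <= b i, b i <= a i, a i <= B & a i <= b i + e]) ->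
  \prod_(0 <= i < n) a i <= \prod_(0 <= i < n) b i + n%:R * e * B ^+ n.
Proof.
move=> B1 e0 H; have B0 : 0 <= B by exact: le_trans B1.
elim: n => [|n ih]; first by rewrite !big_geq// !mul0r addr0.
rewrite !big_nat_recr//=.
set Pa := \prod_(0 <= i < n) a i in ih *; set Pb := \prod_(0 <= i < n) b i in ih *.
have [b0 ba aB ab] := H n.
have Pb0 : 0 <= Pb by apply: prodr_ge0 => i _; have [] := H i.
have PbB : Pb <= B ^+ n.
  rewrite -[n in B ^+ n]subn0 -prodr_const_nat; apply: ler_prod => i _.
  by have [bi0 bai aiB _] := H i; rewrite bi0 (le_trans bai).
have Bn0 : 0 <= B ^+ n by rewrite exprn_ge0.
have a0 : 0 <= a n by exact: le_trans ba.
have t0 : 0 <= n%:R * e * B ^+ n by rewrite !mulr_ge0.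
apply: (@le_trans _ _ ((Pb + n%:R * e * B ^+ n) * a n)); first by rewrite ler_wpM2r.
rewrite mulrDl.
have h1 : Pb * a n <= Pb * b n + B ^+ n * B * e.
  apply: (@le_trans _ _ (Pb * (b n + e))); first by rewrite ler_wpM2l.
  rewrite mulrDr lerD2l ler_wpM2r// (le_trans PbB)//.
  by rewrite ler_peMr.
have h2 : n%:R * e * B ^+ n * a n <= n%:R * e * B ^+ n * B by rewrite ler_wpM2l.
apply: (le_trans (lerD h1 h2)); rewrite -[n.+1]addn1 natrD exprD expr1.
by rewrite le_eqVlt; apply/orP; left; apply/eqP; ring.
Qed.

Lemma transfer1_le n : \forall y \ae m, transfer A n (fun=> 1) y <= C ^+ n.
Proof.
have C0 : 0 <= C by exact: le_trans C1.
apply: (transfer_le_cst m_sfinite mbeta beta_bound AE); first exact: essbounded_cst.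
move=> B mB Bfin; have lB := L1fun_indic mB Bfin.
rewrite -integ_indic//.
rewrite (_ : (fun y => _) = (fun y => \1_B (iter n beta y))); last first.
  by apply/funext => y; rewrite mul1r.
apply: (integ_beta_le m_sfinite mbeta beta_bound AE) => //.
by apply/nearW => y; rewrite indicE.
Qed.

Variables (p : R) (psi : Linf m).
Hypothesis p1 : 1 <= p.

Let p0 : 0 < p. Proof. exact: lt_le_trans p1. Qed.

Let phi l y := ln_trunc l (psi y : R).

Let bphi l : essbounded m (phi l).
Proof. by apply: essbounded_ln_trunc; exact: essbounded_Linf. Qed.

Lemma expR_ln_trunc l (x : R) :
  expR (p * ln_trunc l x) = (Num.max `|x| (expR (- l%:R))) `^ p.
Proof.
rewrite /ln_trunc /powR ifF//; apply/negbTE; rewrite gt_eqF//.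
Qed.

Lemma weight_le_expR l y : weight p psi y <= expR (p * ln_trunc l (psi y)).
Proof.
rewrite expR_ln_trunc; apply: ge0_ler_powR; rewrite ?nnegrE ?(ltW p0)//.
by rewrite le_max lexx.
Qed.

Lemma expR_le_weightD l y :
  expR (p * ln_trunc l (psi y)) <= weight p psi y + expR (- l%:R).
Proof.
rewrite expR_ln_trunc /weight maxEle; case: ifP => _; last by rewrite lerDl expR_ge0.
apply: (@le_trans _ _ (expR (- l%:R))); last by rewrite lerDr powR_ge0.
by rewrite -expRM ler_expR mulNr lerN2 ler_peMr.
Qed.

Lemma weight_bound : exists2 B : R, 1 <= B &
  forall l, \forall y \ae m, expR (p * ln_trunc l (psi y)) <= B.
Proof.
have [_ [M psiM]] := essbounded_Linf psi.
exists ((Num.max M 1) `^ p).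
  have e1 : (1 : R) `^ p = 1 by rewrite powR1.
  rewrite -[leLHS]e1; apply: ge0_ler_powR; rewrite ?nnegrE ?(ltW p0)//.
    by rewrite le_max ler01 orbT.
  by rewrite le_max lexx orbT.
move=> l; apply: filterS psiM => y psiM; rewrite expR_ln_trunc.
have h1 : 0 <= Num.max `|psi y| (expR (- l%:R)) by rewrite le_max normr_ge0.
have h2 : 0 <= Num.max M 1 by rewrite le_max ler01 orbT.
apply: ge0_ler_powR; rewrite ?nnegrE ?(ltW p0)//.
rewrite ge_max !le_max psiM/= (_ : expR _ <= 1) ?orbT//.
Qed.

(** Truncation at level l raises the cocycle by at most n e^(-l) B^n a.e., hence A^n of it by at
    most that times A^n 1 <= C^n. As n is fixed, a large l makes this at most t. *)
Lemma transfer_cocycle_trunc_le n (K t : R) : 0 < t ->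
  (\forall y \ae m, transfer A n (cocycle beta (weight p psi) n) y <= K) ->
  exists l, \forall y \ae m,
    transfer A n (fun y => expR (p * \sum_(0 <= i < n) ln_trunc l (psi (iter i beta y)))) y
    <= K + t.
Proof.
move=> t0 HK; have [B B1 HB] := weight_bound.
have C0 : 0 <= C by exact: le_trans C1.
have Bn0 : 0 <= B ^+ n by rewrite exprn_ge0// (le_trans ler01).
pose c := n%:R * B ^+ n * C ^+ n.
have c0 : 0 <= c by rewrite !mulr_ge0// exprn_ge0.
(* c / t <= l <= e^l gives c e^(-l) <= t. *)
pose l := (Num.truncn (c / t)).+1; exists l.
have lc : expR (- l%:R) * c <= t.
  rewrite mulrC expRN ler_pdivrMr ?expR_gt0// mulrC -ler_pdivrMr//.
  apply: (@le_trans _ _ l%:R); first by apply: ltW; exact: truncnS_gt.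
  by apply: le_trans (expR_ge1Dx _); rewrite lerDr.
have bn := essbounded_iter_beta mbeta beta_bound.
pose U y := expR (p * \sum_(0 <= i < n) ln_trunc l (psi (iter i beta y))).
have bU : essbounded m U.
  apply: essbounded_expR; apply: essboundedZ; apply: essbounded_sum => i _.
  exact: (bn i (phi l)).
pose W := cocycle beta (weight p psi) n.
have bW : essbounded m W.
  exact: (essbounded_cocycle mbeta beta_bound (essbounded_weight p1 psi)).
pose k := n%:R * expR (- l%:R) * B ^+ n.
have b1 : essbounded m (fun=> 1 : R) by exact: essbounded_cst.
have UW : \forall y \ae m, U y <= k * 1 + W y.
  have : \forall y \ae m, forall i,
      expR (p * ln_trunc l (psi (iter i beta y))) <= B.
    by apply/ae_foralln => i; exact: (ae_iter_beta mbeta beta_bound i (HB l)).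
  apply: filterS => y HBy; rewrite /U mulr_sumr expR_sum mulr1 addrC.
  apply: prod_le_prodD => //.
  by move=> i; split; [exact: weight_ge0|exact: weight_le_expR|exact: HBy|
    exact: expR_le_weightD].
have bkW : essbounded m (fun y => k * 1 + W y).
  by apply: essboundedD => //; exact: essboundedZ.
apply: filterS3 (le_transfer m_sfinite mbeta beta_bound AE n bU bkW UW)
  (transferZD m_sfinite mbeta beta_bound AE n k b1 bW)
  (filterI HK (transfer1_le n)) => y h1 h2 [h3 h4].
apply: (le_trans h1); rewrite h2 addrC lerD//.
apply: (@le_trans _ _ (k * C ^+ n)).
  by rewrite ler_wpM2l// !mulr_ge0// expR_ge0.
by apply: le_trans lc; rewrite /k /c le_eqVlt; apply/orP; left; apply/eqP; ring.
Qed.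

Lemma value_le (mu : {content set Y -> \bar R}) n (x : R) :
  invariant_fa_prob m beta mu -> (0 < n)%N -> 0 < x ->
  (\forall y \ae m, transfer A n (cocycle beta (weight p psi) n) y <= x `^ p) ->
  (integral_ln m0 mu psi + t_entropy A mu / p%:E <= (ln x / n%:R)%:E)%E.
Proof.
move=> imu n0 x0 Hx; have [mu1 mu0 _] := imu.
have mM := is_mean_content_mean mu1 mu0.
have n0' : 0 < n%:R :> R by rewrite ltr0n.
apply/lee_addgt0Pr => e e0.
have xp0 : 0 < x `^ p by exact: powR_gt0.
(* Chosen so that x^p + t = x^p e^(e/2): truncation costs e/2 after the logarithm, and the level-set
   approximation in [tau_n_le] takes the other e/2. *)
pose t := x `^ p * (expR (e / 2) - 1).
have t0 : 0 < t by rewrite mulr_gt0// subr_gt0 -expR0 ltr_expR divr_gt0.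
have [l Hl] := transfer_cocycle_trunc_le t0 Hx.
have Kt : x `^ p + t = x `^ p * expR (e / 2) by rewrite /t; ring.
rewrite Kt in Hl.
have K0 : 0 < x `^ p * expR (e / 2) by rewrite mulr_gt0// expR_gt0.
have e2 : 0 < e / 2 by rewrite divr_gt0.
have bn := essbounded_iter_beta mbeta beta_bound.
have bS : essbounded m (fun y => \sum_(0 <= i < n) ln_trunc l (psi (iter i beta y))).
  by apply: essbounded_sum => i _; exact: (bn i (phi l)).
have bu : essbounded m (fun y => p * \sum_(0 <= i < n) ln_trunc l (psi (iter i beta y))).
  exact: essboundedZ.
have := tau_n_le m_sfinite mbeta beta_bound AE mu1 mu0 e2 K0 bu Hl.
pose I := content_mean mu (phi l).
have -> : content_mean mu (fun y => p * \sum_(0 <= i < n) ln_trunc l (psi (iter i beta y))) =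
    p * (n%:R * I).
  rewrite (meanZ mM)//; congr (_ * _).
  rewrite (mean_sum mM); last by move=> i _; exact: (bn i (phi l)).
  rewrite (eq_bigr (fun=> I)); last first.
    move=> i _; rewrite (content_mean_iter mbeta beta_bound _ i (bphi l))//.
    by move=> f bf; exact: content_mean_beta.
  by rewrite sumr_const_nat subn0 mulr_natl.
rewrite lnM ?posrE ?expR_gt0// expRK ln_powR => Htau.
have Hint := integral_ln_le m0 mu1 mu0 psi l.
(* The same truncated mean [I] bounds the integral of ln |psi| from above and enters the entropy
   bound with the opposite sign, so it cancels. *)
apply: (@le_trans _ _ (I%:E + ((p * ln x + e) / n%:R / p - I)%:E)%E).
  apply: leeD => //.
  rewrite inver gt_eqF// lee_pdivrMr//.
  apply: (@le_trans _ _ (tau_n A mu n / n%:R%:E)%E).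
    by apply: ereal_inf_lbound; exists n.
  rewrite inver gt_eqF// lee_pdivrMr//; apply: (le_trans Htau).
  rewrite -!EFinM lee_fin le_eqVlt; apply/orP; left; apply/eqP.
  by field; rewrite !gt_eqF.
rewrite -!EFinD lee_fin addrC subrK.
have -> : (p * ln x + e) / n%:R / p = ln x / n%:R + e / (n%:R * p).
  by field; rewrite !gt_eqF.
rewrite lerD2l ler_pdivrMr ?mulr_gt0// ler_peMr ?(ltW e0)//.
by rewrite mulr_ege1// ler1n.
Qed.

End ValueUpperBound.

(** * From the two one-sided bounds to the limit and the attained maximum *)

Section GrowthRate.
Variable R : realType.

(** Stands in for submultiplicativity of norms: the upper bound at every single N compares [V] with
    the infimum of the roots, and the lower bound along any infinite set of indices prevents the
    roots from staying above it. *)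
Lemma growth_rate_max (a : nat -> R) (V : set (\bar R)) :
  (forall N, 0 <= a N) -> V !=set0 ->
  (forall v N x, V v -> (0 < N)%N -> 0 < x -> a N <= x -> (v <= (ln x / N%:R)%:E)%E) ->
  (forall Lam (S : set nat), (forall K, exists2 N, (K <= N)%N & S N) ->
     (forall N, S N -> expR (N%:R * Lam) <= a N) ->
     exists2 v, V v & (Lam%:E <= v)%E) ->
  let r := limn (fun N => (a N)%:E `^ N%:R^-1)%E in
  V (lne r) /\ ubound V (lne r).
Proof.
move=> a0 [v0 Vv0] up low.
pose u N := a N `^ N%:R^-1.
have u0 N : 0 <= u N by exact: powR_ge0.
have uE N : (0 < N)%N -> a N = u N `^ N%:R.
  by move=> N0; rewrite /u -powRrM mulVf ?powRr1// pnatr_eq0 -lt0n.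
have powE N y : 0 < y -> y `^ N%:R = expR (N%:R * ln y).
  by move=> y0; rewrite /powR gt_eqF.
pose E := [set u N | N in [set N | (0 < N)%N]].
have E0 : has_inf E.
  by split; [exists (u 1%N), 1%N|exists 0 => _ [N _ <-]].
pose l := inf E.
have l0 : 0 <= l by apply: lb_le_inf; [exact: E0.1|move=> _ [N _ <-]].
have lu N : (0 < N)%N -> l <= u N.
  by move=> N0; apply: ge_inf; [exact: E0.2|exists N].
have Vle v y : V v -> l < y -> (v <= (ln y)%:E)%E.
  move=> Vv ly; have y0 : 0 < y by exact: le_lt_trans ly.
  have [_ [N N0 <-] uy] := inf_lt E0.1 ly.
  have -> : ln y = ln (y `^ N%:R) / N%:R.
    by rewrite ln_powR mulrC mulKf// pnatr_eq0 -lt0n.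
  apply: up => //; first exact: powR_gt0.
  by rewrite uE//; apply: ge0_ler_powR; rewrite ?nnegrE ?(ltW y0) ?(ltW uy).
have ucvg : u @ \oo --> l.
  apply/cvgrPdist_le => e e0; apply: contrapT => nH.
  have inf_many K : exists2 N, (K <= N)%N & [set N | (0 < N)%N /\ l + e < u N] N.
    apply: contrapT => H; apply: nH; exists K.+1 => // N /= KN.
    have N0 : (0 < N)%N by exact: leq_ltn_trans KN.
    rewrite distrC ger0_norm ?subr_ge0 ?lu// lerBlDl leNgt; apply/negP => luN.
    by apply: H; exists N => //; exact: ltnW.
  have le0 : 0 < l + e by rewrite ltr_wpDl.
  have [v Vv lv] : exists2 v, V v & ((ln (l + e))%:E <= v)%E.
    apply: (low _ _ inf_many) => N [N0 luN]; rewrite uE// -powE//.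
    by apply: ge0_ler_powR; rewrite ?nnegrE ?(ltW luN) ?(ltW le0).
  (* The contradiction: a value at least ln(l + e) exists, yet every value is at most ln(l +
     e/2). *)
  have e2 : l < l + e / 2 by rewrite ltrDl divr_gt0.
  have := le_trans lv (Vle v _ Vv e2); rewrite lee_fin leNgt => /negP; apply.
  by rewrite ltr_ln ?posrE// ?ltrD2l ?(le_lt_trans l0 e2)//; lra.
move=> r; have -> : r = l%:E.
  rewrite /r; apply/cvg_lim => //.
  rewrite (_ : (fun N => _) = EFin \o u); last first.
    by apply/funext => N; rewrite poweR_EFin.
  by apply: cvg_EFin => //; exact/nearW.
have Vub : ubound V (lne l%:E).
  move=> v Vv; have [l00|lneq0] := eqVneq l 0.
    rewrite l00 le0_lneNy//; case: v Vv => [s|//|] Vv; last by rewrite leeNy_eq.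
      (* When l = 0, a real value s would satisfy s <= s - 1. *)
      have := Vle _ (expR (s - 1)) Vv; rewrite l00 expR_gt0 expRK => /(_ isT).
      by rewrite lee_fin => ?; exfalso; lra.
    have := Vle _ 1 Vv; rewrite l00 => /(_ ltr01).
    by rewrite leye_eq.
  have lgt0 : 0 < l by rewrite lt0r lneq0.
  rewrite lne_EFin//; apply/lee_addgt0Pr => e e0.
  have := Vle v (l * expR e) Vv; rewrite lnM ?posrE ?expR_gt0// expRK -EFinD; apply.
  by rewrite ltr_pMr// -expR0 ltr_expR.
split => //.
(* Attainment. If l = 0 all values are -oo and nonemptiness of [V] suffices; otherwise all roots are
   at least l, so the lower bound applies with the exact rate ln l. *)
have [l00|lneq0] := eqVneq l 0.
  have := Vub _ Vv0; rewrite l00 le0_lneNy// leeNy_eq => /eqP <-.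
  exact: Vv0.
have lgt0 : 0 < l by rewrite lt0r lneq0.
have [v Vv lv] : exists2 v, V v & ((ln l)%:E <= v)%E.
  apply: (low _ [set N | (0 < N)%N]) => [K|N /= N0]; first by exists K.+1.
  by rewrite uE// -powE//; apply: ge0_ler_powR; rewrite ?nnegrE ?lu.
suff <- : v = lne l%:E by [].
apply/eqP; rewrite eq_le (Vub _ Vv) lne_EFin//.
Qed.

End GrowthRate.

Section ValueLowerBound.
Context d (Y : measurableType d) (R : realType) (m : {measure set Y -> \bar R}).
Hypothesis m0 : m [set: Y] != 0%E.
Hypothesis m_sfinite : sigma_finite setT m.
Variables (beta : Y -> Y) (C : R).
Hypothesis C1 : 1 <= C.
Hypothesis mbeta : measurable_fun setT beta.
Hypothesis beta_bound : forall G : set Y, measurable G ->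
  (m (beta @^-1` G) <= C%:E * m G)%E.
Variable A : Linf m -> Linf m.
Hypothesis AE : forall (f : Linf m) (g : LspaceType1 m),
  (\int[m]_y ((f y : R) * g (beta y))%:E = \int[m]_y ((A f y : R) * g y)%:E)%E.

Lemma invariant_mean_content (Phi : (Y -> R) -> R) : is_mean m Phi ->
  (forall f, essbounded m f -> Phi (fun y => f (beta y)) = Phi f) ->
  exists2 mu, invariant_fa_prob m beta mu &
    forall f, essbounded m f -> content_mean mu f = Phi f.
Proof.
move=> mPhi Pinv; have [mu [mu1 mu0 muG muf]] := mean_content mPhi.
exists mu => //; split => // G mG.
rewrite !muG//; last exact: measurable_beta_preimage.
by congr EFin; exact: (Pinv \1_G (essbounded_indic m mG)).
Qed.

(** Covers spectral radius 0, where the lower bound supplies no measure: averages of any fixed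
    normalized indicator have an invariant limit. *)
Lemma invariant_fa_prob_nonempty : invariant_fa_prob m beta !=set0.
Proof.
have [B [mB _ B0 Bfin]] := sigma_finite_pos_subset m_sfinite measurableT m0.
have mr : is_mean m (fun f => integ m (fun y => f y * \1_B y) / integ m \1_B).
  apply: is_mean_density; first exact: L1fun_indic.
  - by apply/nearW => y; rewrite indicE.
  - by rewrite integ_indic// fine_gt0// B0 Bfin.
have [Phi [mPhi Pinv _]] := averaged_limit (essbounded_iter_beta mbeta beta_bound)
  (ae_iter_beta mbeta beta_bound) (S := setT)
  (fun K => ex_intro2 _ _ K (leqnn K) I) (fun=> mr).
by have [mu imu _] := invariant_mean_content mPhi Pinv; exists mu.
Qed.

(** Take n = 1 and u = 0 in the upper bound, with A 1 <= C. Excluding +oo allows the entropy to be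
    moved across inequalities between extended reals. *)
Lemma t_entropy_lty (mu : {content set Y -> \bar R}) :
  invariant_fa_prob m beta mu -> (t_entropy A mu < +oo)%E.
Proof.
move=> [mu1 mu0 _].
have C0 : 0 < C by exact: lt_le_trans C1.
have b0 := essbounded_cst m (0 : R).
have H1 : \forall y \ae m, transfer A 1 (fun=> expR 0) y <= C.
  rewrite expR0; have := transfer1_le m_sfinite C1 mbeta beta_bound AE 1.
  by rewrite expr1.
have := tau_n_le m_sfinite mbeta beta_bound AE mu1 mu0 ltr01 C0 b0 H1.
move=> /le_lt_trans/(_ (ltry _)) h; apply: le_lt_trans h.
apply: ereal_inf_lbound; exists 1%N => //.
by rewrite inver oner_eq0 invr1 mule1.
Qed.

Variables (p : R) (p1 : (1 <= p%:E)%E).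
Variable T : LspaceType m p1 -> LspaceType m p1.
Hypothesis TE : forall f : LspaceType m p1, \forall x \ae m, T f x = f (beta x).
Variable psi : Linf m.
Variable psiT : LspaceType m p1 -> LspaceType m p1.
Hypothesis psiTE : forall f : LspaceType m p1,
  \forall x \ae m, (psiT f x : R) = psi x * T f x.

Let pge1 : 1 <= p. Proof. by move: p1; rewrite lee_fin. Qed.

Lemma value_ge (S : set nat) (Lam : R) :
  (forall K, exists2 N, (K <= N)%N & S N) ->
  (forall N, S N -> ((expR (N%:R * Lam))%:E <= Lnorm_op (iter N psiT))%E) ->
  exists2 mu, invariant_fa_prob m beta mu &
    (Lam%:E <= integral_ln m0 mu psi + t_entropy A mu / p%:E)%E.
Proof.
move=> Sinf HS.
have p0 : 0 < p by exact: lt_le_trans pge1.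
have growth N : S N -> exists B, [/\ measurable B, (0 < m B)%E, (m B < +oo)%E &
    expR (N%:R * (p * Lam)) / 2 * fine (m B) <=
    integ m (fun y => cocycle beta (weight p psi) N y * \1_B (iter N beta y))].
  move=> SN; have := Lnorm_op_growth m_sfinite mbeta beta_bound AE TE psiTE
    (expR_gt0 _) (HS N SN).
  by rewrite -expRM -[N%:R * Lam * p]mulrA [Lam * p]mulrC.
have [Phi [mPhi Pinv HPhi]] := limit_mean_exists m0 m_sfinite C1 mbeta beta_bound AE
  (essbounded_weight pge1 psi) (weight_ge0 p psi) Sinf growth.
have [mu imu muPhi] := invariant_mean_content mPhi Pinv.
exists mu => //; have [mu1 mu0 _] := imu.
have bphi l : essbounded m (fun y => ln_trunc l (psi y)).
  by apply: essbounded_ln_trunc; exact: essbounded_Linf.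
(* The bounded majorant of ln w is p times the truncated logarithm. As mu does not depend on l, the
   entropy can be fixed while l grows, which then bounds the integral of ln |psi| from below. *)
have Ht l : ((p * Lam - p * Phi (fun y => ln_trunc l (psi y)))%:E <= t_entropy A mu)%E.
  rewrite -opprB; apply: (t_entropy_ge m_sfinite mbeta beta_bound AE mu1 mu0).
    by move=> f; exact: (content_mean_beta mbeta beta_bound imu).
  move=> n chi n0 bchi Hchi; rewrite muPhi// -(meanZ mPhi)//.
  apply: HPhi => //; first exact: essboundedZ.
  by apply/nearW => y; exact: weight_le_expR.
have := t_entropy_lty imu.
case: (t_entropy A mu) Ht => [t| |] Ht // _; last by have := Ht 0%N; rewrite leeNy_eq.
have : ((Lam - t / p)%:E <= integral_ln m0 mu psi)%E.
  apply: (integral_ln_ge m0 mu1 mu0) => l; rewrite muPhi//.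
  have := Ht l; rewrite lee_fin => h.
  rewrite -(ler_pM2l p0) mulrBr [p * (t / p)]mulrC mulfVK ?gt_eqF//.
  by lra.
rewrite inver gt_eqF// -EFinM.
case: (integral_ln m0 mu psi) => [I|_|]; rewrite ?leeNy_eq//.
  by rewrite -EFinD !lee_fin => ?; lra.
by rewrite addye ?leey.
Qed.

End ValueLowerBound.
Theorem theorem13p1 (R : realType) (d : measure_display) (Y : measurableType d)
  (m : {measure set Y -> \bar R}) (m0 : m [set: Y] != 0%E)
  (m_sfinite : sigma_finite [set: Y] m)
  (beta : Y -> Y) (mbeta : measurable_fun [set: Y] beta)
  (beta_bound : exists C : R,
     forall G : set Y, measurable G -> (m (beta @^-1` G) <= C%:E * m G)%E)
  (p : R) (p1 : (1 <= p%:E)%E)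
  (T : LspaceType m p1 -> LspaceType m p1)
  (TE : forall f : LspaceType m p1, \forall x \ae m, T f x = f (beta x))
  (psi : Linf m)
  (psiT : LspaceType m p1 -> LspaceType m p1)
  (psiTE : forall f : LspaceType m p1,
     \forall x \ae m, (psiT f x : R) = psi x * T f x)
  (A : Linf m -> Linf m)
  (AE : forall (f : Linf m) (g : LspaceType1 m),
     (\int[m]_y ((f y : R) * g (beta y))%:E =
      \int[m]_y ((A f y : R) * g y)%:E)%E) :
  let value (mu : {content set Y -> \bar R}) :=
    (integral_ln m0 mu psi + t_entropy A mu / p%:E)%E in
  [set value mu | mu in invariant_fa_prob m beta] (lne (spectral_radius psiT)) /\
  ubound [set value mu | mu in invariant_fa_prob m beta]
    (lne (spectral_radius psiT)).
Proof.
move=> value; have [C0 HC0] := beta_bound.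
(* A constant at least 1 makes its powers nondecreasing in the exponent, so that C^(j+q) can be
   bounded by C^(2n). *)
pose C := Num.max C0 1.
have C1 : 1 <= C by rewrite le_max lexx orbT.
have HC G : measurable G -> (m (beta @^-1` G) <= C%:E * m G)%E.
  move=> mG; apply: (le_trans (HC0 G mG)); apply: lee_wpmul2r => //.
  by rewrite lee_fin le_max lexx.
have pge1 : 1 <= p by rewrite -lee_fin.
have p0 : 0 < p by exact: lt_le_trans pge1.
pose a N := fine (Lnorm_op (iter N psiT)).
have aE N : Lnorm_op (iter N psiT) = (a N)%:E.
  rewrite fineK// ge0_fin_numE ?Lnorm_op_ge0//.
  exact: (Lnorm_op_lty mbeta HC AE TE psiTE).
have -> : spectral_radius psiT = limn (fun N => (a N)%:E `^ N%:R^-1)%E.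
  by rewrite /spectral_radius; under eq_fun do rewrite aE.
apply: growth_rate_max.
- by move=> N; rewrite -lee_fin -aE Lnorm_op_ge0.
- have [mu imu] := invariant_fa_prob_nonempty m0 m_sfinite mbeta HC.
  by exists (value mu), mu.
- move=> _ N x [mu imu <-] N0 x0 ax.
  apply: (value_le m0 m_sfinite C1 mbeta HC AE pge1) => //.
  apply: (Lnorm_op_ge m_sfinite mbeta HC AE TE psiTE); first exact: ltW.
  by rewrite aE lee_fin.
- move=> Lam S Sinf HS.
  have [|mu imu Hmu] := value_ge m0 m_sfinite C1 mbeta HC AE TE psiTE Sinf (Lam := Lam).
    by move=> N SN; rewrite aE lee_fin HS.
  by exists (value mu) => //; exists mu.
Qed.
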